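(* Let $f:\mathbb{K}\to\mathbb{K}$ be smooth, bounded and globally Lipschitz, with all derivatives of at most polynomial growth at infinity and $f(0)=0$. Assume that $a,b\in\mathcal{D}'(\mathbb{R})$ have discrete support. Let $u\in\mathcal{G}(\mathbb{R}^2)$ be the generalized solution of $$\partial_t^2u-\partial_x^2u=f(u)\ \text{ in }\mathcal{G}(\mathbb{R}^2),\qquad u|_{\{t=0\}}=\iota(a),\quad\partial_tu|_{\{t=0\}}=\iota(b)\ \text{ in }\mathcal{G}(\mathbb{R}).$$ Let $v\in\mathcal{D}'(\mathbb{R}^2)$ be the weak solution of the linear problem $$\partial_t^2v-\partial_x^2v=0\ \text{ on }\mathbb{R}^2,\qquad v(\cdot,0)=a,\quad\partial_tv(\cdot,0)=b\ \text{ on }\mathbb{R},$$ let $S$ be the singular support of $v$ (a set of Lebesgue measure zero), and let $\mathbf{1}_{S^{\mathsf C}}v$ be the almost everywhere defined measurable function equal to $v(x,t)$ for $(x,t)\notin S$. Let $w\in C(\mathbb{R}^2)$ be the unique weak solution of $$\partial_t^2w-\partial_x^2w=f(\mathbf{1}_{S^{\mathsf C}}v+w)\ \text{ on }\mathbb{R}^2,\qquad w(\cdot,0)=0,\quad\partial_tw(\cdot,0)=0\ \text{ on }\mathbb{R}.$$ Then the generalized solution $u$ is associated with the sum of the distribution $v$ and the continuous function $w$, that is, $u\approx\iota(v+w)$.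
   Context: Fix the scalar field $\mathbb{K}\in\{\mathbb{R},\mathbb{C}\}$; all functions (and distributions) are $\mathbb{K}$-valued, and if $\mathbb{K}=\mathbb{C}$, smoothness and derivatives of $f$ are meant in the real sense with $\mathbb{C}\cong\mathbb{R}^2$. Points of $\mathbb{R}^2$ are written $(x,t)$. Colombeau algebra: for open $\Omega\subset\mathbb{R}^n$ consider families $(u_\varepsilon)_{\varepsilon\in(0,1]}$ with $u_\varepsilon\in C^\infty(\Omega)$. The family is moderate, $(u_\varepsilon)\in\mathcal{E}_{\mathrm M}(\Omega)$, if for every compact $K\subset\Omega$ and every $\alpha\in\mathbb{N}_0^n$ there is $p\ge 0$ with $\sup_{x\in K}|\partial^\alpha u_\varepsilon(x)|=O(\varepsilon^{-p})$ as $\varepsilon\to 0$. It is null, $(u_\varepsilon)\in\mathcal{N}(\Omega)$, if for every compact $K\subset\Omega$, every $\alpha\in\mathbb{N}_0^n$ and every $q\ge 0$, $\sup_{x\in K}|\partial^\alpha u_\varepsilon(x)|=O(\varepsilon^{q})$ as $\varepsilon\to0$. Put $\mathcal{G}(\Omega)=\mathcal{E}_{\mathrm M}(\Omega)/\mathcal{N}(\Omega)$. Derivatives are defined on representatives. For $u\in\mathcal{G}(\mathbb{R}^2)$ with representative $(u_\varepsilon)$, the restriction $u|_{\{t=0\}}\in\mathcal{G}(\mathbb{R})$ is the class of $(u_\varepsilon(\cdot,0))_\varepsilon$. If $f$ is smooth and $f$ and all its derivatives are of at most polynomial growth at infinity, $f(u)$ is the (well-defined) class of $(f(u_\varepsilon))_\varepsilon$.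 Imbedding: for $n=1,2$ fix $\varphi\in\mathcal{S}(\mathbb{R}^n)$ (real-valued if $\mathbb{K}=\mathbb{R}$) with $\int\varphi=1$ and $\int x^\alpha\varphi(x)\,dx=0$ for all $|\alpha|\ge1$, put $\varphi_\varepsilon(x)=\varepsilon^{-n}\varphi(x/\varepsilon)$, and fix a compactly supported smooth function $\chi$ on $\mathbb{R}^n$ identically equal to one near $0$. The imbedding $\iota:\mathcal{D}'(\mathbb{R}^n)\to\mathcal{G}(\mathbb{R}^n)$ is $\iota(w)=$ class of $(w*(\chi\varphi_\varepsilon))_\varepsilon$. Association: $u,v\in\mathcal{G}(\Omega)$ with representatives $(u_\varepsilon),(v_\varepsilon)$ are associated, $u\approx v$, if $\lim_{\varepsilon\to0}\int(u_\varepsilon(x)-v_\varepsilon(x))\psi(x)\,dx=0$ for all $\psi\in\mathcal{D}(\Omega)$. $u$ is associated with a distribution $w$ if $u_\varepsilon\to w$ in $\mathcal{D}'(\Omega)$; equivalently $u\approx\iota(w)$. A distribution has discrete support if its support is a (closed) discrete set; it is then locally a finite linear combination of Dirac measures and their derivatives at the points of the support. The linear solution $v$ is given by d'Alembert's formula $v(x,t)=\frac12(a(x-t)+a(x+t))+\frac12\int_{x-t}^{x+t}b(y)\,dy$ in the sense of distributions; its singular support is contained in the union of the characteristic lines of slope $\pm1$ through the points of the supports of $a,b$. The weak solution $w$ is the unique continuous function with $$w(x,t)=\tfrac12\int_0^t\int_{x-t+s}^{x+t-s}f\big((\mathbf{1}_{S^{\mathsf C}}v)(y,s)+w(y,s)\big)\,dy\,ds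 .$$ Under the stated assumptions on $f$ the generalized initial value problem has exactly one solution in $\mathcal{G}(\mathbb{R}^2)$. *)

(* Defs.v *)
From HB Require Import structures.
From mathcomp Require Import all_boot all_order all_algebra.
From mathcomp Require Import all_classical all_reals all_analysis.
From mathcomp.real_closed Require Import complex.

Set Implicit Arguments.
Unset Strict Implicit.
Unset Printing Implicit Defensive.

Import Order.TTheory GRing.Theory Num.Theory.
Import numFieldNormedType.Exports.

Local Open Scope classical_set_scope.
Local Open Scope ring_scope.

(** * Scalars *)

Variant scalar_kind := RealScalars | ComplexScalars.

Definition scalar_field (R : realType) (k : scalar_kind) : numFieldType :=
  match k with
  | RealScalars => (R : numFieldType)
  | ComplexScalars => (R[i] : numFieldType)
  end.

Definition re (R : realType) (k : scalar_kind) : scalar_field R k -> R :=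
  match k with
  | RealScalars => fun z : R => z
  | ComplexScalars => fun z : R[i] => complex.Re z
  end.

Definition im (R : realType) (k : scalar_kind) : scalar_field R k -> R :=
  match k with
  | RealScalars => fun=> 0
  | ComplexScalars => fun z : R[i] => complex.Im z
  end.

(* The scalar with given parts; the imaginary part is dropped over the reals. *)
Definition of_parts (R : realType) (k : scalar_kind) : R -> R -> scalar_field R k :=
  match k with
  | RealScalars => fun x _ => x
  | ComplexScalars => fun x y => Complex x y
  end.

Definition of_real (R : realType) (k : scalar_kind) (x : R) : scalar_field R k :=
  of_parts k x 0.

(* The norm of [R[i]] is [R[i]]-valued; [modulus] is its real value. *)
Definition modulus (R : realType) (k : scalar_kind) (z : scalar_field R k) : R :=
  re `|z|.

(** * The spaces R and R^2 *)

(* A space with coordinates and Lebesgue integration, so that the same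
   definitions serve the line and the plane. *)
Record coord_space (R : realType) := Space {
  space_point :> normedModType R;
  sp_dim : nat;
  sp_axis : 'I_sp_dim -> space_point;
  sp_coord : space_point -> 'I_sp_dim -> R;
  integral_space : (space_point -> R) -> R }.

Definition line (R : realType) : coord_space R :=
  @Space R R 1 (fun=> 1) (fun x _ => x)
    (fun g => \int[lebesgue_measure]_x g x).

Definition plane (R : realType) : coord_space R :=
  @Space R (R * R)%type 2
    (fun i => if i == ord0 then (1, 0) else (0, 1))
    (fun z i => if i == ord0 then z.1 else z.2)
    (fun g => \int[(lebesgue_measure \x lebesgue_measure)%E]_z g z).

(* The axes of [plane], whose points are written (x, t). *)
Definition dir_x (R : realType) : 'I_(sp_dim (plane R)) := @Ordinal 2 0 isT.
Definition dir_t (R : realType) : 'I_(sp_dim (plane R)) := @Ordinal 2 1 isT.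

Section Calculus.
Context {R : realType} {E : coord_space R} {k : scalar_kind}.
Local Notation K := (scalar_field R k).

Definition rpartial (l : seq 'I_(sp_dim E)) (g : E -> R) : E -> R :=
  foldr (fun i h => 'D_(sp_axis i) h) g l.

(* Iterated partial derivatives are indexed by words in the coordinate
   directions; on smooth functions, where the order of differentiation is
   irrelevant, these are the derivatives indexed by multi-indices. *)
Definition partial (l : seq 'I_(sp_dim E)) (u : E -> K) : E -> K :=
  fun x => of_parts k (rpartial l (@re R k \o u) x)
                      (rpartial l (@im R k \o u) x).

Definition rsmooth_on (U : set E) (g : E -> R) : Prop :=
  forall l x, U x ->
    {for x, continuous (rpartial l g)} /\
    forall i, derivable (rpartial l g) x (sp_axis i).

(* Meant for open [U]. *)
Definition smooth_on (U : set E) (u : E -> K) : Prop :=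
  rsmooth_on U (@re R k \o u) /\ rsmooth_on U (@im R k \o u).

Definition smooth (u : E -> K) : Prop := smooth_on setT u.

Definition continuous_scalar (u : E -> K) : Prop :=
  continuous (@re R k \o u) /\ continuous (@im R k \o u).

Definition Kintegral (u : E -> K) : K :=
  of_parts k (integral_space (@re R k \o u)) (integral_space (@im R k \o u)).

Definition monomial (alpha : 'I_(sp_dim E) -> nat) (x : E) : R :=
  \prod_i sp_coord x i ^+ alpha i.

(** * Test functions, distributions, mollifiers *)

Definition supported_in (C : set E) (psi : E -> K) : Prop :=
  forall x, ~ C x -> psi x = 0.

Definition test_in (U : set E) (psi : E -> K) : Prop :=
  smooth psi /\
  exists C : set E, [/\ compact C, C `<=` U & supported_in C psi].

Definition test : (E -> K) -> Prop := test_in setT.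

(* A distribution is represented by a functional on all functions of which
   only the values on test functions are relevant. Continuity is the seminorm
   estimate on each space of test functions supported in a fixed compact set. *)
Definition is_distribution (T : (E -> K) -> K) : Prop :=
  (forall (c : K) psi1 psi2, test psi1 -> test psi2 ->
     T (fun x => c * psi1 x + psi2 x) = c * T psi1 + T psi2) /\
  (forall C : set E, compact C ->
     exists (c : R) (m : nat), forall psi, smooth psi -> supported_in C psi ->
       forall M : R,
         (forall l x, (size l <= m)%N -> modulus (partial l psi x) <= M) ->
         modulus (T psi) <= c * M).

Definition dsupport (T : (E -> K) -> K) : set E :=
  [set x | forall U : set E, open U -> U x ->
     exists psi, test_in U psi /\ T psi != 0].

(* The support is always closed, so only discreteness is required. *)
Definition has_discrete_support (T : (E -> K) -> K) : Prop :=
  dsupport T `<=` isolated (dsupport T).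

Definition of_function (g : E -> K) : (E -> K) -> K :=
  fun psi => Kintegral (fun x => g x * psi x).

Definition equals_on (U : set E) (T : (E -> K) -> K) (g : E -> K) : Prop :=
  forall psi, test_in U psi -> T psi = of_function g psi.

Definition singular_support (T : (E -> K) -> K) : set E :=
  [set x | ~ exists (U : set E) (g : E -> K),
     [/\ open U, U x, smooth_on U g & equals_on U T g]].

(* [g] is the function 1_(S^c) T, S being the singular support of T. *)
Definition regular_part (T : (E -> K) -> K) (g : E -> K) : Prop :=
  [/\ forall x, singular_support T x -> g x = 0,
      smooth_on (~` singular_support T) g
    & equals_on (~` singular_support T) T g].

Definition schwartz (phi : E -> K) : Prop :=
  smooth phi /\
  forall alpha l, exists c : R, forall x,
    `|monomial alpha x| * modulus (partial l phi x) <= c.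

Definition mollifier (phi : E -> K) : Prop :=
  [/\ schwartz phi,
      Kintegral phi = 1
    & forall alpha, (0 < \sum_i alpha i)%N ->
        Kintegral (fun x => of_real k (monomial alpha x) * phi x) = 0].

Definition cutoff (chi : E -> K) : Prop :=
  test chi /\ \forall x \near (0 : E), chi x = 1.

(** * The Colombeau algebra *)

(* [u e] is relevant for [0 < e <= 1] only. *)
Definition eps_family : Type := R -> E -> K.

Definition smooth_family (u : eps_family) : Prop :=
  forall e : R, 0 < e <= 1 -> smooth (u e).

Definition moderate (u : eps_family) : Prop :=
  smooth_family u /\
  forall (C : set E) l, compact C -> exists2 p : R, 0 <= p &
    exists c : R, \forall e \near 0^'+, forall x, C x ->
      modulus (partial l (u e) x) <= c * e `^ (- p).

Definition negligible_family (u : eps_family) : Prop :=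
  smooth_family u /\
  forall (C : set E) l (q : R), compact C -> 0 <= q ->
    exists c : R, \forall e \near 0^'+, forall x, C x ->
      modulus (partial l (u e) x) <= c * e `^ q.

(* The class u + N of a family u. *)
Definition coset (u : eps_family) : set eps_family :=
  [set r | negligible_family (fun e x => r e x - u e x)].

(* The quotient E_M / N, as a set of cosets. *)
Definition colombeau : set (set eps_family) := coset @` moderate.

Definition gsub (U V : set eps_family) : set eps_family :=
  [set r | exists u v, [/\ U u, V v & coset (fun e x => u e x - v e x) r]].

(* The families u_e = T * (chi phi_e), with phi_e(x) = e^-n phi (x / e). *)
Definition regularization (phi chi : E -> K) (T : (E -> K) -> K) :
    eps_family :=
  fun e x => T (fun y => chi (x - y) *
    (of_real k (e ^- sp_dim E) * phi (e^-1 *: (x - y)))).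

Definition embed (phi chi : E -> K) (T : (E -> K) -> K) : set eps_family :=
  coset (regularization phi chi T).

Definition associated (U V : set eps_family) : Prop :=
  forall u v, U u -> V v -> forall psi, test psi ->
    modulus (Kintegral (fun x => (u e x - v e x) * psi x)) @[e --> 0^'+]
      --> (0 : R).

End Calculus.
Arguments eps_family {R} E k.
Arguments colombeau {R} E k.

(* The image of a set of families under an operation on representatives. When
   the operation respects null families and [U] is a coset, this is the coset
   of the image of any representative. *)
Definition glift (R : realType) (E F : coord_space R) (k : scalar_kind)
    (op : eps_family E k -> eps_family F k) (U : set (eps_family E k)) :
    set (eps_family F k) :=
  [set r | exists2 u, U u & coset (op u) r].

Definition gpartial (R : realType) (E : coord_space R) (k : scalar_kind)
    (l : seq 'I_(sp_dim E)) : set (eps_family E k) -> set (eps_family E k) :=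
  glift (fun u e => partial l (u e)).

Definition gcomp (R : realType) (E : coord_space R) (k : scalar_kind)
    (f : scalar_field R k -> scalar_field R k) :
    set (eps_family E k) -> set (eps_family E k) :=
  glift (fun u e x => f (u e x)).

Definition restrict_t0 (R : realType) (k : scalar_kind) :
    set (eps_family (plane R) k) -> set (eps_family (line R) k) :=
  glift (fun (u : eps_family (plane R) k) e (x : line R) =>
    u e ((x, 0) : plane R)).

(** * The nonlinearity *)

(* The scalar field as a real space: R itself, or C identified with R^2. *)
Definition scalar_space (R : realType) (k : scalar_kind) : coord_space R :=
  match k with RealScalars => line R | ComplexScalars => plane R end.

Definition of_coords (R : realType) (k : scalar_kind) :
    scalar_space R k -> scalar_field R k :=
  match k with
  | RealScalars => fun x : R => x
  | ComplexScalars => fun z : R * R => Complex z.1 z.2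
  end.

Definition polynomial_growth (R : realType) (E : coord_space R) (k : scalar_kind)
    (g : E -> scalar_field R k) : Prop :=
  exists (c : R) (m : nat), forall x, modulus (g x) <= c * (1 + `|x|) ^+ m.

Definition admissible (R : realType) (k : scalar_kind)
    (f : scalar_field R k -> scalar_field R k) : Prop :=
  [/\ smooth (f \o @of_coords R k),
      exists M : R, forall z, modulus (f z) <= M,
      exists L : R, forall y z, modulus (f y - f z) <= L * modulus (y - z),
      forall l, polynomial_growth (partial l (f \o @of_coords R k))
    & f 0 = 0].

(** * The linear and the nonlinear wave equation *)

Section Wave.
Context {R : realType} {k : scalar_kind}.
Local Notation K := (scalar_field R k).

Definition rinterval_integral (a b : R) (g : R -> R) : R :=
  if a <= b then \int[lebesgue_measure]_(x in `[a, b]) g x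
  else - \int[lebesgue_measure]_(x in `[b, a]) g x.

(* The oriented integral from [a] to [b]. *)
Definition interval_integral (a b : R) (g : R -> K) : K :=
  of_parts k (rinterval_integral a b (@re R k \o g))
             (rinterval_integral a b (@im R k \o g)).

(* d'Alembert's formula
     v(x,t) = (a(x-t) + a(x+t)) / 2 + 1/2 \int_(x-t)^(x+t) b(y) dy,
   paired with a test function: in the three terms, substitute y = x - t,
   y = x + t, and exchange the integrals in x and y, respectively. *)
Definition dalembert (a b : (line R -> K) -> K) : (plane R -> K) -> K :=
  fun psi =>
    2^-1 * (a (fun y => Kintegral (fun t : line R => psi (y + t, t))) +
            a (fun y => Kintegral (fun t : line R => psi (y - t, t)))) +
    2^-1 * b (fun y => Kintegral (fun t : line R =>
              interval_integral (y - t) (y + t) (fun x => psi (x, t)))).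

Definition linear_solution (a b : (line R -> K) -> K)
    (v : (plane R -> K) -> K) : Prop :=
  is_distribution v /\ forall psi, test psi -> v psi = dalembert a b psi.

(* [u] solves u_tt - u_xx = f(u) with u = A, u_t = B at t = 0, as equalities
   between elements of the Colombeau algebras. *)
Definition generalized_solution (f : K -> K) (A B : set (eps_family (line R) k))
    (u : set (eps_family (plane R) k)) : Prop :=
  [/\ colombeau (plane R) k u,
      gsub (gpartial [:: dir_t R; dir_t R] u)
           (gpartial [:: dir_x R; dir_x R] u) = gcomp f u,
      restrict_t0 u = A
    & restrict_t0 (gpartial [:: dir_t R] u) = B].

(* [w] is the continuous solution, with zero data, of
   w_tt - w_xx = f(g + w), in integrated form. *)
Definition weak_solution (f : K -> K) (g w : plane R -> K) : Prop :=
  continuous_scalar w /\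
  forall x t : R, w (x, t) = 2^-1 *
    interval_integral 0 t (fun s =>
      interval_integral (x - t + s) (x + t - s) (fun y =>
        f (g (y, s) + w (y, s)))).

End Wave.

(* Main.v *)
(* Write u_e = v_e + w_e, where v_e is given by d'Alembert's formula from the
   Cauchy data of u_e, and w_e is half the integral of u_tt - u_xx over the
   domain of dependence. Paired with a test function, d'Alembert's formula is
   transposed to the test function, so that v_e tends to v. Off the
   characteristics through the supports of a and b the data are O(e), hence v_e
   oscillates by O(e) only, and its limit can only be the regular part of v.
   Discrete sets being countable, these characteristics form a null set, and
   v_e tends to 1_(S^c) v almost everywhere. As f is bounded, dominated
   convergence gives f(v_e + w) -> f(1_(S^c) v + w) in L^1 on compact sets, and
   Gronwall's argument with the Lipschitz constant of f gives w_e -> w uniformly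
   on compact sets. *)

From HB Require Import structures.
From mathcomp Require Import all_boot all_order all_algebra.
From mathcomp Require Import all_classical all_reals all_analysis measurable_realfun.
From mathcomp.real_closed Require Import complex.
From mathcomp Require Import ring lra.
Require Import Defs.
Set Implicit Arguments.
Unset Strict Implicit.
Unset Printing Implicit Defensive.
Import Order.TTheory GRing.Theory Num.Theory.
Import numFieldNormedType.Exports.
Local Open Scope classical_set_scope.
Local Open Scope ring_scope.

(** * Calculus of one variable *)

Notation mu := lebesgue_measure.
Notation ri := rinterval_integral.

Section OneVariable.
Context {R : realType}.
Implicit Types (f g F G : R -> R) (a b c x y : R).

(** The equation holds in a quotient, so a representative satisfies it up to a null family only: the
    nonlinear part is the integral of [wave_op (u e)], and its O(e) distance from [f (u e)] enters
    Gronwall's argument as a source.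

    The values of v_e off the characteristics cannot be estimated directly, because d'Alembert's
    integral may run across points of the support of [b], where the data are not bounded in e. Only
    differences of values at nearby points are controlled, since they see the data near the feet of
    the characteristics alone.

    The difference f(v_e + w) - f(1_(S^c) v + w) is the one error without a rate. It tends to zero
    pointwise only, so it is measured in L^1 over a fixed square that contains all domains of
    dependence in question; this makes it uniform in the vertex. As 1_(S^c) v is merely measurable,
    the iterated integral of the weak solution has to be identified with an integral over a triangle
    in the plane before it can be compared with anything.

    Regularization is needed twice, on the line for the data and on the plane for v + w;
    [space_calculus] lets one argument serve both. *)

Lemma is_derive_continuous f df x : is_derive x 1 f df -> {for x, continuous f}.
Proof.
move=> [? _]; apply: (@differentiable_continuous R R R x f).
exact/derivable1_diffP.
Qed.

Lemma continuous_integrable_itv f a b : continuous f ->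
  mu.-integrable `[a, b] (EFin \o f).
Proof.
move=> cf; apply: continuous_compact_integrable; first exact: segment_compact.
by apply: continuous_subspaceT => x; exact: cf.
Qed.

Lemma ri_oppC f a b : ri b a f = - ri a b f.
Proof.
rewrite /rinterval_integral.
have [ab|ba|->] := ltrgtP a b; rewrite ?opprK //.
by rewrite set_itv1 Rintegral_set1 oppr0.
Qed.

Lemma ri_eq f g a b : (forall x, a <= x <= b \/ b <= x <= a -> f x = g x) ->
  ri a b f = ri a b g.
Proof.
move=> fg; rewrite /rinterval_integral.
case: ifP => _; [|congr (- _)]; apply: eq_Rintegral => x;
  rewrite inE /= in_itv /= => h; apply: fg; [by left|by right].
Qed.

(** No order between [a] and [b] is assumed. Together with [primitive_exists] this reduces many
    identities between oriented integrals to identities between values of a primitive. *)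
Lemma ri_FTC f F a b : continuous f -> (forall x, is_derive x 1 F (f x)) ->
  ri a b f = F b - F a.
Proof.
move=> cf dF.
have key x y : x < y -> \int[mu]_(t in `[x, y]) f t = F y - F x.
  move=> xy; rewrite /Rintegral (@continuous_FTC2 _ f F) //.
  - by apply: continuous_subspaceT => z; exact: cf.
  - split.
    + by move=> z _; case: (dF z).
    + by apply: cvg_at_right_filter; exact: is_derive_continuous.
    + by apply: cvg_at_left_filter; exact: is_derive_continuous.
  - by move=> z _; rewrite derive1E; case: (dF z).
rewrite /rinterval_integral; have [ab|ba|->] := ltrgtP a b.
- exact: key.
- by rewrite key // opprB.
- by rewrite set_itv1 Rintegral_set1 subrr.
Qed.

Lemma ri_chasles_le f x y z : continuous f -> x <= y -> y <= z ->
  \int[mu]_(t in `[x, z]) f t =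
  \int[mu]_(t in `[x, y]) f t + \int[mu]_(t in `[y, z]) f t.
Proof.
move=> cf xy yz.
rewrite -[in RHS](@Rintegral_itv_obnd_cbnd _ y).
  rewrite -(@Rintegral_itvB _ f (BLeft x) (BRight z) y) ?bnd_simp //.
    by rewrite addrC subrK.
  exact: continuous_integrable_itv.
apply: (integrableS _ _ _ (continuous_integrable_itv y z cf)) => //.
by apply: subset_itvr; rewrite bnd_simp.
Qed.

Lemma ri_derive f a x : continuous f ->
  is_derive x 1 (fun y => ri a y f) (f x).
Proof.
(* The base point [m] lies to the left of both [a] and [x], so that near [x] the oriented integral
   is a difference of two ordinary integrals from [m], whatever the order of [a] and [x]. *)
move=> cf; pose m := Num.min a x - 1.
have ma : m <= a by rewrite /m lerBlDr ge_min lerDl ler01.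
have mx : m < x.
  by rewrite /m ltrBlDr gt_min !ltrDl ltr01 orbT.
pose P y := \int[mu]_(t in `[m, y]) f t.
have [dP vP] := @continuous_FTC1_closed _ f m x (x + 1) (ltr_pwDr ltr01 (lexx x))
  (continuous_integrable_itv _ _ cf) mx (cf x).
have PE y : m < y -> ri a y f = P y - P a.
  move=> my; rewrite /rinterval_integral /P; case: ifP => [ay|/negbT].
    by rewrite (ri_chasles_le cf ma ay) addrC addKr.
  rewrite -ltNge => /ltW ya; rewrite (ri_chasles_le cf (ltW my) ya).
  by rewrite opprD addNKr.
have dPa : is_derive x 1 (fun y => P y - P a) (f x).
  have h1 : is_derive x 1 P (f x).
    exact: (DeriveDef dP (etrans (esym (derive1E P x)) vP)).
  have h2 : is_derive x 1 (cst (P a)) (0 : R) by exact: is_derive_cst.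
  have := is_deriveB h1 h2; rewrite subr0; exact.
apply: near_eq_is_derive dPa.
by near=> y; rewrite PE //; near: y; exact: lt_nbhsr.
Unshelve. all: by end_near. Qed.

Lemma primitive_exists f : continuous f ->
  exists F, forall x, is_derive x 1 F (f x).
Proof. by move=> cf; exists (fun y => ri 0 y f) => x; exact: ri_derive. Qed.

Lemma ri_chasles f a b c : continuous f -> ri a c f = ri a b f + ri b c f.
Proof.
move=> cf; have [F dF] := primitive_exists cf.
by rewrite !(ri_FTC _ _ cf dF) [RHS]addrC addrA subrK.
Qed.

Lemma rixx f a : ri a a f = 0.
Proof. by rewrite /rinterval_integral lexx set_itv1 Rintegral_set1. Qed.

Lemma riD f g a b : continuous f -> continuous g ->
  ri a b (fun x => f x + g x) = ri a b f + ri a b g.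
Proof.
move=> cf cg; rewrite /rinterval_integral.
by case: ifP => _; rewrite RintegralD ?opprD //; exact: continuous_integrable_itv.
Qed.

Lemma riZ f c a b : continuous f -> ri a b (fun x => c * f x) = c * ri a b f.
Proof.
move=> cf; rewrite /rinterval_integral; case: ifP => _;
  rewrite RintegralZl ?mulrN //; exact: continuous_integrable_itv.
Qed.

Lemma riN f a b : continuous f -> ri a b (fun x => - f x) = - ri a b f.
Proof.
move=> cf; rewrite -mulN1r -riZ //; congr (ri _ _ _).
by apply/funext => x; rewrite mulN1r.
Qed.

Lemma riB f g a b : continuous f -> continuous g ->
  ri a b (fun x => f x - g x) = ri a b f - ri a b g.
Proof.
move=> cf cg; rewrite riD ?riN // => x; apply: continuousN; exact: cg.
Qed.

Lemma ri_cst c a b : ri a b (fun=> c) = c * (b - a).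
Proof.
have dF x : is_derive x 1 (fun x => c * x) c.
  by have := is_deriveZ c (is_derive_id x (1 : R)); rewrite /GRing.scale /= mulr1.
by rewrite (ri_FTC a b _ dF) ?mulrBr // => x; exact: cvg_cst.
Qed.

Lemma ri_norm_le f a b (C : R) : mu.-integrable `[a, b] (EFin \o f) ->
  mu.-integrable `[b, a] (EFin \o f) ->
  (forall x, a <= x <= b \/ b <= x <= a -> `|f x| <= C) ->
  `|ri a b f| <= C * `|b - a|.
Proof.
have key x y : x <= y -> mu.-integrable `[x, y] (EFin \o f) ->
    (forall z, x <= z <= y -> `|f z| <= C) ->
    `|\int[mu]_(t in `[x, y]) f t| <= C * (y - x).
  move=> xy fi fC; apply: (le_trans (le_normr_Rintegral _ fi)) => //.
  have -> : C * (y - x) = \int[mu]_(t in `[x, y]) C.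
    rewrite Rintegral_cst //= lebesgue_measure_itv /= lte_fin.
    by move: xy; rewrite le_eqVlt => /orP[/eqP->|->] //; rewrite ltxx subrr mulr0.
  apply: le_Rintegral => //; first exact: integrable_norm.
  by apply: continuous_integrable_itv => z; exact: cvg_cst.
move=> fi1 fi2 fC; rewrite /rinterval_integral; case: ifP => [ab|/negbT].
  rewrite [X in _ * X]ger0_norm ?subr_ge0 //; apply: key => // z zab; apply: fC; by left.
rewrite -ltNge => /ltW ba; rewrite normrN [X in _ * X]ler0_norm ?subr_le0 // opprB.
by apply: key => // z zab; apply: fC; right.
Qed.

Lemma ri_le f a b (C : R) : continuous f ->
  (forall x, a <= x <= b \/ b <= x <= a -> `|f x| <= C) ->
  `|ri a b f| <= C * `|b - a|.
Proof. by move=> cf; apply: ri_norm_le; exact: continuous_integrable_itv. Qed.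

Lemma mean_value f (f' : R -> R) a b : (forall x, is_derive x 1 f (f' x)) ->
  exists2 c, a <= c <= b \/ b <= c <= a & f b - f a = f' c * (b - a).
Proof.
move=> df.
have cf u v : {within `[u, v], continuous f}.
  by apply: continuous_subspaceT => z; exact: is_derive_continuous.
have [ab|/ltW ba] := leP a b.
  have [c cab E] := MVT_segment ab (fun x _ => df x) (cf a b).
  by exists c => //; left; move: cab; rewrite in_itv.
have [c cab E] := MVT_segment ba (fun x _ => df x) (cf b a).
exists c; first by right; move: cab; rewrite in_itv.
by rewrite -opprB E -mulrN opprB.
Qed.

Lemma mean_value_le f (f' : R -> R) a b (C : R) : (forall x, is_derive x 1 f (f' x)) ->
  (forall x, a <= x <= b \/ b <= x <= a -> `|f' x| <= C) ->
  `|f b - f a| <= C * `|b - a|.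
Proof.
move=> df fC; have [c cab ->] := mean_value a b df.
by rewrite normrM ler_wpM2r // fC.
Qed.

Lemma is_derive_affine f df c d x : is_derive (c * x + d) 1 f df ->
  is_derive x 1 (fun y => f (c * y + d)) (c * df).
Proof.
move=> hf.
have da : is_derive x 1 (fun y => c * y + d) c.
  have h1 := is_deriveZ c (is_derive_id x (1 : R)).
  have h2 : is_derive x 1 (cst d) (0 : R) by exact: is_derive_cst.
  have := is_deriveD h1 h2.
  by rewrite addr0 /GRing.scale /= mulr1; exact.
have [d1 v1] := hf; have [d2 v2] := da.
apply: DeriveDef.
  apply/derivable1_diffP; apply: (@differentiable_comp _ _ _ _ (fun y => c * y + d) f).
    exact: (proj1 (derivable1_diffP _ _) d2).
  exact: (proj1 (derivable1_diffP f (c * x + d)) d1).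
have := @derive1_comp R (fun y => c * y + d) f x d2 d1.
by rewrite !derive1E v1 v2 mulrC.
Qed.

(** Both sides are increments of one primitive. With the factor [c] kept on the left, the identity
    also holds for [c = 0] and for negative [c]; [continuous_ri_endpoint] relies on this. *)
Lemma ri_affine f a b c d : continuous f ->
  c * ri a b (fun x => f (c * x + d)) = ri (c * a + d) (c * b + d) f.
Proof.
move=> cf; have [F dF] := primitive_exists cf.
rewrite (ri_FTC _ _ cf dF) -riZ; last first.
  move=> x; apply: (@continuous_comp _ _ _ (fun x => c * x + d) f); last exact: cf.
  by apply: cvgD; [apply: cvgM; [exact: cvg_cst|exact: cvg_id]|exact: cvg_cst].
have dG x : is_derive x 1 (fun x => F (c * x + d)) (c * f (c * x + d)).
  exact: is_derive_affine.
rewrite (ri_FTC a b _ dG) // => x.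
apply: cvgM; first exact: cvg_cst.
apply: (@continuous_comp _ _ _ (fun x => c * x + d) f); last exact: cf.
by apply: cvgD; [apply: cvgM; [exact: cvg_cst|exact: cvg_id]|exact: cvg_cst].
Qed.

Lemma ri_shift f a b d : continuous f ->
  ri a b (fun x => f (x + d)) = ri (a + d) (b + d) f.
Proof.
move=> cf; have := @ri_affine f a b 1 d cf; rewrite !mul1r => <-.
by congr (ri _ _ _); apply/funext => x; rewrite mul1r.
Qed.

End OneVariable.

(** * Continuity and parametric integrals *)

Section Continuity.
Context {X Y Z : topologicalType}.

Lemma continuousT_comp (g : Y -> Z) (f : X -> Y) :
  continuous g -> continuous f -> continuous (fun x => g (f x)).
Proof. by move=> cg cf x; apply: continuous_comp; [exact: cf|exact: cg]. Qed.

Lemma continuousT_pair (f : X -> Y) (g : X -> Z) :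
  continuous f -> continuous g -> continuous (fun x => (f x, g x)).
Proof.
by move=> cf cg x; apply: (@cvg_pair X Y Z (nbhs x) (nbhs (f x)) (nbhs (g x)));
  [exact: cf|exact: cg].
Qed.

Lemma continuousT_id : continuous (fun x : X => x).
Proof. by move=> x; exact: cvg_id. Qed.

Lemma continuousT_cst (y : Y) : continuous (fun _ : X => y).
Proof. by move=> x; exact: cvg_cst. Qed.

Lemma continuousT_fst (f : X -> Y * Z) :
  continuous f -> continuous (fun x => (f x).1).
Proof. by move=> cf x; apply: (cvg_comp _ _ (cf x)); exact: cvg_fst. Qed.

Lemma continuousT_snd (f : X -> Y * Z) :
  continuous f -> continuous (fun x => (f x).2).
Proof. by move=> cf x; apply: (cvg_comp _ _ (cf x)); exact: cvg_snd. Qed.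

End Continuity.

Section ContinuityNormed.
Context {R : realType} {V : normedModType R} {X : topologicalType}.
Implicit Types (f g : X -> V).

Lemma continuousT_add f g : continuous f -> continuous g ->
  continuous (fun x => f x + g x).
Proof. by move=> cf cg x; apply: cvgD; [exact: cf|exact: cg]. Qed.

Lemma continuousT_opp f : continuous f -> continuous (fun x => - f x).
Proof. by move=> cf x; apply: cvgN; exact: cf. Qed.

Lemma continuousT_scale (k : X -> R) f : continuous k -> continuous f ->
  continuous (fun x => k x *: f x).
Proof. by move=> ck cf x; apply: cvgZ; [exact: ck|exact: cf]. Qed.

Lemma continuousT_mul (f g : X -> R) : continuous f -> continuous g ->
  continuous (fun x => f x * g x).
Proof. by move=> cf cg x; apply: cvgM; [exact: cf|exact: cg]. Qed.

Lemma continuousT_norm f : continuous f -> continuous (fun x => `|f x|).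
Proof. by move=> cf x; apply: cvg_norm; exact: cf. Qed.

End ContinuityNormed.

Ltac cont := repeat first [ assumption | progress cbv beta | match goal with
  | |- continuous (fun x => x) => exact: continuousT_id
  | |- continuous -%R => exact: (continuousT_opp continuousT_id)
  | |- continuous ( +%R ?c) => exact: (continuousT_add (@continuousT_cst _ _ c) continuousT_id)
  | |- continuous ( *%R ?c) => exact: (continuousT_mul (@continuousT_cst _ _ c) continuousT_id)
  | |- continuous ( *:%R ?c) => exact: (continuousT_scale (@continuousT_cst _ _ c) continuousT_id)
  | |- continuous fst => exact: (continuousT_fst continuousT_id)
  | |- continuous snd => exact: (continuousT_snd continuousT_id)
  | |- continuous (fun x => (_, _)) => apply: continuousT_pair
  | |- continuous (fun x => _.1) => apply: continuousT_fst
  | |- continuous (fun x => _.2) => apply: continuousT_snd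
  | |- continuous (fun x => _ + _) => apply: continuousT_add
  | |- continuous (fun x => - _) => apply: continuousT_opp
  | |- continuous (fun x => _ * _) => apply: continuousT_mul
  | |- continuous (fun x => _ *: _) => apply: continuousT_scale
  | |- continuous (fun x => `|_|) => apply: continuousT_norm
  | |- continuous _ => exact: continuousT_cst
  end ].

(** * Directional derivatives *)

Section DirectionalDerivative.
Context {R : realType} {V : normedModType R}.
Implicit Types (f g : V -> R) (x y v : V).

Lemma nbhs_normE (x : V) (P : set V) :
  nbhs x P <-> exists2 d : R, 0 < d & forall y, `|y - x| < d -> P y.
Proof.
split=> [/nbhs_ballP[d /= d0 dP]|[d d0 dP]].
  by exists d => // y yx; apply: dP; rewrite -ball_normE /= distrC.
by apply/nbhs_ballP; exists d => //= y; rewrite -ball_normE /= distrC; exact: dP.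
Qed.

(** The first order expansion with an explicit error, free of division by [h]: this is the form in
    which estimates of integrals and of distributions deliver a derivative. *)
Lemma is_derive_littleo f y v (d : R) :
  (forall e : R, 0 < e -> exists2 r : R, 0 < r &
    forall h : R, `|h| < r -> `|f (h *: v + y) - f y - h * d| <= e * `|h|) ->
  is_derive y v f d.
Proof.
move=> H.
have cv : (fun h : R => h^-1 *: ((f \o shift y) (h *: v) - f y)) @ 0^' --> d.
  apply/cvgrPdist_le => e e0; have [r r0 Hr] := H e e0.
  rewrite near_withinE; apply/nbhs_ballP; exists r => //= h.
  rewrite -ball_normE /= sub0r normrN => hr h0.
  have -> : d - h^-1 *: (f (h *: v + y) - f y) =
      - (h^-1 * (f (h *: v + y) - f y - h * d)).
    by rewrite /GRing.scale /=; field.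
  rewrite normrN normrM normfV mulrC ler_pdivrMr ?normr_gt0 //.
  exact: Hr.
by apply: DeriveDef; [apply/cvg_ex; exists d|apply/cvg_lim => //; exact: Rhausdorff].
Qed.

(** Restricting [f] to the line through [y] in direction [v], at an arbitrary parameter [h] and not
    only at 0, makes the mean value theorem available along whole segments. *)
Lemma is_derive_lineE f y v (h d : R) :
  is_derive (h *: v + y) v f d <-> is_derive h 1 (fun s : R => f (s *: v + y)) d.
Proof.
have E : (fun s : R => s^-1 *: ((f \o shift (h *: v + y)) (s *: v) - f (h *: v + y))) =
   (fun s : R => s^-1 *: (((fun s : R => f (s *: v + y)) \o shift h) (s *: (1:R)) -
      (fun s : R => f (s *: v + y)) h)).
  apply/funext => s /=; congr (_ *: (f _ - _)).
  by rewrite scalerDl /GRing.scale /= mulr1 addrA.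
split=> -[D1 D2]; apply: DeriveDef.
- by move: D1; rewrite /derivable E.
- by move: D2; rewrite /derive E.
- by move: D1; rewrite /derivable -E.
- by move: D2; rewrite /derive -E.
Qed.

Lemma is_derive_comp_affine f y v (c : R) (p : V) (d : R) :
  is_derive (c *: y + p) v f d -> is_derive y v (fun z => f (c *: z + p)) (c * d).
Proof.
move=> df; rewrite -[y]add0r -(scale0r v) is_derive_lineE.
have := df; rewrite -[_ + p]add0r -(scale0r v) is_derive_lineE.
rewrite -[in X in is_derive X](mulr0 c) -[c * 0]addr0.
move/is_derive_affine; congr (is_derive _ _ _ _).
  by rewrite mulr0 addr0.
apply/funext => s; congr f.
by rewrite addr0 scalerDr scalerA addrA.
Qed.

End DirectionalDerivative.

Lemma between_dist (R : realType) (u c d : R) :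
  u <= c <= d \/ d <= c <= u -> `|c - u| <= `|d - u|.
Proof.
case=> /andP[h1 h2].
  by rewrite !ger0_norm ?subr_ge0 ?lerD2r // (le_trans h1).
by rewrite !ler0_norm ?subr_le0 ?lerN2 ?lerD2r // (le_trans h1).
Qed.

(** A tube lemma. Near each [(s, x)] both [F t y] and [F t x] are within [e / 2] of [F s x], and
    compactness leaves finitely many neighbourhoods of [x] to intersect. *)
Lemma uniform_on_compact {R : realType} {Y X : topologicalType} (F : Y -> X -> R) (K : set Y)
    (x : X) (e : R) :
  compact K -> continuous (fun p : Y * X => F p.1 p.2) -> 0 < e ->
  \forall y \near x, forall s, K s -> `|F s y - F s x| <= e.
Proof.
move=> cK cF e0.
have /compact_near_coveringP/(_ X (nbhs x) (fun y s => `|F s y - F s x| <= e) _) := cK.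
apply => s _.
have e20 : 0 < e / 2 by rewrite divr_gt0.
have /cvgrPdist_le/(_ _ e20) c1 := cF (s, x).
have cFx : continuous (F ^~ x).
  apply: (continuousT_comp cF) (continuousT_pair _ _); first exact: continuousT_id.
  exact: continuousT_cst.
have /cvgrPdist_le/(_ _ e20) c2 := cFx s.
case: c1 => /= -[A B] /= [nA nB] AB.
exists (A `&` [set t | `|F s x - F t x| <= e / 2], B) => /=.
  by split => //; exact: filterI.
move=> [t y] /= [[At h2] By].
have h1 := AB (t, y) (conj At By).
rewrite (_ : F t y - F t x = - (F s x - F t y) + (F s x - F t x)); last by ring.
by rewrite (le_trans (ler_normD _ _)) // normrN [e]splitr lerD.
Qed.

Section ParametricIntegral.
Context {R : realType}.

Lemma continuous_uncurry_fst {X : topologicalType} (F : R -> X -> R) x :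
  continuous (fun p : R * X => F p.1 p.2) -> continuous (F ^~ x).
Proof.
move=> cF; apply: (continuousT_comp cF) (continuousT_pair _ _); first exact: continuousT_id.
exact: continuousT_cst.
Qed.

Lemma uniform_on_segment {X : topologicalType} (F : R -> X -> R) (a b : R) (x : X) (e : R) :
  continuous (fun p : R * X => F p.1 p.2) -> 0 < e ->
  \forall y \near x, forall s, a <= s <= b -> `|F s y - F s x| <= e.
Proof.
move=> cF e0; have := @uniform_on_compact R _ X F _ x e (@segment_compact R a b) cF e0.
by apply: filterS => y H s sab; apply: H; rewrite /= in_itv.
Qed.

Lemma continuous_param_ri {X : topologicalType} (F : R -> X -> R) (a b : R) :
  continuous (fun p : R * X => F p.1 p.2) -> continuous (fun x => ri a b (F ^~ x)).
Proof.
move=> cF x; apply/cvgrPdist_le => e e0.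
(* The summand 1 keeps the denominator positive when [a = b]. The uniform estimate is taken on both
   [[a, b]] and [[b, a]] because the orientation is not known. *)
have e1 : 0 < e / (1 + `|b - a|) by rewrite divr_gt0 // ltr_pwDl.
have U1 := @uniform_on_segment X F a b x _ cF e1.
have U2 := @uniform_on_segment X F b a x _ cF e1.
near=> y.
rewrite -riB; [|exact: continuous_uncurry_fst..].
apply: (@le_trans _ _ (e / (1 + `|b - a|) * `|b - a|)).
  apply: ri_le; first by move=> s; apply: cvgB; exact: continuous_uncurry_fst.
  move=> s [sab|sab]; rewrite distrC; move: s sab; near: y => //.
by rewrite mulrAC ler_pdivrMr ?ltr_pwDl // ler_wpM2l ?(ltW e0) // lerDr.
Unshelve. all: by end_near. Qed.

(** Differentiation under the integral sign. For each [s] the mean value theorem turns the increment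
    into [h * dF s] at an intermediate point, and joint continuity of [dF] makes the resulting error
    uniform in [s] over the segment. *)
Lemma is_derive_param_ri {V : normedModType R} (F dF : R -> V -> R) (a b : R) (y v : V) :
  (forall s z, is_derive z v (F s) (dF s z)) ->
  (forall z, continuous (F ^~ z)) ->
  continuous (fun p : R * V => dF p.1 p.2) ->
  is_derive y v (fun z => ri a b (F ^~ z)) (ri a b (dF ^~ y)).
Proof.
move=> DF cF cdF; apply: is_derive_littleo => e e0.
have e1 : 0 < e / (1 + `|b - a|) by rewrite divr_gt0 // ltr_pwDl.
have U1 := @uniform_on_segment V dF a b y _ cdF e1.
have U2 := @uniform_on_segment V dF b a y _ cdF e1.
have [r r0 Hr] := proj1 (nbhs_normE _ _) (filterI U1 U2).
exists (r / (1 + `|v|)); first by rewrite divr_gt0 // ltr_pwDl.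
move=> h hr.
have cdy := @continuous_uncurry_fst V dF y cdF.
have ch : continuous (fun s => h * dF s y) by move=> s; apply: cvgM; [exact: cvg_cst|exact: cdy].
have cB : continuous (fun s => F s (h *: v + y) - F s y).
  by move=> s; apply: cvgB; exact: cF.
rewrite -riB // -riZ // -riB //.
apply: (@le_trans _ _ (e / (1 + `|b - a|) * `|h| * `|b - a|)); last first.
  rewrite -mulrA mulrCA mulrC ler_wpM2r // mulrAC ler_pdivrMr ?ltr_pwDl //.
  by rewrite ler_wpM2l ?(ltW e0) // lerDr.
apply: ri_le; first by move=> s; apply: cvgB; [exact: cB|exact: ch].
move=> s sab.
have dl (t : R) : is_derive t 1 (fun t : R => F s (t *: v + y)) (dF s (t *: v + y)).
  by rewrite -is_derive_lineE.
have [c ch0] := mean_value 0 h dl.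
rewrite scale0r add0r subr0 => ->.
rewrite [h * _]mulrC -mulrBl normrM ler_wpM2r //.
have cr : `|c *: v + y - y| < r.
  rewrite addrK normrZ.
  have := between_dist ch0; rewrite !subr0.
  move=> chn; apply: (@le_lt_trans _ _ (`|h| * (1 + `|v|))).
    by rewrite (le_trans (ler_wpM2r _ chn)) // ler_wpM2l // lerDr.
  by rewrite -ltr_pdivlMr // ltr_pwDl.
by have [H1 H2] := Hr _ cr; case: sab => sab; [exact: H1|exact: H2].
Qed.

(** The chain rule from continuous partial derivatives. The increment is split along two sides of a
    coordinate rectangle; the mean value theorem on each side gives partial derivatives at points
    within [(|al| + |be|) |h|] of the base point. *)
Lemma is_derive_along_line (F Fx Ft : R * R -> R) (p q al be s : R) :
  (forall z, is_derive z ((1, 0) : R * R) F (Fx z)) ->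
  (forall z, is_derive z ((0, 1) : R * R) F (Ft z)) ->
  continuous Fx -> continuous Ft ->
  is_derive s 1 (fun s => F (p + al * s, q + be * s))
    (al * Fx (p + al * s, q + be * s) + be * Ft (p + al * s, q + be * s)).
Proof.
move=> dFx dFt cFx cFt; set a := p + al * s; set b := q + be * s.
apply: is_derive_littleo => e e0.
have C0 : 0 < 1 + `|al| + `|be| by rewrite -addrA ltr_pwDl // addr_ge0.
have e1 : 0 < e / (1 + `|al| + `|be|) by rewrite divr_gt0.
have /cvgrPdist_le/(_ _ e1) U1 := cFx (a, b).
have /cvgrPdist_le/(_ _ e1) U2 := cFt (a, b).
have [r r0 Hr] := proj1 (nbhs_normE _ _) (filterI U1 U2).
exists (r / (1 + `|al| + `|be|)); first by rewrite divr_gt0.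
move=> h hr.
have -> : (p + al * (h *: (1:R) + s), q + be * (h *: (1:R) + s)) = (a + al * h, b + be * h).
  by rewrite /a /b /GRing.scale /=; congr pair; ring.
have dl1 c (t : R) : is_derive t 1 (fun t : R => F (t, c)) (Fx (t, c)).
  have := (proj1 (is_derive_lineE F ((0, c) : R * R) ((1, 0) : R * R) t (Fx (t, c)))).
  have E u : u *: ((1, 0) : R * R) + (0, c) = (u, c).
    by rewrite [LHS]surjective_pairing /= [u *: 0]mulr0 [u *: 1]mulr1 addr0 add0r.
  by rewrite E => /(_ (dFx _)); under eq_fun do rewrite E.
have dl2 c (t : R) : is_derive t 1 (fun t : R => F (c, t)) (Ft (c, t)).
  have := (proj1 (is_derive_lineE F ((c, 0) : R * R) ((0, 1) : R * R) t (Ft (c, t)))).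
  have E u : u *: ((0, 1) : R * R) + (c, 0) = (c, u).
    by rewrite [LHS]surjective_pairing /= [u *: 0]mulr0 [u *: 1]mulr1 addr0 add0r.
  by rewrite E => /(_ (dFt _)); under eq_fun do rewrite E.
have [x hx Ex] := mean_value a (a + al * h) (dl1 (b + be * h)).
have [t ht Et] := mean_value b (b + be * h) (dl2 a).
have -> : F (a + al * h, b + be * h) - F (a, b) - h * (al * Fx (a, b) + be * Ft (a, b)) =
   - (al * h * (Fx (a, b) - Fx (x, b + be * h))) - be * h * (Ft (a, b) - Ft (a, t)).
  transitivity (F (a + al * h, b + be * h) - F (a, b + be * h) + (F (a, b + be * h) - F (a, b)) - h * (al * Fx (a, b) + be * Ft (a, b))); first by ring.
  by rewrite Ex Et; ring.
have near0 c k u : `|k| <= `|al| + `|be| -> u <= c <= u + k * h \/ u + k * h <= c <= u ->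
    `|c - u| < r.
  move=> kle /between_dist; rewrite addrAC subrr add0r normrM.
  move=> /le_lt_trans; apply; apply: (@le_lt_trans _ _ (`|h| * (1 + `|al| + `|be|))).
    by rewrite mulrC ler_wpM2l // (le_trans kle) // -addrA lerDr.
  by rewrite -ltr_pdivlMr.
have h1 : `|(x, b + be * h) - (a, b)| < r.
  rewrite prod_normE /= gt_max (near0 _ _ _ _ hx) ?lerDl //=.
  by apply: (near0 _ be); rewrite ?lerDr //; case: (leP 0 (be * h)) => bh; [left|right];
    rewrite ?lexx ?andbT ?lerDl ?gerDl // ltW.
have h2 : `|(a, t) - (a, b)| < r.
  rewrite prod_normE /= gt_max (near0 _ _ _ _ ht) ?lerDr // andbT.
  by rewrite subrr normr0.
have {}h1 := (Hr _ h1).1; have {}h2 := (Hr _ h2).2.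
apply: (le_trans (ler_normB _ _)); rewrite normrN !normrM.
apply: (@le_trans _ _ (`|al| * `|h| * (e / (1 + `|al| + `|be|)) + `|be| * `|h| * (e / (1 + `|al| + `|be|)))).
  by rewrite lerD // ler_wpM2l // mulr_ge0.
rewrite -mulrDl -mulrDl mulrAC ler_wpM2r //.
rewrite mulrCA ger_pMr // ler_pdivrMr // mul1r.
by rewrite -addrA lerDr.
Qed.

End ParametricIntegral.

(** * Smooth functions *)

(* Sealed, because unfolding [rsmooth_on] makes trivial tactics very slow. *)
HB.lock Definition rsmooth (R : realType) (E : coord_space R) (g : E -> R) : Prop :=
  rsmooth_on setT g.

Section Smooth.
Context {R : realType} {E : coord_space R}.
Implicit Types (f g : E -> R) (l : seq 'I_(sp_dim E)) (i : 'I_(sp_dim E)).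
Local Notation D i g := ('D_(sp_axis i) g).

Lemma rsmoothE g : rsmooth g <-> rsmooth_on setT g.
Proof. by rewrite unlock. Qed.

Lemma rpartial_rcons l i g : rpartial (rcons l i) g = rpartial l (D i g).
Proof. by rewrite /rpartial -cats1 foldr_cat. Qed.

(** A coinduction principle: a class of continuous functions that is stable under the partial
    derivatives consists of smooth functions, by induction on the word of directions. Smoothness can
    thus be proved without a formula for iterated derivatives. *)
Lemma rsmoothP (P : (E -> R) -> Prop) :
  (forall g, P g -> continuous g /\
     forall i, (forall x, derivable g x (sp_axis i)) /\ P (D i g)) ->
  forall g, P g -> rsmooth g.
Proof.
move=> H g Pg; apply/rsmoothE => l x _.
have Pl : P (rpartial l g) by elim: l => //= i l IH; exact: (proj2 (H _ IH) i).2.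
have [cl dl] := H _ Pl; split=> [|i]; first exact: cl.
exact: (dl i).1.
Qed.

Lemma rsmooth_continuous g : rsmooth g -> continuous g.
Proof. by move=> /rsmoothE sg x; exact: (sg [::] x I).1. Qed.

Lemma rsmooth_rpartial l g : rsmooth g -> rsmooth (rpartial l g).
Proof.
move=> /rsmoothE sg; apply/rsmoothE => l' x _.
by have := sg (l' ++ l) x I; rewrite /rpartial foldr_cat.
Qed.

Lemma rsmooth_D i g : rsmooth g -> rsmooth (D i g).
Proof. exact: (@rsmooth_rpartial [:: i]). Qed.

Lemma rsmooth_derivable g x i : rsmooth g -> derivable g x (sp_axis i).
Proof. by move=> /rsmoothE sg; exact: (sg [::] x I).2. Qed.

Lemma rsmooth_is_derive g x i : rsmooth g ->
  is_derive x (sp_axis i) g (D i g x).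
Proof. by move=> sg; apply: derivableP; exact: rsmooth_derivable. Qed.

Lemma is_derive_fun (f df : E -> R) v :
  (forall x, is_derive x v f (df x)) -> 'D_v f = df.
Proof. by move=> H; apply/funext => x; exact: (@derive_val _ _ _ _ _ _ _ (H x)). Qed.

Lemma rsmooth_coind (P : (E -> R) -> Prop) :
  (forall g, P g -> continuous g /\
     forall i, exists2 h, P h & forall x, is_derive x (sp_axis i) g (h x)) ->
  forall g, P g -> rsmooth g.
Proof.
move=> H; apply: rsmoothP => g Pg; have [cg dg] := H _ Pg; split=> // i.
have [h Ph gh] := dg i; split; last by rewrite (is_derive_fun gh).
by move=> x; case: (gh x).
Qed.

Lemma rsmooth_cst (c : R) : rsmooth (fun _ : E => c).
Proof.
apply: (@rsmooth_coind (fun g => exists c, g = fun=> c)); last by exists c.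
move=> _ [{}c ->]; split; first exact: continuousT_cst.
by move=> i; exists (fun=> 0); [by exists 0|move=> x; exact: is_derive_cst].
Qed.

(** Products alone are not stable under differentiation, by Leibniz' rule; their finite sums are.
    This is the class to which the coinduction principle is applied. *)
Inductive sum_of_products : (E -> R) -> Prop :=
| SumMul f g : rsmooth f -> rsmooth g -> sum_of_products (fun x => f x * g x)
| SumAdd f g : sum_of_products f -> sum_of_products g ->
    sum_of_products (fun x => f x + g x).

Lemma is_derive_mul f g x v (df dg : R) :
  is_derive x v f df -> is_derive x v g dg ->
  is_derive x v (fun y => f y * g y) (df * g x + f x * dg).
Proof.
move=> hf hg; have := is_deriveM hf hg.
by rewrite /GRing.scale /= [df * _]mulrC [_ * df + _]addrC; exact.
Qed.

Lemma is_derive_add f g x v (df dg : R) :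
  is_derive x v f df -> is_derive x v g dg ->
  is_derive x v (fun y => f y + g y) (df + dg).
Proof. by move=> hf hg; exact: is_deriveD. Qed.

Lemma sum_of_products_smooth f : sum_of_products f -> rsmooth f.
Proof.
move: f; apply: rsmooth_coind => g; elim=> {g} [f g sf sg|f g _ [cf IHf] _ [cg IHg]].
  split; first by cont; exact: rsmooth_continuous.
  move=> i; exists (fun x => D i f x * g x + f x * D i g x).
    by apply: SumAdd; apply: SumMul => //; exact: rsmooth_D.
  by move=> x; apply: is_derive_mul; exact: rsmooth_is_derive.
split; first by cont.
move=> i; have [f' Pf' ff'] := IHf i; have [g' Pg' gg'] := IHg i.
exists (fun x => f' x + g' x); first exact: SumAdd.
by move=> x; exact: is_derive_add.
Qed.

Lemma rsmooth_mul f g : rsmooth f -> rsmooth g -> rsmooth (fun x => f x * g x).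
Proof. by move=> sf sg; apply: sum_of_products_smooth; exact: SumMul. Qed.

Lemma rsmooth_scale c g : rsmooth g -> rsmooth (fun x => c * g x).
Proof. by apply: rsmooth_mul; exact: rsmooth_cst. Qed.

Lemma rsmooth_add f g : rsmooth f -> rsmooth g -> rsmooth (fun x => f x + g x).
Proof.
move=> sf sg; apply: sum_of_products_smooth.
rewrite (_ : (fun _ => _) = fun x => 1 * f x + 1 * g x); last first.
  by apply/funext => x; rewrite !mul1r.
by apply: SumAdd; apply: SumMul => //; exact: rsmooth_cst.
Qed.

Lemma rsmooth_opp g : rsmooth g -> rsmooth (fun x => - g x).
Proof.
move=> sg; rewrite (_ : (fun _ => _) = fun x => -1 * g x); last first.
  by apply/funext => x; rewrite mulN1r.
exact: rsmooth_scale.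
Qed.

Lemma rsmooth_sub f g : rsmooth f -> rsmooth g -> rsmooth (fun x => f x - g x).
Proof. by move=> sf sg; apply: rsmooth_add => //; exact: rsmooth_opp. Qed.

Lemma D_add i f g : rsmooth f -> rsmooth g ->
  D i (fun x => f x + g x) = fun x => D i f x + D i g x.
Proof.
by move=> sf sg; apply: is_derive_fun => x; apply: is_derive_add; exact: rsmooth_is_derive.
Qed.

Lemma D_mul i f g : rsmooth f -> rsmooth g ->
  D i (fun x => f x * g x) = fun x => D i f x * g x + f x * D i g x.
Proof.
by move=> sf sg; apply: is_derive_fun => x; apply: is_derive_mul; exact: rsmooth_is_derive.
Qed.

Lemma rpartial_add l f g : rsmooth f -> rsmooth g ->
  rpartial l (fun x => f x + g x) = fun x => rpartial l f x + rpartial l g x.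
Proof.
move=> sf sg; elim: l => //= i l IH.
by rewrite -/(rpartial l _) IH D_add //; exact: rsmooth_rpartial.
Qed.

Lemma rpartial_cst l c : (0 < size l)%N -> rpartial l (fun _ : E => c : R) = fun=> 0.
Proof.
have D0 c' i : D i (fun _ : E => c' : R) = fun=> 0.
  by apply: is_derive_fun => x; exact: is_derive_cst.
elim: l => // i [|j l] IH _; first by rewrite /= D0.
by rewrite -[LHS]/(D i (rpartial (j :: l) _)) IH // D0.
Qed.

Lemma rpartial_scale l c g : rsmooth g ->
  rpartial l (fun x => c * g x) = fun x => c * rpartial l g x.
Proof.
move=> sg; elim: l => //= i l IH; rewrite -/(rpartial l _) IH.
apply: is_derive_fun => x.
have := is_derive_mul (is_derive_cst c x (sp_axis i)) (rsmooth_is_derive x i (rsmooth_rpartial l sg)).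
by rewrite mul0r add0r.
Qed.

Lemma rpartial_opp l g : rsmooth g ->
  rpartial l (fun x => - g x) = fun x => - rpartial l g x.
Proof.
move=> sg; rewrite (_ : (fun _ => - g _) = fun x => -1 * g x); last first.
  by apply/funext => x; rewrite mulN1r.
by rewrite rpartial_scale //; apply/funext => x; rewrite mulN1r.
Qed.

Lemma rpartial_sub l f g : rsmooth f -> rsmooth g ->
  rpartial l (fun x => f x - g x) = fun x => rpartial l f x - rpartial l g x.
Proof.
by move=> sf sg; rewrite rpartial_add ?rpartial_opp //; exact: rsmooth_opp.
Qed.

Lemma rsmooth_affine (c : R) (p : E) g : rsmooth g -> rsmooth (fun x => g (c *: x + p)).
Proof.
(* The factor [s] absorbs the power of [c] that the chain rule produces at each differentiation. *)
move=> sg; pose P h := exists s g', rsmooth g' /\ h = fun x => s * g' (c *: x + p).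
apply: (@rsmooth_coind P); last first.
  by exists 1, g; split => //; apply/funext => x; rewrite mul1r.
move=> _ [s [h [sh ->]]]; split.
  cont; apply: (continuousT_comp (rsmooth_continuous sh)); cont.
move=> i; exists (fun x => (s * c) * D i h (c *: x + p)).
  by exists (s * c), (D i h); split => //; exact: rsmooth_D.
move=> x; have h1 := is_derive_comp_affine (rsmooth_is_derive (c *: x + p) i sh).
by have := is_derive_mul (is_derive_cst s x (sp_axis i)) h1; rewrite mul0r add0r mulrA.
Qed.

Lemma rpartial_affine l (c : R) (p : E) g : rsmooth g ->
  rpartial l (fun x => g (c *: x + p)) =
  fun x => c ^+ size l * rpartial l g (c *: x + p).
Proof.
move=> sg; elim: l => [|i l IH] /=; first by apply/funext => x; rewrite mul1r.
rewrite -/(rpartial l _) IH; apply: is_derive_fun => x.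
have h1 := is_derive_comp_affine (rsmooth_is_derive (c *: x + p) i (rsmooth_rpartial l sg)).
have := is_derive_mul (is_derive_cst (c ^+ size l) x (sp_axis i)) h1.
by rewrite mul0r add0r mulrA exprSr.
Qed.

Lemma rpartial_near l f g (U : set E) : open U -> (forall x, U x -> f x = g x) ->
  forall x, U x -> rpartial l f x = rpartial l g x.
Proof.
move=> oU fg; elim: l => //= i l IH x Ux; apply: near_eq_derive.
by apply: filterS (open_nbhs_nbhs (conj oU Ux)); exact: IH.
Qed.

Lemma rpartial_supp l g (C : set E) : closed C -> (forall x, ~ C x -> g x = 0) ->
  forall x, ~ C x -> rpartial l g x = 0.
Proof.
move=> cC g0 x Cx.
rewrite (@rpartial_near l g (fun=> 0) (~` C)) //; last exact: closed_openC.
by case: l => // i l; rewrite rpartial_cst.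
Qed.

(** Each differentiation at most doubles the number of terms in Leibniz' formula, whence the factor
    [2 ^+ size l]. The induction peels off the innermost derivative, so that linearity applies to
    the outer ones. *)
Lemma rpartial_mul_le l f g x (A B : R) : rsmooth f -> rsmooth g -> 0 <= A -> 0 <= B ->
  (forall l', (size l' <= size l)%N -> `|rpartial l' f x| <= A) ->
  (forall l', (size l' <= size l)%N -> `|rpartial l' g x| <= B) ->
  `|rpartial l (fun y => f y * g y) x| <= 2 ^+ size l * (A * B).
Proof.
move=> + + A0 B0; elim/last_ind: l f g => [f g sf sg fA gB|l i IH f g sf sg fA gB].
  by rewrite expr0 mul1r /= normrM ler_pM // ?(fA [::]) ?(gB [::]).
rewrite rpartial_rcons D_mul // rpartial_add; last 2 first.
- by apply: rsmooth_mul => //; exact: rsmooth_D.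
- by apply: rsmooth_mul => //; exact: rsmooth_D.
rewrite size_rcons exprS -mulrA mulr2n mulrDl mul1r.
rewrite (le_trans (ler_normD _ _)) // lerD // IH //; try exact: rsmooth_D.
- by move=> l' hl; rewrite -rpartial_rcons fA // !size_rcons.
- by move=> l' hl; rewrite gB // size_rcons leqW.
- by move=> l' hl; rewrite fA // size_rcons leqW.
- by move=> l' hl; rewrite -rpartial_rcons gB // !size_rcons.
Qed.

Lemma continuous_bounded_on g (C : set E) : continuous g -> compact C ->
  exists2 M : R, 0 <= M & forall x, C x -> `|g x| <= M.
Proof.
move=> cg cC.
have [M [_ HM]] := compact_bounded (continuous_compact (continuous_subspaceT cg) cC).
exists (`|M| + 1) => [|x Cx]; first by rewrite addr_ge0.
by apply: (HM _ _ (g x)); [rewrite (le_lt_trans (ler_norm M)) // ltrDl|exists x].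
Qed.

Lemma continuous_bounded_supp g (C : set E) : continuous g -> compact C ->
  (forall x, ~ C x -> g x = 0) -> exists2 M : R, 0 <= M & forall x, `|g x| <= M.
Proof.
move=> cg cC gC; have [M M0 HM] := continuous_bounded_on cg cC.
exists M => // x; have [/HM //|Cx] := pselect (C x).
by rewrite gC // normr0.
Qed.

(** Nothing is differentiated in the parameter. Joint continuity of every derivative in the space
    variable is what differentiation under the integral, repeated any number of times, requires. *)
Definition smooth_param (X : topologicalType) (F : X -> E -> R) : Prop :=
  (forall s, rsmooth (F s)) /\
  forall l, continuous (fun p : X * E => rpartial l (F p.1) p.2).

Lemma smooth_param_D (X : topologicalType) (F : X -> E -> R) i : smooth_param F -> smooth_param (fun s => D i (F s)).
Proof.
move=> [sF cF]; split=> [s|l]; first exact: rsmooth_D.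
by have := cF (rcons l i); under eq_fun do rewrite rpartial_rcons.
Qed.

Lemma is_derive_smooth_param (F : R -> E -> R) a b i x : smooth_param F ->
  is_derive x (sp_axis i) (fun y => ri a b (F ^~ y)) (ri a b (fun s => D i (F s) x)).
Proof.
move=> sF; apply: (@is_derive_param_ri R E F (fun s => D i (F s))).
- by move=> s z; apply: rsmooth_is_derive; exact: sF.1.
- by move=> z; exact: continuous_uncurry_fst (sF.2 [::]).
- exact: (sF.2 [:: i]).
Qed.

Lemma rsmooth_param_ri (F : R -> E -> R) a b : smooth_param F -> rsmooth (fun y => ri a b (F ^~ y)).
Proof.
move=> sF; pose P h := exists2 F' : R -> E -> R, smooth_param F' & h = fun y => ri a b (F' ^~ y).
apply: (@rsmooth_coind P); last by exists F.
move=> _ [G sG ->]; split; first exact: continuous_param_ri (sG.2 [::]).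
move=> i; exists (fun y => ri a b (fun s => D i (G s) y)).
  by exists (fun s => D i (G s)) => //; exact: smooth_param_D.
by move=> x; exact: is_derive_smooth_param.
Qed.

Lemma rpartial_param_ri l (F : R -> E -> R) a b : smooth_param F ->
  rpartial l (fun y => ri a b (F ^~ y)) = fun y => ri a b (fun s => rpartial l (F s) y).
Proof.
elim/last_ind: l F => // l i IH F sF.
rewrite rpartial_rcons (is_derive_fun (fun x => is_derive_smooth_param a b i x sF)).
rewrite (IH (fun s => D i (F s))); last exact: smooth_param_D.
by apply/funext => y; congr ri; apply/funext => s; rewrite rpartial_rcons.
Qed.

(** Convergence of [F s] to [F s0] in the C^m norm, for functions supported in one compact set:
    exactly the convergence seen by a distribution of order [m] on that set. *)
Lemma uniform_smooth_param (X : topologicalType) (F : X -> E -> R) (C : set E) m s0 (e : R) :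
  smooth_param F -> compact C -> closed C -> (forall s x, ~ C x -> F s x = 0) -> 0 < e ->
  \forall s \near s0, forall l, (size l <= m)%N -> forall y,
    `|rpartial l (F s) y - rpartial l (F s0) y| <= e.
Proof.
move=> + cC clC + e0; elim: m F => [|m IH] F sF FC.
  have cF : continuous (fun p : E * X => F p.2 p.1).
    by apply: (continuousT_comp (sF.2 [::]) (f := fun p : E * X => (p.2, p.1))); cont.
  have := uniform_on_compact (F := fun y s => F s y) s0 cC cF e0.
  apply: filterS => s H [] // _ y /=.
  by have [/H //|Cy] := pselect (C y); rewrite !FC // subrr normr0 ltW.
have HD : \forall s \near s0, forall i l, (size l <= m)%N -> forall y,
    `|rpartial l (D i (F s)) y - rpartial l (D i (F s0)) y| <= e.
  apply: filter_forall => i; apply: IH; first exact: smooth_param_D.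
  by move=> s x Cx; exact: (rpartial_supp [:: i] clC (FC s) Cx).
have H0 := IH F sF FC.
move: HD H0; apply: filterS2 => s hD h0 l; case/lastP: l => [_ y|l i].
  exact: (h0 [::]).
by rewrite size_rcons ltnS => lm y; rewrite !rpartial_rcons; exact: hD.
Qed.

Lemma smooth_param_ri (X : topologicalType) (F : R -> X -> E -> R) a b :
  smooth_param (fun p : R * X => F p.1 p.2) ->
  smooth_param (fun x y => ri a b (fun s => F s x y)).
Proof.
move=> [sF cF].
have sFx x : smooth_param (fun s => F s x).
  split=> [s|l]; first exact: (sF (s, x)).
  by apply: (continuousT_comp (cF l) (f := fun p : R * E => ((p.1, x), p.2))); cont.
split=> [x|l]; first exact: rsmooth_param_ri.
have -> : (fun p : X * E => rpartial l (fun y => ri a b (fun s => F s p.1 y)) p.2) =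
   fun p => ri a b (fun s => rpartial l (F s p.1) p.2).
  by apply/funext => p; rewrite (rpartial_param_ri l a b (sFx p.1)).
apply: (@continuous_param_ri R _ (fun s (p : X * E) => rpartial l (F s p.1) p.2)).
by apply: (continuousT_comp (cF l) (f := fun p : R * (X * E) => ((p.1, p.2.1), p.2.2))); cont.
Qed.

Lemma smooth_param_pullback (X Y : topologicalType) (F : X -> E -> R) (h : Y -> X) :
  continuous h -> smooth_param F -> smooth_param (fun y => F (h y)).
Proof.
move=> ch [sF cF]; split=> [s|l]; first exact: sF.
by apply: (continuousT_comp (cF l) (f := fun p : Y * E => (h p.1, p.2))); cont;
  apply: (continuousT_comp ch); cont.
Qed.

Lemma smooth_param_add (X : topologicalType) (F G : X -> E -> R) :
  smooth_param F -> smooth_param G -> smooth_param (fun s y => F s y + G s y).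
Proof.
move=> [sF cF] [sG cG]; split=> [s|l]; first exact: rsmooth_add.
under eq_fun do rewrite rpartial_add //.
by apply: continuousT_add.
Qed.

Lemma smooth_param_opp (X : topologicalType) (F : X -> E -> R) :
  smooth_param F -> smooth_param (fun s y => - F s y).
Proof.
move=> [sF cF]; split=> [s|l]; first exact: rsmooth_opp.
by under eq_fun do rewrite rpartial_opp //; apply: continuousT_opp.
Qed.

Lemma smooth_param_scale (X : topologicalType) (c : X -> R) (F : X -> E -> R) :
  continuous c -> smooth_param F -> smooth_param (fun s y => c s * F s y).
Proof.
move=> cc [sF cF]; split=> [s|l]; first exact: rsmooth_scale.
under eq_fun do rewrite rpartial_scale //.
apply: (continuousT_mul (f := fun p : X * E => c p.1)) => //.
by apply: (continuousT_comp cc); cont.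
Qed.

Lemma smooth_param_affine (X : topologicalType) (c : R) (p : X -> E) g :
  continuous p -> rsmooth g -> smooth_param (fun s y => g (c *: y + p s)).
Proof.
move=> cp sg; split=> [s|l]; first exact: rsmooth_affine.
under eq_fun do rewrite rpartial_affine //.
apply: continuousT_mul; first exact: continuousT_cst.
apply: (continuousT_comp (rsmooth_continuous (rsmooth_rpartial l sg))).
by cont; apply: (continuousT_comp cp); cont.
Qed.

End Smooth.

(** * Scalars and distributions *)

Section Scalars.
Context {R : realType} {k : scalar_kind}.
Local Notation K := (scalar_field R k).
Implicit Types (x y z : K) (r s : R).

Lemma reD x y : re (x + y) = re x + re y.
Proof. by case: k x y => // -[a b] [c d]. Qed.

Lemma imD x y : im (x + y) = im x + im y.
Proof. by case: k x y => [x y|[a b] [c d]] //=; rewrite addr0. Qed.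

Lemma reN x : re (- x) = - re x.
Proof. by case: k x => // -[a b]. Qed.

Lemma imN x : im (- x) = - im x.
Proof. by case: k x => [x|[a b]] //=; rewrite oppr0. Qed.

Lemma reB x y : re (x - y) = re x - re y.
Proof. by rewrite reD reN. Qed.

Lemma imB x y : im (x - y) = im x - im y.
Proof. by rewrite imD imN. Qed.

Lemma reM x y : re (x * y) = re x * re y - im x * im y.
Proof. by case: k x y => [x y|[a b] [c d]] //=; rewrite mulr0 subr0. Qed.

Lemma imM x y : im (x * y) = re x * im y + im x * re y.
Proof. by case: k x y => [x y|[a b] [c d]] //=; rewrite mulr0 mul0r addr0. Qed.

Lemma re0 : re (0 : K) = 0. Proof. by case: k. Qed.
Lemma im0 : im (0 : K) = 0. Proof. by case: k. Qed.
Lemma re1 : re (1 : K) = 1. Proof. by case: k. Qed.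
Lemma im1 : im (1 : K) = 0. Proof. by case: k. Qed.

Lemma re_of_parts r s : re (of_parts k r s) = r.
Proof. by case: k. Qed.

Lemma im_of_parts r s : (k = RealScalars -> s = 0) -> im (of_parts k r s) = s.
Proof. by case: k => //= ->. Qed.

Lemma im_real_scalars x : k = RealScalars -> im x = 0.
Proof. by case: k x. Qed.

Lemma re_of_real r : re (of_real k r) = r.
Proof. exact: re_of_parts. Qed.

Lemma im_of_real r : im (of_real k r) = 0.
Proof. by rewrite im_of_parts. Qed.

Lemma of_parts_re_im x : of_parts k (re x) (im x) = x.
Proof. by case: k x => // -[]. Qed.

Lemma scalar_eq x y : re x = re y -> im x = im y -> x = y.
Proof. by move=> h1 h2; rewrite -[x]of_parts_re_im h1 h2 of_parts_re_im. Qed.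

Lemma re_real_mul r x : re (of_real k r * x) = r * re x.
Proof. by rewrite reM re_of_real im_of_real mul0r subr0. Qed.

Lemma im_real_mul r x : im (of_real k r * x) = r * im x.
Proof. by rewrite imM re_of_real im_of_real mul0r addr0. Qed.

Lemma re_half x : re (2^-1 * x) = 2^-1 * re x.
Proof.
suff -> : (2^-1 : K) = of_real k 2^-1 by rewrite re_real_mul.
apply: (@mulfI _ (2 : K)); first by rewrite pnatr_eq0.
rewrite divff ?pnatr_eq0 //; apply: scalar_eq.
  by rewrite mulr_natl mulr2n reD re_of_real re1; lra.
by rewrite mulr_natl mulr2n imD im_of_real im1 addr0.
Qed.

Lemma im_half x : im (2^-1 * x) = 2^-1 * im x.
Proof.
suff -> : (2^-1 : K) = of_real k 2^-1 by rewrite im_real_mul.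
apply: (@mulfI _ (2 : K)); first by rewrite pnatr_eq0.
rewrite divff ?pnatr_eq0 //; apply: scalar_eq.
  by rewrite mulr_natl mulr2n reD re_of_real re1; lra.
by rewrite mulr_natl mulr2n imD im_of_real im1 addr0.
Qed.

Lemma modulusE x : modulus x = Num.sqrt (re x ^+ 2 + im x ^+ 2).
Proof.
rewrite /modulus; case: k x => [x|[a b]] /=; last by [].
by rewrite expr0n addr0 sqrtr_sqr.
Qed.

Lemma modulus_ge0 x : 0 <= modulus x.
Proof. by rewrite modulusE sqrtr_ge0. Qed.

Lemma re_le_modulus x : `|re x| <= modulus x.
Proof. by rewrite modulusE -sqrtr_sqr ler_wsqrtr // lerDl sqr_ge0. Qed.

Lemma im_le_modulus x : `|im x| <= modulus x.
Proof. by rewrite modulusE -sqrtr_sqr ler_wsqrtr // lerDr sqr_ge0. Qed.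

Lemma modulus_le x : modulus x <= `|re x| + `|im x|.
Proof.
rewrite modulusE -[leRHS]ger0_norm ?addr_ge0 // -sqrtr_sqr ler_wsqrtr //.
rewrite sqrrD !real_normK ?num_real // -addrA lerD2l lerDr.
by rewrite mulrn_wge0 // mulr_ge0.
Qed.

End Scalars.

Section Functions.
Context {R : realType} {k : scalar_kind} {E : coord_space R}.
Local Notation K := (scalar_field R k).
Implicit Types (u v psi : E -> K) (l : seq 'I_(sp_dim E)).

Lemma smoothE u : smooth u <-> rsmooth (@re R k \o u) /\ rsmooth (@im R k \o u).
Proof. by rewrite !rsmoothE. Qed.

Lemma smooth_re u : smooth u -> rsmooth (fun x => re (u x)).
Proof. by case/smoothE. Qed.

Lemma smooth_im u : smooth u -> rsmooth (fun x => im (u x)).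
Proof. by case/smoothE. Qed.

Lemma im_funE u : k = RealScalars -> (@im R k \o u) = fun=> 0.
Proof. by move=> kR; apply/funext => x /=; rewrite im_real_scalars. Qed.

Lemma re_partial l u x : re (partial l u x) = rpartial l (fun x => re (u x)) x.
Proof. exact: re_of_parts. Qed.

Lemma rpartial0 l : rpartial l (fun _ : E => 0 : R) = fun=> 0.
Proof. by case: l => // i l; rewrite rpartial_cst. Qed.

Lemma im_partial l u x : im (partial l u x) = rpartial l (fun x => im (u x)) x.
Proof.
by rewrite /partial im_of_parts // => kR; rewrite im_funE // rpartial0.
Qed.

Lemma smooth_of_re_im (u : E -> K) (f g : E -> R) : rsmooth f -> rsmooth g ->
  (forall x, re (u x) = f x) -> (forall x, im (u x) = g x) -> smooth u.
Proof.
move=> sf sg hf hg; apply/smoothE; split.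
  by rewrite (_ : _ \o _ = f) //; apply/funext => x; exact: hf.
by rewrite (_ : _ \o _ = g) //; apply/funext => x; exact: hg.
Qed.

Lemma smooth_mul u v : smooth u -> smooth v -> smooth (fun x => u x * v x).
Proof.
move=> /[dup] /smooth_re ru /smooth_im iu /[dup] /smooth_re rv /smooth_im iv.
apply: (smooth_of_re_im _ _ (fun x => reM (u x) (v x)) (fun x => imM (u x) (v x))).
  by apply: rsmooth_sub; exact: rsmooth_mul.
by apply: rsmooth_add; exact: rsmooth_mul.
Qed.

Lemma smooth_add u v : smooth u -> smooth v -> smooth (fun x => u x + v x).
Proof.
move=> /[dup] /smooth_re ru /smooth_im iu /[dup] /smooth_re rv /smooth_im iv.
apply: (smooth_of_re_im _ _ (fun x => reD (u x) (v x)) (fun x => imD (u x) (v x)));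
  exact: rsmooth_add.
Qed.

Lemma smooth_cst (c : K) : smooth (fun _ : E => c).
Proof.
by apply: (smooth_of_re_im (rsmooth_cst (re c)) (rsmooth_cst (im c))).
Qed.

Lemma smooth_scale (c : K) u : smooth u -> smooth (fun x => c * u x).
Proof. by apply: smooth_mul; exact: smooth_cst. Qed.

Lemma smooth_opp u : smooth u -> smooth (fun x => - u x).
Proof.
move=> su; rewrite (_ : (fun _ => _) = fun x => -1 * u x).
  exact: smooth_scale.
by apply/funext => x; rewrite mulN1r.
Qed.

Lemma smooth_sub u v : smooth u -> smooth v -> smooth (fun x => u x - v x).
Proof. by move=> su sv; exact: (smooth_add su (smooth_opp sv)). Qed.

Lemma smooth_affine (c : R) (p : E) u : smooth u -> smooth (fun x => u (c *: x + p)).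
Proof.
move=> /[dup] /smooth_re ru /smooth_im iu.
by apply: (smooth_of_re_im (rsmooth_affine c p ru) (rsmooth_affine c p iu)).
Qed.

Lemma test_supported psi (C : set E) : smooth psi -> compact C -> supported_in C psi ->
  test psi.
Proof. by move=> sp cC pC; split=> //; exists C; split. Qed.

End Functions.

(** * Distributions applied to families of test functions *)

Section Distributions.
Context {R : realType} {k : scalar_kind} {E : coord_space R}.
Local Notation K := (scalar_field R k).
Variable T : (E -> K) -> K.
Hypothesis dT : is_distribution T.
Implicit Types (psi : E -> K) (C : set E).

Lemma distribution_add psi1 psi2 : test psi1 -> test psi2 ->
  T (fun x => psi1 x + psi2 x) = T psi1 + T psi2.
Proof.
move=> t1 t2; have := dT.1 1 psi1 psi2 t1 t2; rewrite mul1r => <-.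
by congr T; apply/funext => x; rewrite mul1r.
Qed.

Lemma distribution0 : T (fun=> 0) = 0.
Proof.
have t0 : test (fun _ : E => 0 : K).
  by split; [exact: smooth_cst|exists set0; split => //; exact: compact0].
have := dT.1 1 _ _ t0 t0; rewrite !mul1r addr0 => h.
by apply/eqP; rewrite -[X in X == _](addrK (T (fun=> 0))) -h subrr.
Qed.

Lemma distribution_scale (c : K) psi : test psi -> T (fun x => c * psi x) = c * T psi.
Proof.
move=> t1; have t0 : test (fun _ : E => 0 : K).
  by split; [exact: smooth_cst|exists set0; split => //; exact: compact0].
have := dT.1 c psi _ t1 t0; rewrite distribution0 addr0 => <-.
by congr T; apply/funext => x; rewrite addr0.
Qed.

Lemma distribution_sub psi1 psi2 : test psi1 -> test psi2 ->
  T (fun x => psi1 x - psi2 x) = T psi1 - T psi2.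
Proof.
move=> t1 t2; have := dT.1 (-1) psi2 psi1 t2 t1; rewrite mulN1r addrC => <-.
by congr T; apply/funext => x; rewrite mulN1r addrC.
Qed.

Lemma distribution_bound C : compact C ->
  exists (c : R) (m : nat), 0 <= c /\ forall psi, smooth psi -> supported_in C psi ->
  forall M : R, (forall l x, (size l <= m)%N ->
     `|rpartial l (fun x => re (psi x)) x| <= M /\ `|rpartial l (fun x => im (psi x)) x| <= M) ->
  modulus (T psi) <= c * M.
Proof.
(* The factor 2 pays for bounding the real and imaginary parts separately; the absolute value makes
   the constant nonnegative. *)
move=> /(dT.2)[c [m H]]; exists (2 * `|c|), m; split; first by rewrite mulr_ge0.
move=> psi sp Cp M HM.
have M0 : 0 <= M by have [+ _] := HM [::] 0 (leq0n _); apply: le_trans.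
apply: (@le_trans _ _ (c * (2 * M))).
  apply: H => // l x lm; have [h1 h2] := HM l x lm.
  by rewrite (le_trans (modulus_le _)) // re_partial im_partial mulr2n mulrDl mul1r lerD.
by rewrite mulrCA -mulrA ler_wpM2l // ler_wpM2r // ler_norm.
Qed.

Definition smooth_family_K (X : topologicalType) (F : X -> E -> K) : Prop :=
  smooth_param (fun s y => re (F s y)) /\ smooth_param (fun s y => im (F s y)).

Lemma smooth_family_smooth (X : topologicalType) (F : X -> E -> K) s :
  smooth_family_K F -> smooth (F s).
Proof. by move=> [[h1 _] [h2 _]]; apply/smoothE; split; [exact: h1|exact: h2]. Qed.

Lemma distribution_near (X : topologicalType) (F : X -> E -> K) C s0 (e : R) :
  smooth_family_K F -> compact C -> closed C -> (forall s, supported_in C (F s)) ->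
  0 < e -> \forall s \near s0, modulus (T (F s) - T (F s0)) <= e.
Proof.
move=> sF cC clC FC e0; have [c [m [c0 Hc]]] := distribution_bound cC.
have c10 : 0 < 1 + c by rewrite ltr_pwDl.
have e1 : 0 < e / (1 + c) by rewrite divr_gt0.
have H1 := uniform_smooth_param m s0 sF.1 cC clC _ e1.
have H2 := uniform_smooth_param m s0 sF.2 cC clC _ e1.
have h0 P : (forall s x, ~ C x -> re (F s x) = 0) /\ (forall s x, ~ C x -> im (F s x) = 0) -> P -> P by [].
have reC : forall s x, ~ C x -> re (F s x) = 0 by move=> s x Cx; rewrite (FC s) // re0.
have imC : forall s x, ~ C x -> im (F s x) = 0 by move=> s x Cx; rewrite (FC s) // im0.
move: (H1 reC) (H2 imC); apply: filterS2 => s h1 h2.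
have ts s' : test (F s') by apply: (@test_supported _ _ _ _ C) => //; exact: smooth_family_smooth.
rewrite -distribution_sub //.
apply: (@le_trans _ _ (c * (e / (1 + c)))).
  apply: Hc.
  - by apply: smooth_sub; exact: smooth_family_smooth.
  - by move=> x Cx; rewrite !(FC _ x Cx) subrr.
  - move=> l x lm.
    under eq_fun do rewrite reB; under [X in _ /\ `|rpartial l X x| <= _]eq_fun do rewrite imB.
    rewrite !rpartial_sub; try exact: sF.1.1; try exact: sF.2.1.
    by split; [exact: h1|exact: h2].
by rewrite mulrCA ger_pMr // ler_pdivrMr // mul1r lerDr.
Qed.

Lemma distribution_family_continuous (X : topologicalType) (F : X -> E -> K) C :
  smooth_family_K F -> compact C -> closed C -> (forall s, supported_in C (F s)) ->
  continuous (fun s => re (T (F s))) /\ continuous (fun s => im (T (F s))).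
Proof.
move=> sF cC clC FC; split=> s0; apply/cvgrPdist_le => e e0;
  have := distribution_near s0 sF cC clC FC e0; apply: filterS => s.
  by apply: le_trans; rewrite distrC -reB re_le_modulus.
by apply: le_trans; rewrite distrC -imB im_le_modulus.
Qed.

Lemma re_interval_integral a b (g : R -> K) :
  re (interval_integral a b g) = ri a b (fun x => re (g x)).
Proof. exact: re_of_parts. Qed.

Lemma ri0 a b : ri a b (fun=> 0 : R) = 0.
Proof. by rewrite ri_cst mul0r. Qed.

Lemma im_interval_integral a b (g : R -> K) :
  im (interval_integral a b g) = ri a b (fun x => im (g x)).
Proof.
rewrite /interval_integral im_of_parts // => kR.
by rewrite (_ : _ \o _ = fun=> 0) ?ri0 //; apply/funext => x /=; rewrite im_real_scalars.
Qed.

(* Both sides have the same derivative in [b]. *)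
Lemma distribution_interval_integral (F : R -> E -> K) C a b :
  smooth_family_K F -> compact C -> closed C -> (forall s, supported_in C (F s)) ->
  T (fun y => interval_integral a b (F ^~ y)) = interval_integral a b (fun s => T (F s)).
Proof.
move=> sF cC clC FC; have [c [m [c0 Hc]]] := distribution_bound cC.
pose J r y := interval_integral a r (F ^~ y).
have sJ r : smooth (J r).
  apply: (smooth_of_re_im (rsmooth_param_ri a r sF.1) (rsmooth_param_ri a r sF.2)) => y.
    exact: re_interval_integral.
  exact: im_interval_integral.
have JC r : supported_in C (J r).
  move=> y Cy; apply: scalar_eq; rewrite ?re_interval_integral ?im_interval_integral ?re0 ?im0.
    by under eq_fun do rewrite (FC _ _ Cy) re0; rewrite ri0.
  by under eq_fun do rewrite (FC _ _ Cy) im0; rewrite ri0.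
have tJ r : test (J r) by exact: test_supported (sJ r) cC (JC r).
have tF s : test (F s) by exact: test_supported (smooth_family_smooth s sF) cC (FC s).
(* All derivatives up to order [m] of [J (h + r) - J r - h F r] are integrals from [r] to [h + r] of
   differences [F s - F r], hence small compared with [h]. The seminorm estimate carries this
   through [T]. *)
have key r (e : R) : 0 < e -> exists2 d : R, 0 < d & forall h : R, `|h| < d ->
    modulus (T (J (h + r)) - T (J r) - of_real k h * T (F r)) <= e * `|h|.
  move=> e0; have c10 : 0 < 1 + c by rewrite ltr_pwDl.
  have e1 : 0 < e / (1 + c) by rewrite divr_gt0.
  have reC : forall s x, ~ C x -> re (F s x) = 0 by move=> s x Cx; rewrite (FC s) // re0.
  have imC : forall s x, ~ C x -> im (F s x) = 0 by move=> s x Cx; rewrite (FC s) // im0.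
  have H1 := uniform_smooth_param m r sF.1 cC clC reC e1.
  have H2 := uniform_smooth_param m r sF.2 cC clC imC e1.
  have [d d0 Hd] := proj1 (nbhs_normE _ _) (filterI H1 H2).
  exists d => // h hd.
  have est (G : R -> E -> R) l y : smooth_param G ->
      (forall s, `|s - r| < d -> forall l, (size l <= m)%N -> forall y,
         `|rpartial l (G s) y - rpartial l (G r) y| <= e / (1 + c)) ->
      (size l <= m)%N ->
      `|rpartial l (fun y => ri a (h + r) (G ^~ y) - ri a r (G ^~ y) - h * G r y) y| <=
         e / (1 + c) * `|h|.
    move=> sG HG lm.
    have cG := @continuous_uncurry_fst R E (fun s y => rpartial l (G s) y) y (sG.2 l).
    rewrite !rpartial_sub; try exact: rsmooth_param_ri; last 2 first.
    - by apply: rsmooth_sub; exact: rsmooth_param_ri.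
    - by apply: rsmooth_scale; exact: sG.1.
    rewrite rpartial_scale; last exact: sG.1.
    rewrite !rpartial_param_ri // (ri_chasles a r _ cG) [X in X - _ - _]addrC addrK.
    have -> : h * rpartial l (G r) y = ri r (h + r) (fun=> rpartial l (G r) y).
      by rewrite ri_cst addrK mulrC.
    rewrite -riB //; last exact: continuousT_cst.
    rewrite -[h in leRHS](addrK r); apply: ri_le.
      by apply: continuousT_add => //; apply: continuousT_opp; exact: continuousT_cst.
    move=> s hs; apply: HG => //.
    by apply: le_lt_trans (between_dist hs) _; rewrite addrK.
  rewrite -distribution_scale // -!distribution_sub //; last first.
  - apply: (@test_supported _ _ _ _ C) => //.
      by apply: smooth_scale; exact: smooth_family_smooth.
    by move=> x Cx; rewrite (FC _ x Cx) mulr0.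
  - apply: (@test_supported _ _ _ _ C) => //; first exact: smooth_sub.
    by move=> x Cx; rewrite !JC // subrr.
  apply: (@le_trans _ _ (c * (e / (1 + c) * `|h|))).
    apply: Hc.
    - apply: smooth_sub; first exact: smooth_sub.
      by apply: smooth_scale; exact: smooth_family_smooth.
    - by move=> x Cx; rewrite !JC // (FC _ x Cx) mulr0 !subr0.
    - move=> l y lm; split.
      + have -> : (fun x => re (J (h + r) x - J r x - of_real k h * F r x)) =
          (fun y => ri a (h + r) (fun s => re (F s y)) - ri a r (fun s => re (F s y)) - h * re (F r y)).
          by apply/funext => x; rewrite !reB re_real_mul !re_interval_integral.
        apply: (est (fun s y => re (F s y))) => //; first exact: sF.1.
        by move=> s hs; exact: (Hd s hs).1.
      + have -> : (fun x => im (J (h + r) x - J r x - of_real k h * F r x)) =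
          (fun y => ri a (h + r) (fun s => im (F s y)) - ri a r (fun s => im (F s y)) - h * im (F r y)).
          by apply/funext => x; rewrite !imB im_real_mul !im_interval_integral.
        apply: (est (fun s y => im (F s y))) => //; first exact: sF.2.
        by move=> s hs; exact: (Hd s hs).2.
  rewrite mulrA ler_wpM2r // mulrCA ger_pMr // ler_pdivrMr // mul1r.
  by rewrite lerDr.
have [cre cim] := distribution_family_continuous sF cC clC FC.
have dre (r : R) : is_derive r 1 (fun r => re (T (J r))) (re (T (F r))).
  apply: is_derive_littleo => e e0; have [d d0 Hd] := key r e e0; exists d => // h hd.
  rewrite [h *: 1]mulr1 -reB -re_real_mul -reB; apply: le_trans (Hd h hd).
  exact: re_le_modulus.
have dim (r : R) : is_derive r 1 (fun r => im (T (J r))) (im (T (F r))).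
  apply: is_derive_littleo => e e0; have [d d0 Hd] := key r e e0; exists d => // h hd.
  rewrite [h *: 1]mulr1 -imB -im_real_mul -imB; apply: le_trans (Hd h hd).
  exact: im_le_modulus.
have Ja : T (J a) = 0.
  rewrite -distribution0; congr T; apply/funext => y; apply: scalar_eq.
    by rewrite re_interval_integral rixx re0.
  by rewrite im_interval_integral rixx im0.
apply: scalar_eq.
  by rewrite re_interval_integral (ri_FTC a b cre dre) Ja re0 subr0.
by rewrite im_interval_integral (ri_FTC a b cim dim) Ja im0 subr0.
Qed.

End Distributions.

(** * Measure on the plane *)

Section PlaneMeasure.
Context {R : realType}.
Local Notation mR := (measurableTypeR R).
Local Notation M := ((@lebesgue_measure R) \x (@lebesgue_measure R))%E.
Implicit Types (g : R * R -> R).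

(** Measurability refers to the product of two sigma-algebras, so an open set is written as a
    countable union of squares with rational centres and half-sides [1 / (n + 1)]. *)
Lemma open_measurable_plane (O : set (R * R)) :
  open O -> measurable (O : set (mR * mR)).
Proof.
move=> oO.
pose B (q : rat * rat * nat) : set (mR * mR) :=
  `](ratr q.1.1 - q.2.+1%:R^-1), (ratr q.1.1 + q.2.+1%:R^-1)[%classic `*`
  `](ratr q.1.2 - q.2.+1%:R^-1), (ratr q.1.2 + q.2.+1%:R^-1)[%classic.
pose F q := if asbool (B q `<=` O) then B q else set0.
have -> : O = \bigcup_q F q.
  apply/seteqP; split=> [[x t] Oxt|z [q _]]; last first.
    by rewrite /F; case: asboolP => // BO Bz; exact: BO.
  have [d d0 Hd] := proj1 (nbhs_normE _ _) (open_nbhs_nbhs (conj oO Oxt)).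
  (* Half of [d] is required because the square is centred at a rational point near [(x, t)], not at
     [(x, t)]: its points are at a distance of up to two half-sides. *)
  have [n Hn] : exists n : nat, n.+1%:R^-1 < d / 2.
    have d2 : 0 < d / 2 by rewrite divr_gt0.
    exists (Num.trunc (d / 2)^-1); rewrite invf_plt ?posrE ?invr_gt0 //.
    exact: truncnS_gt.
  have n0 : (0 : R) < n.+1%:R^-1 by rewrite invr_gt0.
  have rp (y : R) : exists a : rat, y - n.+1%:R^-1 < ratr a < y + n.+1%:R^-1.
    have /rat_in_itvoo[a] : y - n.+1%:R^-1 < y + n.+1%:R^-1 by rewrite ltrD2l gtrN.
    by rewrite in_itv /= => h; exists a.
  have [a /andP[a1 a2]] := rp x; have [b /andP[b1 b2]] := rp t.
  exists (a, b, n) => //; rewrite /F asboolT; last first.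
    have H (u w : R) : ratr a - n.+1%:R^-1 < u < ratr a + n.+1%:R^-1 ->
        ratr b - n.+1%:R^-1 < w < ratr b + n.+1%:R^-1 -> O (u, w).
      move=> /andP[h1 h2] /andP[h3 h4]; apply: Hd.
      rewrite -[_ - _]/(u - x, w - t) prod_normE /= gt_max !ltr_norml.
      move: Hn n0 a1 a2 b1 b2 h1 h2 h3 h4; move: (n.+1%:R^-1) (ratr a) (ratr b) => e ra rb *.
      by apply/andP; split; apply/andP; split; lra.
    by move=> [u w] /= [] /=; rewrite !in_itv /=; exact: H.
  have sw (e u w : R) : u - e < w -> w < u + e -> w - e < u < w + e.
    by move=> h1 h2; apply/andP; split; lra.
  by split=> /=; rewrite in_itv /=; exact: sw.
apply: countable_bigcupT_measurable; first exact: countableP.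
move=> q; rewrite /F; case: ifP => _; last exact: measurable0.
by apply: measurableX; exact: measurable_itv.
Qed.

Lemma continuous_measurable_plane g : continuous g ->
  measurable_fun setT (g : mR * mR -> R).
Proof.
move=> /continuousP cg; apply: (measurability _ (RGenOpens.measurableE R)).
move=> _ [_ [a [b ->] <-]]; rewrite setTI; apply: open_measurable_plane.
exact/cg/interval_open.
Qed.

Definition box (X : R) : set (R * R) := `[- X, X]%classic `*` `[- X, X]%classic.

Lemma measurable_box X : measurable (box X : set (mR * mR)).
Proof. by apply: measurableX; exact: measurable_itv. Qed.

Lemma box_finite X : (M (box X) < +oo)%E.
Proof.
rewrite product_measure1E; [|exact: measurable_itv..].
by rewrite -ge0_fin_numE ?mule_ge0 // fin_numM //= lebesgue_measure_itv /=;
  case: ifP.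
Qed.

(** Measurable and not continuous, because Fubini's theorem is also applied to [f (vreg + w)] cut
    off to a triangle. *)
Definition bounded_supp g (X : R) : Prop :=
  [/\ measurable_fun setT (g : mR * mR -> R), exists B : R, forall z, `|g z| <= B
    & forall z, ~ box X z -> g z = 0].

Lemma integrable_bounded_supp g X : bounded_supp g X ->
  M.-integrable setT (EFin \o g).
Proof.
move=> [mg [B gB] gX].
have -> : EFin \o g = (EFin \o g) \_ (box X).
  apply/funext => z; rewrite patchE; case: ifPn => // /negP; rewrite inE => zX.
  by rewrite /= gX.
apply/(integrable_mkcond _ (measurable_box X)).
apply: measurable_bounded_integrable.
- exact: measurable_box.
- exact: box_finite.
- by apply: measurable_funTS.
- exists B; split; first exact: num_real.
  by move=> y By z _ /=; rewrite (le_trans (gB z)) // ltW.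
Qed.

Lemma integrable_bounded_supp1 (h : R -> R) (X B : R) :
  measurable_fun setT (h : mR -> R) -> (forall x, `|h x| <= B) ->
  (forall x, ~ (- X <= x <= X) -> h x = 0) ->
  mu.-integrable setT (EFin \o h).
Proof.
move=> mh hB hX.
have -> : EFin \o h = (EFin \o h) \_ `[- X, X].
  apply/funext => z; rewrite patchE; case: ifPn => // /negP; rewrite inE => zX.
  by rewrite /= hX // => zX'; apply: zX; rewrite /= in_itv.
apply/(@integrable_mkcond _ mR R mu _ _ (measurable_itv _)).
apply: measurable_bounded_integrable => //.
- by rewrite /= lebesgue_measure_itv /=; case: ifP => // _; rewrite -EFinD ltry.
- exact: measurable_funTS.
- exists B; split; first exact: num_real.
  by move=> y By z _ /=; rewrite (le_trans (hB z)) // ltW.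
Qed.

Lemma Rintegral_supp (h : R -> R) (X : R) : 0 <= X ->
  (forall x, ~ (- X <= x <= X) -> h x = 0) ->
  \int[mu]_x h x = ri (- X) X h.
Proof.
move=> X0 hX; rewrite /rinterval_integral (le_trans _ X0) ?oppr_le0 //.
rewrite [RHS]Rintegral_mkcond; congr (Rintegral _ _ _); apply/funext => x.
rewrite patchE; case: ifPn => // /negP; rewrite inE => zX.
by rewrite hX // => zX'; apply: zX; rewrite /= in_itv.
Qed.

Lemma section_measurable g t : measurable_fun setT (g : mR * mR -> R) ->
  measurable_fun setT ((fun x => g (x, t)) : mR -> R).
Proof. by move=> mg; apply: measurableT_comp => //; exact: measurable_pair2. Qed.

Lemma section_measurable2 g x : measurable_fun setT (g : mR * mR -> R) ->
  measurable_fun setT ((fun t => g (x, t)) : mR -> R).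
Proof. by move=> mg; apply: measurableT_comp => //; exact: measurable_pair1. Qed.

Lemma section_supp g X t x : bounded_supp g X -> ~ (- X <= x <= X) -> g (x, t) = 0.
Proof. by case=> _ _ gX xX; apply: gX => -[/=]; rewrite in_itv. Qed.

Lemma section_supp2 g X t x : bounded_supp g X -> ~ (- X <= t <= X) -> g (x, t) = 0.
Proof. by case=> _ _ gX xX; apply: gX => -[/= _]; rewrite in_itv. Qed.

Lemma plane_fubini g X : 0 <= X -> bounded_supp g X ->
  \int[M]_z g z = ri (- X) X (fun t => ri (- X) X (fun x => g (x, t))).
Proof.
move=> X0 bg; have [mg [B gB] gX] := bg.
rewrite -Rintegral_supp //; last first.
  move=> t tX; rewrite -Rintegral_supp //.
    by under eq_Rintegral do rewrite (section_supp2 _ bg) //; rewrite Rintegral_cst // mul0r.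
  by move=> x xX; exact: (section_supp _ bg).
rewrite /Rintegral -(integral21_prod_meas1 (integrable_bounded_supp bg)).
congr fine; apply: eq_integral => t _.
rewrite -Rintegral_supp //; last by move=> x; exact: (section_supp _ bg).
rewrite /Rintegral fineK //; apply: integrable_fin_num => //.
apply: (integrable_bounded_supp1 (X := X) (B := B)) => //.
  exact: section_measurable.
by move=> x; exact: (section_supp _ bg).
Qed.

Lemma plane_fubini2 g X : 0 <= X -> bounded_supp g X ->
  \int[M]_z g z = ri (- X) X (fun x => ri (- X) X (fun t => g (x, t))).
Proof.
move=> X0 bg; have [mg [B gB] gX] := bg.
rewrite -Rintegral_supp //; last first.
  move=> x xX; rewrite -Rintegral_supp //.
    by under eq_Rintegral do rewrite (section_supp _ bg) //; rewrite Rintegral_cst // mul0r.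
  by move=> t tX; exact: (section_supp2 _ bg).
rewrite /Rintegral -(integral12_prod_meas1 (integrable_bounded_supp bg)).
congr fine; apply: eq_integral => x _.
rewrite -Rintegral_supp //; last by move=> t; exact: (section_supp2 _ bg).
rewrite /Rintegral fineK //; apply: integrable_fin_num => //.
apply: (integrable_bounded_supp1 (X := X) (B := B)) => //.
  exact: section_measurable2.
by move=> t; exact: (section_supp2 _ bg).
Qed.

Lemma compact_box X : compact (box X).
Proof. by apply: compact_setX; exact: segment_compact. Qed.

Lemma boxE X (z : R * R) : box X z <-> `|z| <= X.
Proof.
case: z => x t; rewrite /box prod_normE /= ge_max !ler_norml /= !in_itv /=.
by split=> [[-> ->]|/andP[]].
Qed.

Lemma continuous_bounded_supp_plane g X : continuous g ->
  (forall z, X < `|z| -> g z = 0) -> bounded_supp g X.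
Proof.
move=> cg gX.
have gX' z : ~ box X z -> g z = 0.
  by move=> zX; apply: gX; rewrite ltNge; apply/negP => h; apply: zX; apply/boxE.
split=> //; first exact: continuous_measurable_plane.
have [B B0 HB] := @continuous_bounded_supp R (plane R) g (box X) cg (@compact_box X) gX'.
by exists B.
Qed.

End PlaneMeasure.

(** * Integration on the line and on the plane *)

Section SpaceCalculus.
Context {R : realType}.

Definition compactly_supported_continuous (E : coord_space R) (g : E -> R) : Prop :=
  continuous g /\ exists2 X : R, 0 <= X & forall x, X < `|x| -> g x = 0.

(* What the theory of regularizations uses of the line and of the plane;
   [bint X] is the integral over the cube of half-side [X]. *)
Record space_calculus (E : coord_space R) := SpaceCalculus {
  bint : R -> (E -> R) -> R;
  bint_integral : forall (g : E -> R) (X : R), 0 <= X -> continuous g ->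
    (forall x, X < `|x| -> g x = 0) -> integral_space g = bint X g;
  bint_param : forall (F : E -> E -> R) (X : R), smooth_param F ->
    rsmooth (fun y => bint X (F ^~ y)) /\
    forall l, rpartial l (fun y => bint X (F ^~ y)) =
      fun y => bint X (fun s => rpartial l (F s) y);
  bint_distribution : forall (k : scalar_kind) (T : (E -> scalar_field R k) -> scalar_field R k)
    (F : E -> E -> scalar_field R k) (C : set E) (X : R), is_distribution T ->
    smooth_family_K F -> compact C -> closed C -> (forall s, supported_in C (F s)) ->
    T (fun y => of_parts k (bint X (fun s => re (F s y))) (bint X (fun s => im (F s y)))) =
    of_parts k (bint X (fun s => re (T (F s)))) (bint X (fun s => im (T (F s))));
  ball_compact : forall X : R, compact [set x : E | `|x| <= X];
  integral_shift : forall (g : E -> R) (y : E), compactly_supported_continuous g ->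
    integral_space (fun x => g (x + y)) = integral_space g;
  integral_scale : forall (g : E -> R) (e : R), 0 < e -> compactly_supported_continuous g ->
    integral_space (fun x => e ^- sp_dim E * g (e^-1 *: x)) = integral_space g;
  integral_add : forall f g : E -> R, compactly_supported_continuous f ->
    compactly_supported_continuous g ->
    integral_space (fun x => f x + g x) = integral_space f + integral_space g;
  lipschitz_test : forall (g : E -> R) (X : R), rsmooth g -> (forall x, X < `|x| -> g x = 0) ->
    exists2 C : R, 0 <= C & forall x y, `|g x - g y| <= C * `|x - y|;
  moment_bound : forall b : E -> R, continuous b ->
    (forall alpha, exists c : R, forall x, `|monomial alpha x| * `|b x| <= c) ->
    exists2 C : R, 0 <= C & forall (h : E -> R) (L : R), 0 <= L -> continuous h ->
      (forall z, `|h z - h 0| <= L * `|z|) ->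
      `|integral_space (fun z => b z * h z) - h 0 * integral_space b| <= C * L }.

(** Here [b] is the kernel and [N] the norm. In [b h = b (h - h0) + h0 b] the first summand is
    dominated by [L |b N|], which is integrable although nothing bounds [h] itself. *)
Lemma first_moment_estimate d (T : measurableType d) (m : {measure set T -> \bar R})
    (b N h : T -> R) (h0 L : R) :
  measurable_fun setT b -> measurable_fun setT N -> measurable_fun setT h ->
  m.-integrable setT (EFin \o b) -> m.-integrable setT (EFin \o (fun x => b x * N x)) ->
  0 <= L -> (forall x, 0 <= N x) -> (forall x, `|h x - h0| <= L * N x) ->
  `|\int[m]_x (b x * h x) - h0 * \int[m]_x b x| <= \int[m]_x `|b x * N x| * L.
Proof.
move=> mb mN mh ib ibN L0 N0 hL.
have mbh : measurable_fun setT (fun x => b x * (h x - h0)).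
  by apply: measurable_funM => //; apply: measurable_funB => //; exact: measurable_cst.
have iL : m.-integrable setT (EFin \o (fun x => L * (b x * N x))).
  by have := integrableZl measurableT L ibN; apply: eq_integrable.
have ibh : m.-integrable setT (EFin \o (fun x => b x * (h x - h0))).
  apply: le_integrable iL => //; first exact/measurable_EFinP.
  move=> x _ /=; rewrite lee_fin !normrM mulrCA ler_wpM2l //.
  by rewrite (le_trans (hL x)) // (ger0_norm L0) (ger0_norm (N0 x)).
have ih0 : m.-integrable setT (EFin \o (fun x => h0 * b x)).
  by have := integrableZl measurableT h0 ib; apply: eq_integrable.
have -> : (fun x => b x * h x) = (fun x => b x * (h x - h0) + h0 * b x).
  by apply/funext => x; ring.
rewrite RintegralD // RintegralZl // addrK.
apply: (le_trans (le_normr_Rintegral _ ibh)) => //.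
rewrite -RintegralZr //; last first.
  by have := integrable_norm ibN; apply: eq_integrable.
apply: le_Rintegral => //.
- by have := integrable_norm ibh; apply: eq_integrable.
- have := integrableZr measurableT L (integrable_norm ibN); by apply: eq_integrable.
- move=> x _; rewrite !normrM -mulrA ler_wpM2l // mulrC.
  by rewrite (ger0_norm (N0 x)) hL.
Qed.

(** The integrable majorant against which the decay of Schwartz functions is measured. *)
Lemma integrable_oneDsqrV : mu.-integrable setT (EFin \o (fun x : R => (oneDsqr x)^-1)).
Proof.
apply/integrableP; split.
  apply/measurable_EFinP; apply: continuous_measurable_fun; exact: continuous_oneDsqrV.
under eq_integral => x _ do rewrite /= ger0_norm ?invr_ge0 //.
rewrite ge0_symfun_integralT //=.
- rewrite (_ : [set x | 0 <= x] = `[0, +oo[%classic); last first.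
    by apply/seteqP; split => x /=; rewrite in_itv /= andbT.
  by rewrite integral0y_oneDsqr ltry.
- exact: continuous_oneDsqrV.
- by move=> x /=; rewrite /oneDsqr /= sqrrN.
Qed.

Lemma integrable_oneDsqrV_plane :
  ((@lebesgue_measure R) \x (@lebesgue_measure R))%E.-integrable setT
    (EFin \o (fun z : R * R => (oneDsqr z.1)^-1 * (oneDsqr z.2)^-1)).
Proof.
have c2 : continuous (fun z : R * R => (oneDsqr z.1)^-1 * (oneDsqr z.2)^-1).
  have co : continuous (fun x : R => (oneDsqr x)^-1) by exact: continuous_oneDsqrV.
  apply: continuousT_mul; [apply: (continuousT_comp co (f := fst))|apply: (continuousT_comp co (f := snd))].
    by apply: continuousT_fst; exact: continuousT_id.
  by apply: continuousT_snd; exact: continuousT_id.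
apply/integrableP; split.
  by apply/measurable_EFinP; exact: continuous_measurable_plane.
have i1 := integrable_oneDsqrV.
have [r Er] : exists r, (\int[mu]_x ((oneDsqr x)^-1)%:E = r%:E :> \bar R)%E.
  exists (fine (\int[mu]_x ((oneDsqr x)^-1)%:E)%E).
  by have /= := integrable_fin_num measurableT i1; move/fineK.
under eq_integral => z _ do rewrite /= ger0_norm ?mulr_ge0 ?invr_ge0 ?oneDsqr_ge0 //.
rewrite fubini_tonelli1 //=; last first.
  by apply/measurable_EFinP; exact: continuous_measurable_plane.
rewrite /fubini_F /=.
under eq_integral => x _.
  under eq_integral => y _ do rewrite EFinM.
  rewrite integralZl //= Er.
  over.
by rewrite integralZr //= Er -EFinM ltry.
Qed.

Lemma ri_supp (g : R -> R) (X a b : R) : continuous g -> 0 <= X ->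
  (forall x, X <= `|x| -> g x = 0) -> a <= - X -> X <= b -> ri a b g = ri (- X) X g.
Proof.
move=> cg X0 gX aX Xb; rewrite (ri_chasles a (- X) b cg) (ri_chasles (- X) X b cg).
have z1 : ri a (- X) g = 0.
  rewrite -(ri0 (R := R) a (- X)); apply: ri_eq => x [] /andP[h1 h2]; apply: gX.
    by rewrite ler_normr lerNr h2 orbT.
  by rewrite ler_normr lerNr (le_trans h2 aX) orbT.
have z2 : ri X b g = 0.
  rewrite -(ri0 (R := R) X b); apply: ri_eq => x [] /andP[h1 h2]; apply: gX.
    by rewrite ler_normr h1.
  by rewrite ler_normr (le_trans Xb).
by rewrite z1 z2 add0r addr0.
Qed.

Lemma ri_supp_shift (g : R -> R) (X Y c : R) : continuous g -> 0 <= X ->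
  (forall x, X <= `|x| -> g x = 0) -> X + `|c| <= Y ->
  ri (- Y) Y (fun x => g (x + c)) = ri (- X) X g.
Proof.
move=> cg X0 gX XY; rewrite ri_shift //; have := ler_norm c; have := ler_norm (- c).
rewrite normrN => h1 h2.
by apply: ri_supp => //; lra.
Qed.

Lemma ri_supp_scale (g : R -> R) (X Y c : R) : continuous g -> 0 <= X ->
  (forall x, X <= `|x| -> g x = 0) -> 0 < c -> c * X <= Y ->
  c^-1 * ri (- Y) Y (fun x => g (c^-1 * x)) = ri (- X) X g.
Proof.
move=> cg X0 gX c0 XY.
have := @ri_affine R g (- Y) Y c^-1 0 cg.
under [X in _ * ri _ _ X = _]eq_fun do rewrite addr0.
move=> ->; rewrite !addr0; apply: ri_supp => //.
  by rewrite mulrN lerN2 ler_pdivlMl.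
by rewrite ler_pdivlMl.
Qed.

Lemma rsmooth_line_derive (g : line R -> R) (x : R) : rsmooth g ->
  is_derive x 1 (g : R -> R) ('D_(1:R) (g : R -> R) x).
Proof. by move=> sg; exact: (@rsmooth_is_derive R (line R) g x ord0 sg). Qed.

Lemma cc_bound (E : coord_space R) (f g : E -> R) : compactly_supported_continuous f ->
  compactly_supported_continuous g ->
  exists2 X : R, 0 <= X & forall x, X < `|x| -> f x = 0 /\ g x = 0.
Proof.
move=> [_ [X X0 fX]] [_ [Y Y0 gY]]; exists (Num.max X Y); first by rewrite le_max X0.
by move=> x; rewrite gt_max => /andP[/fX -> /gY ->].
Qed.

Lemma oneD_sqr_le (x : R) : 1 + `|x| <= 2 * (1 + x ^+ 2).
Proof.
rewrite -real_normK ?num_real //; have := sqr_ge0 (`|x| - 1); rewrite sqrrB1; nra.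
Qed.

Lemma line_moment (b : line R -> R) : continuous b ->
  (forall alpha, exists c : R, forall x, `|monomial alpha x| * `|b x| <= c) ->
  exists2 C : R, 0 <= C & forall (h : line R -> R) (L : R), 0 <= L -> continuous h ->
      (forall z, `|h z - h 0| <= L * `|z|) ->
      `|integral_space (fun z => b z * h z) - h 0 * integral_space b| <= C * L.
Proof.
move=> cb Hb.
have mono n : exists c : R, forall x : R, x ^+ (2 * n) * `|b x| <= c.
  have [c Hc] := Hb (fun=> (2 * n)%N); exists c => x.
  apply: le_trans (Hc x); rewrite /monomial big_ord1 /= ler_wpM2r //.
  exact: ler_norm.
have [c0 H0] := mono 0; have [c1 H1] := mono 1; have [c2 H2] := mono 2.
(* One factor [1 + x^2] dominates [(1 + |x|) / 2], the other one gives the integrable weight. The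
   constant [c0 + 2 c1 + c2] comes from expanding [(1 + x^2)^2] into the moments of order 0, 2 and
   4. *)
have key x : (1 + `|x|) * `|b x| <= 2 * (c0 + 2 * c1 + c2) * (oneDsqr x)^-1.
  rewrite ler_pdivlMr ?oneDsqr_gt0 // /oneDsqr.
  apply: (@le_trans _ _ (2 * (1 + x ^+ 2) * `|b x| * (1 + x ^+ 2))).
    by rewrite !ler_wpM2r ?oneD_sqr_le // addr_ge0 ?sqr_ge0.
  have := H0 x; have := H1 x; have := H2 x; rewrite expr0.
  have -> : x ^+ (2 * 2) = x ^+ 2 * x ^+ 2 by rewrite -exprD.
  rewrite muln1; lra.
have cb1 : measurable_fun setT (b : measurableTypeR R -> R) by exact: continuous_measurable_fun.
have cN : measurable_fun setT ((fun x => `|x|) : measurableTypeR R -> R).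
  by apply: continuous_measurable_fun; apply: continuousT_norm; exact: continuousT_id.
have ik := integrableZl measurableT (2 * (c0 + 2 * c1 + c2)) integrable_oneDsqrV.
have ib : mu.-integrable setT (EFin \o (b : R -> R)).
  apply: le_integrable ik => //; first exact/measurable_EFinP.
  move=> x _ /=; rewrite lee_fin [leRHS]ger0_norm; last first.
    by apply: le_trans (key x); rewrite mulr_ge0 // addr_ge0.
  by apply: le_trans (key x); rewrite ler_peMl // lerDl.
have ibN : mu.-integrable setT (EFin \o (fun x : R => b x * `|x|)).
  apply: le_integrable ik => //; first by apply/measurable_EFinP; exact: measurable_funM.
  move=> x _ /=; rewrite lee_fin [leRHS]ger0_norm; last first.
    by apply: le_trans (key x); rewrite mulr_ge0 // addr_ge0.
  by apply: le_trans (key x); rewrite normrM normr_id mulrC ler_wpM2r // lerDr.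
exists (\int[mu]_x `|b x * `|x| |); first by apply: Rintegral_ge0 => x _.
move=> h L L0 ch hL.
apply: (first_moment_estimate cb1 cN _ ib ibN L0) => //.
exact: continuous_measurable_fun.
Qed.

Lemma line_integral_supp (g : line R -> R) (X : R) : 0 <= X ->
  (forall x, X < `|x| -> g x = 0) -> integral_space g = ri (- X) X g.
Proof.
move=> X0 gX; apply: Rintegral_supp => // x xX; apply: gX.
by rewrite ltNge ler_norml; apply/negP.
Qed.

Lemma line_ballE (X : R) : [set x : R | `|x| <= X] = `[- X, X]%classic.
Proof. by apply/seteqP; split => x /=; rewrite in_itv /= ler_norml. Qed.

Lemma line_shift (g : line R -> R) (y : line R) : compactly_supported_continuous g ->
  integral_space (fun x => g (x + y)) = integral_space g.
Proof.
move=> [cg [X X0 gX]].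
(* Compact support gives vanishing for [X < |x|] only. Enlarging the radius by 1 gives vanishing on
   the closed condition that [ri_supp_shift] asks for. *)
have gX' x : X + 1 <= `|x| -> g x = 0.
  by move=> h; apply: gX; apply: lt_le_trans h; rewrite ltrDl.
have X10 : 0 <= X + 1 by rewrite addr_ge0.
rewrite (line_integral_supp (g := g) X10) => [|x /ltW /gX' //].
rewrite (@line_integral_supp _ (X + 1 + `|y|)) ?addr_ge0 //; first exact: ri_supp_shift.
move=> x h; apply: gX'; rewrite -(lerD2r `|y|); apply: le_trans (ltW h) _.
by rewrite -{1}[x](addrK y) ler_normB.
Qed.

Lemma line_scale (g : line R -> R) (e : R) : 0 < e -> compactly_supported_continuous g ->
  integral_space (fun x : line R => e ^- 1 * g (e^-1 *: x)) = integral_space g.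
Proof.
move=> e0 [cg [X X0 gX]].
have gX' x : X + 1 <= `|x| -> g x = 0.
  by move=> h; apply: gX; apply: lt_le_trans h; rewrite ltrDl.
have X10 : 0 <= X + 1 by rewrite addr_ge0.
rewrite (line_integral_supp (g := g) X10) => [|x /ltW /gX' //].
rewrite (@line_integral_supp _ (e * (X + 1))) ?mulr_ge0 ?(ltW e0) //; last first.
  move=> x h; rewrite gX' ?mulr0 //.
  by rewrite normrM gtr0_norm ?invr_gt0 // ler_pdivlMl // ltW.
rewrite riZ; last first.
  apply: (continuousT_comp cg); apply: continuousT_mul; [exact: continuousT_cst|exact: continuousT_id].
by rewrite expr1; apply: ri_supp_scale.
Qed.

Lemma line_add (f g : line R -> R) : compactly_supported_continuous f ->
  compactly_supported_continuous g ->
  integral_space (fun x => f x + g x) = integral_space f + integral_space g.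
Proof.
move=> cf cg; have [X X0 H] := cc_bound cf cg.
rewrite !(@line_integral_supp _ X) ?riD //; [exact: cf.1|exact: cg.1|..].
- by move=> x /H[].
- by move=> x /H[].
- by move=> x /H[-> ->]; rewrite addr0.
Qed.

Lemma line_lipschitz (g : line R -> R) (X : R) : rsmooth g -> (forall x, X < `|x| -> g x = 0) ->
  exists2 C : R, 0 <= C & forall x y, `|g x - g y| <= C * `|x - y|.
Proof.
move=> sg gX.
have gX' (x : line R) : ~ [set x : R | `|x| <= X] x -> g x = 0.
  by move=> xX; apply: gX; rewrite ltNge; apply/negP.
have cX : compact [set x : R | `|x| <= X] by rewrite line_ballE; exact: segment_compact.
have clX : closed [set x : R | `|x| <= X] by rewrite line_ballE; exact: interval_closed.
have [C C0 HC] := @continuous_bounded_supp R (line R) _ _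
   (rsmooth_continuous (@rsmooth_D R (line R) ord0 g sg)) cX
   (@rpartial_supp R (line R) [:: ord0] g _ clX gX').
exists C => // x y.
apply: (@mean_value_le R g ('D_(1:R) (g : R -> R)) y x C) => [z|z _]; last exact: HC.
exact: rsmooth_line_derive.
Qed.

Definition line_calculus : space_calculus (line R).
Proof.
apply: (@SpaceCalculus (line R) (fun X g => ri (- X) X g)).
- by move=> g X X0 _; exact: line_integral_supp.
- by move=> F X sF; split; [exact: rsmooth_param_ri|move=> l; exact: rpartial_param_ri].
- by move=> k T F C X dT sF cC clC FC; exact: (distribution_interval_integral dT (- X) X sF cC clC FC).
- by move=> X; have := @segment_compact R (- X) X; rewrite -line_ballE.
- exact: line_shift.
- exact: line_scale.
- exact: line_add.
- exact: line_lipschitz.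
- exact: line_moment.
Defined.

Definition pint (X : R) (g : R * R -> R) : R :=
  ri (- X) X (fun t => ri (- X) X (fun x => g (x, t))).

Lemma plane_integral_supp (g : plane R -> R) (X : R) : 0 <= X -> continuous g ->
  (forall x, X < `|x| -> g x = 0) -> integral_space g = pint X g.
Proof. by move=> X0 cg gX; apply: plane_fubini => //; exact: continuous_bounded_supp_plane. Qed.

Lemma plane_param (F : plane R -> plane R -> R) (X : R) : smooth_param F ->
    rsmooth (fun y => pint X (F ^~ y)) /\ forall l, rpartial l (fun y => pint X (F ^~ y)) =
      fun y => pint X (fun s => rpartial l (F s) y).
Proof.
move=> sF; pose G (t : R) (y : plane R) := ri (- X) X (fun x => F (x, t) y).
have sF1 t : smooth_param (fun x : R => F (x, t)).
  apply: (@smooth_param_pullback R (plane R) _ _ F (fun x : R => (x, t) : plane R)) => //.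
  by apply: continuousT_pair; [exact: continuousT_id|exact: continuousT_cst].
have sG : smooth_param G.
  apply: (@smooth_param_ri R (plane R) R (fun x t => F (x, t))).
  by apply: (@smooth_param_pullback R (plane R) _ _ F (fun p : R * R => (p.1, p.2) : plane R)) => //; cont.
split; first exact: (rsmooth_param_ri _ _ sG).
move=> l; rewrite (rpartial_param_ri l _ _ sG); apply/funext => y; congr ri; apply/funext => t.
by rewrite /G (rpartial_param_ri l _ _ (sF1 t)).
Qed.

(** The exchange on a segment is used twice: the inner integral in x is again a smooth family in t
    with supports in [C], so [T] first passes under the outer integral and then under the inner
    one. *)
Lemma plane_distribution (k : scalar_kind) (T : (plane R -> scalar_field R k) -> scalar_field R k)
    (F : plane R -> plane R -> scalar_field R k) (C : set (plane R)) (X : R) : is_distribution T ->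
    smooth_family_K F -> compact C -> closed C -> (forall s, supported_in C (F s)) ->
    T (fun y => of_parts k (pint X (fun s => re (F s y))) (pint X (fun s => im (F s y)))) =
    of_parts k (pint X (fun s => re (T (F s)))) (pint X (fun s => im (T (F s)))).
Proof.
move=> dT sF cC clC FC.
pose G (t : R) (y : plane R) := interval_integral (- X) X (fun x => F (x, t) y).
have sF1 t : smooth_family_K (fun x : R => F (x, t)).
  have cx : continuous (fun x : R => (x, t) : plane R).
    by apply: continuousT_pair; [exact: continuousT_id|exact: continuousT_cst].
  split; first exact: (@smooth_param_pullback R (plane R) _ _ _ (fun x : R => (x, t) : plane R) cx sF.1).
  exact: (@smooth_param_pullback R (plane R) _ _ _ (fun x : R => (x, t) : plane R) cx sF.2).
have cp : continuous (fun p : R * R => (p.1, p.2) : plane R) by cont.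
have sG : smooth_family_K G.
  split; [under eq_fun do under eq_fun do rewrite re_interval_integral|
          under eq_fun do under eq_fun do rewrite im_interval_integral].
    apply: (@smooth_param_ri R (plane R) R (fun x t y => re (F (x, t) y))).
    exact: (@smooth_param_pullback R (plane R) _ _ _ (fun p : R * R => (p.1, p.2) : plane R) cp sF.1).
  apply: (@smooth_param_ri R (plane R) R (fun x t y => im (F (x, t) y))).
  exact: (@smooth_param_pullback R (plane R) _ _ _ (fun p : R * R => (p.1, p.2) : plane R) cp sF.2).
have GC t : supported_in C (G t).
  move=> y Cy; apply: scalar_eq; rewrite ?re_interval_integral ?im_interval_integral ?re0 ?im0.
    by under eq_fun do rewrite (FC _ _ Cy) re0; rewrite ri0.
  by under eq_fun do rewrite (FC _ _ Cy) im0; rewrite ri0.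
have E1 := distribution_interval_integral dT (- X) X sG cC clC GC.
have E2 t := distribution_interval_integral dT (- X) X (sF1 t) cC clC (fun x => FC (x, t)).
have -> : (fun y => of_parts k (pint X (fun s => re (F s y))) (pint X (fun s => im (F s y)))) =
    fun y => interval_integral (- X) X (G ^~ y).
  apply/funext => y; congr of_parts; congr ri; apply/funext => t /=.
    by rewrite re_interval_integral.
  by rewrite im_interval_integral.
rewrite E1; congr of_parts; congr ri; apply/funext => t /=.
  by rewrite E2 re_interval_integral.
by rewrite E2 im_interval_integral.
Qed.

Lemma plane_norm_le (X : R) (x t : R) : (`|(x, t)| <= X :> R) = (`|x| <= X) && (`|t| <= X).
Proof. by rewrite prod_normE /= ge_max. Qed.

Lemma plane_norm_lt (X : R) (x t : R) : (X < `|(x, t)| :> R) = (X < `|x|) || (X < `|t|).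
Proof. by rewrite prod_normE /= lt_max. Qed.

Lemma plane_section (g : plane R -> R) (X : R) : continuous g ->
  (forall x, X < `|x| -> g x = 0) ->
  [/\ (forall t, continuous (fun x => g (x, t))),
      continuous (fun t => ri (- X) X (fun x => g (x, t))) &
      forall t, X < `|t| -> ri (- X) X (fun x => g (x, t)) = 0].
Proof.
move=> cg gX; split.
- by move=> t; apply: (continuousT_comp cg); apply: continuousT_pair; [exact: continuousT_id|exact: continuousT_cst].
- by apply: (@continuous_param_ri R R (fun x t => g (x, t))); apply: (continuousT_comp cg); cont.
- move=> t tX; rewrite -[RHS](ri0 (R := R) (- X) X); apply: ri_eq => x _; apply: gX.
  by rewrite plane_norm_lt tX orbT.
Qed.

Lemma plane_shift (g : plane R -> R) (y : plane R) : compactly_supported_continuous g ->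
  integral_space (fun x => g (x + y)) = integral_space g.
Proof.
move=> [cg [X X0 gX]]; case: y => y1 y2.
have X10 : 0 <= X + 1 by rewrite addr_ge0.
have gX' x : X + 1 <= `|x| -> g x = 0.
  by move=> h; apply: gX; apply: lt_le_trans h; rewrite ltrDl.
have [cg1 cg2 gz] := plane_section cg (fun x h => gX' x (ltW h)).
have nz : 0 <= `|(y1, y2)| :> R by [].
have [ny1 ny2] : `|y1| <= `|(y1, y2)| /\ `|y2| <= `|(y1, y2)|.
  by apply/andP; rewrite -plane_norm_le.
rewrite (plane_integral_supp X10 cg) => [|x /ltW /gX' //].
have Y0 : 0 <= X + 1 + `|(y1, y2)| by apply: addr_ge0.
rewrite (@plane_integral_supp _ _ Y0); last 2 first.
- apply: (continuousT_comp cg); apply: continuousT_add; [exact: continuousT_id|exact: continuousT_cst].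
- move=> x h; apply: gX'; rewrite -(lerD2r `|(y1, y2)|); apply: le_trans (ltW h) _.
  by rewrite -{1}[x](addrK (y1, y2)) ler_normB.
rewrite /pint; under [X in ri _ _ X = _]eq_fun => t.
  rewrite (_ : (fun x => _) = fun x => g (x + y1, t + y2)) //.
  rewrite (@ri_supp_shift (fun x => g (x, t + y2)) (X + 1)) //; last 2 first.
  - by move=> x hx; apply: gX'; rewrite prod_normE /= le_max hx.
  - by rewrite lerD2l.
  over.
apply: (@ri_supp_shift (fun t => ri (- (X + 1)) (X + 1) (fun x => g (x, t)))) => //.
- move=> t ht; rewrite -[RHS](ri0 (R := R) (- (X + 1)) (X + 1)); apply: ri_eq => x _; apply: gX'.
  by rewrite prod_normE /= le_max ht orbT.
- by rewrite lerD2l.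
Qed.

Lemma plane_scale (g : plane R -> R) (e : R) : 0 < e -> compactly_supported_continuous g ->
  integral_space (fun x : plane R => e ^- 2 * g (e^-1 *: x)) = integral_space g.
Proof.
move=> e0 [cg [X X0 gX]].
have X10 : 0 <= X + 1 by rewrite addr_ge0.
have gX' x : X + 1 <= `|x| -> g x = 0.
  by move=> h; apply: gX; apply: lt_le_trans h; rewrite ltrDl.
have [cg1 cg2 gz] := plane_section cg (fun x h => gX' x (ltW h)).
rewrite (plane_integral_supp X10 cg) => [|x /ltW /gX' //].
have Y0 : 0 <= e * (X + 1) by rewrite mulr_ge0 // ltW.
rewrite (@plane_integral_supp _ _ Y0); last 2 first.
- apply: continuousT_mul; first exact: continuousT_cst.
  apply: (continuousT_comp cg); apply: continuousT_scale; [exact: continuousT_cst|exact: continuousT_id].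
- move=> x h; rewrite gX' ?mulr0 //.
  by rewrite normrZ gtr0_norm ?invr_gt0 // ler_pdivlMl // ltW.
have cs (h : R -> R) : continuous h -> continuous (fun x => h (e^-1 * x)).
  move=> ch; apply: (continuousT_comp ch).
  by apply: continuousT_mul; [exact: continuousT_cst|exact: continuousT_id].
rewrite /pint; under [X in ri _ _ X = _]eq_fun => t.
  rewrite (_ : (fun x => _) = fun x => e ^- 2 * g (e^-1 * x, e^-1 * t)) //.
  rewrite riZ; last exact: (cs (fun x => g (x, e^-1 * t))).
  rewrite (_ : e ^- 2 = e^-1 * e^-1) -?mulrA; last by rewrite -exprVn expr2.
  rewrite (@ri_supp_scale (fun x => g (x, e^-1 * t)) (X + 1)) //; last first.
    by move=> x hx; apply: gX'; rewrite prod_normE /= le_max hx.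
  over.
rewrite riZ; last exact: (cs (fun t => ri (- (X + 1)) (X + 1) (fun x => g (x, t)))).
apply: (@ri_supp_scale (fun t => ri (- (X + 1)) (X + 1) (fun x => g (x, t)))) => //.
move=> t ht; rewrite -[RHS](ri0 (R := R) (- (X + 1)) (X + 1)); apply: ri_eq => x _; apply: gX'.
by rewrite prod_normE /= le_max ht orbT.
Qed.

Lemma plane_add (f g : plane R -> R) : compactly_supported_continuous f ->
  compactly_supported_continuous g ->
  integral_space (fun x => f x + g x) = integral_space f + integral_space g.
Proof.
move=> cf cg; have [X X0 H] := cc_bound cf cg.
have [cf1 cf2 _] := plane_section cf.1 (fun x h => (H x h).1).
have [cg1 cg2 _] := plane_section cg.1 (fun x h => (H x h).2).
rewrite !(@plane_integral_supp _ X) //; [|exact: cg.1|by move=> x /H[]|exact: cf.1|by move=> x /H[]|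
  by apply: continuousT_add; [exact: cf.1|exact: cg.1]|by move=> x /H[-> ->]; rewrite addr0].
rewrite /pint -riD //; congr ri; apply/funext => t.
by rewrite -riD.
Qed.

Lemma plane_ballE (X : R) : [set x : plane R | `|x| <= X] = box X.
Proof. by apply/seteqP; split => z; rewrite boxE. Qed.

Lemma plane_ball_compact (X : R) : compact [set x : plane R | `|x| <= X].
Proof. by rewrite plane_ballE; exact: compact_box. Qed.

Lemma rsmooth_plane_line (g : plane R -> R) (p q al be s : R) : rsmooth g ->
  is_derive s 1 (fun s => g (p + al * s, q + be * s))
   (al * 'D_(sp_axis (dir_x R)) g (p + al * s, q + be * s) +
    be * 'D_(sp_axis (dir_t R)) g (p + al * s, q + be * s)).
Proof.
move=> sg; apply: (@is_derive_along_line R g ('D_(sp_axis (dir_x R)) g) ('D_(sp_axis (dir_t R)) g)).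
- by move=> z; exact: (@rsmooth_is_derive R (plane R) g z (dir_x R) sg).
- by move=> z; exact: (@rsmooth_is_derive R (plane R) g z (dir_t R) sg).
- exact: (rsmooth_continuous (rsmooth_D (dir_x R) sg)).
- exact: (rsmooth_continuous (rsmooth_D (dir_t R) sg)).
Qed.

(** The mean value estimate along the segment joining the two points; the bounds of the two partial
    derivatives add up. *)
Lemma plane_lipschitz (g : plane R -> R) (X : R) : rsmooth g -> (forall x, X < `|x| -> g x = 0) ->
  exists2 C : R, 0 <= C & forall x y, `|g x - g y| <= C * `|x - y|.
Proof.
move=> sg gX.
have gX' (x : plane R) : ~ [set x : plane R | `|x| <= X] x -> g x = 0.
  by move=> xX; apply: gX; rewrite ltNge; apply/negP.
have cX := @plane_ball_compact X.
have clX : closed [set x : plane R | `|x| <= X].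
  by apply: compact_closed => //; exact: norm_hausdorff.
have HD i := @continuous_bounded_supp R (plane R) _ _
   (rsmooth_continuous (rsmooth_D i sg)) cX (@rpartial_supp R (plane R) [:: i] g _ clX gX').
have [C C0 HC] := HD (dir_x R); have [D D0 HDt] := HD (dir_t R).
exists (C + D); first by rewrite addr_ge0.
move=> [x t] [y s].
have := mean_value_le (a := 0) (b := 1) (C := (C + D) * `|(x, t) - (y, s)|)
   (fun r => rsmooth_plane_line y s (x - y) (t - s) r sg).
rewrite !mulr1 !mulr0 !addr0 subr0 normr1 mulr1 ![_ + (_ - _)]addrC !subrK; apply => r _.
have [n1 n2] : `|x - y| <= `|(x, t) - (y, s)| /\ `|t - s| <= `|(x, t) - (y, s)|.
  by apply/andP; rewrite -plane_norm_le.
apply: (le_trans (ler_normD _ _)); rewrite !normrM [leRHS]mulrDl; apply: lerD.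
  by rewrite mulrC ler_pM.
by rewrite mulrC ler_pM.
Qed.

Lemma plane_moment (b : plane R -> R) : continuous b ->
  (forall alpha, exists c : R, forall x, `|monomial alpha x| * `|b x| <= c) ->
  exists2 C : R, 0 <= C & forall (h : plane R -> R) (L : R), 0 <= L -> continuous h ->
      (forall z, `|h z - h 0| <= L * `|z|) ->
      `|integral_space (fun z => b z * h z) - h 0 * integral_space b| <= C * L.
Proof.
move=> cb Hb.
have mono n m : exists c : R, forall z : plane R, z.1 ^+ (2 * n) * z.2 ^+ (2 * m) * `|b z| <= c.
  have [c Hc] := Hb (fun i => if i == ord0 then (2 * n)%N else (2 * m)%N); exists c => x.
  apply: le_trans (Hc x); rewrite /monomial big_ord_recl big_ord1 /= ler_wpM2r //.
  exact: ler_norm.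
(* The nine moments, of orders 0, 2 and 4 in each coordinate, are weighted with the coefficients of
   [(1 + p)^2 (1 + q)^2]. One factor [(1 + p) (1 + q)] absorbs the norm, the other is the integrable
   weight. *)
have [c Hc] : exists c : R, forall z : plane R,
   (1 + z.1 ^+ 2) ^+ 2 * (1 + z.2 ^+ 2) ^+ 2 * `|b z| <= c.
  have [c00 H00] := mono 0 0; have [c01 H01] := mono 0 1; have [c02 H02] := mono 0 2.
  have [c10 H10] := mono 1 0; have [c11 H11] := mono 1 1; have [c12 H12] := mono 1 2.
  have [c20 H20] := mono 2 0; have [c21 H21] := mono 2 1; have [c22 H22] := mono 2 2.
  exists (c00 + 2 * c01 + c02 + 2 * c10 + 4 * c11 + 2 * c12 + c20 + 2 * c21 + c22) => z.
  move: (H00 z) (H01 z) (H02 z) (H10 z) (H11 z) (H12 z) (H20 z) (H21 z) (H22 z).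
  rewrite !muln0 !muln1 !expr0 !mul1r !mulr1 (_ : (2 * 2 = 2 + 2)%N) // !exprD.
  by move: (z.1 ^+ 2) (z.2 ^+ 2) (`|b z|) => p q r *; rewrite !expr2; lra.
have wpos (z : R * R) : 0 < (1 + z.1 ^+ 2) * (1 + z.2 ^+ 2).
  by rewrite mulr_gt0 // ltr_pwDl // sqr_ge0.
have key (z : R * R) : (1 + `|z|) * `|b z| <= 2 * c * ((oneDsqr z.1)^-1 * (oneDsqr z.2)^-1).
  rewrite -invfM /oneDsqr ler_pdivlMr //.
  apply: (@le_trans _ _ (2 * ((1 + z.1 ^+ 2) * (1 + z.2 ^+ 2)) * `|b z| * ((1 + z.1 ^+ 2) * (1 + z.2 ^+ 2)))).
    rewrite ler_wpM2r ?(ltW (wpos z)) // ler_wpM2r //.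
    have h1 := oneD_sqr_le z.1; have h2 := oneD_sqr_le z.2.
    have p1 := sqr_ge0 z.1; have p2 := sqr_ge0 z.2.
    have p12 : 0 <= z.1 ^+ 2 * z.2 ^+ 2 by rewrite mulr_ge0.
    rewrite prod_normE /=; case: (leP `|z.1| `|z.2|) => _; nra.
  by have := Hc z; rewrite !expr2; lra.
have c0 : 0 <= c by apply: le_trans (Hc 0); rewrite mulr_ge0 // mulr_ge0 // sqr_ge0.
have mb : measurable_fun setT (b : measurableTypeR R * measurableTypeR R -> R) by exact: continuous_measurable_plane.
have mN : measurable_fun setT ((fun z : R * R => `|z|) : measurableTypeR R * measurableTypeR R -> R).
  by apply: continuous_measurable_plane; apply: continuousT_norm; exact: continuousT_id.
have ik := integrableZl measurableT (2 * c) integrable_oneDsqrV_plane.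
have ib : ((@lebesgue_measure R) \x (@lebesgue_measure R))%E.-integrable setT (EFin \o (b : R * R -> R)).
  apply: le_integrable ik => //; first exact/measurable_EFinP.
  move=> x _ /=; rewrite lee_fin [leRHS]ger0_norm; last first.
    by apply: le_trans (key x); rewrite mulr_ge0 // addr_ge0.
  by apply: le_trans (key x); rewrite ler_peMl // lerDl.
have ibN : ((@lebesgue_measure R) \x (@lebesgue_measure R))%E.-integrable setT (EFin \o (fun x : R * R => b x * `|x|)).
  apply: le_integrable ik => //; first by apply/measurable_EFinP; exact: measurable_funM.
  move=> x _ /=; rewrite lee_fin [leRHS]ger0_norm; last first.
    by apply: le_trans (key x); rewrite mulr_ge0 // addr_ge0.
  by apply: le_trans (key x); rewrite normrM normr_id mulrC ler_wpM2r // lerDr.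
exists (\int[(lebesgue_measure \x lebesgue_measure)%E]_x `|b x * `|x| |); first by apply: Rintegral_ge0 => x _.
move=> h L L0 ch hL.
apply: (first_moment_estimate mb mN _ ib ibN L0) => //.
exact: continuous_measurable_plane.
Qed.

Definition plane_calculus : space_calculus (plane R).
Proof.
apply: (@SpaceCalculus (plane R) pint).
- exact: plane_integral_supp.
- exact: plane_param.
- exact: plane_distribution.
- exact: plane_ball_compact.
- exact: plane_shift.
- exact: plane_scale.
- exact: plane_add.
- exact: plane_lipschitz.
- exact: plane_moment.
Defined.

End SpaceCalculus.

(** * Regularization of distributions *)

Section Regularization.
Context {R : realType} {k : scalar_kind} {E : coord_space R}.
Variable cal : space_calculus E.
Local Notation K := (scalar_field R k).
Local Notation I := (@integral_space R E).
Local Notation cc := compactly_supported_continuous.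
Implicit Types (f g h : E -> R) (u psi : E -> K) (l : seq 'I_(sp_dim E)).

Lemma cc0 : cc (fun _ : E => 0 : R).
Proof. by split; [exact: continuousT_cst|exists 0]. Qed.

Lemma cc_mull f g : cc f -> continuous g -> cc (fun x => f x * g x).
Proof.
move=> [cf [X X0 fX]] cg; split; first exact: continuousT_mul.
by exists X => // x /fX ->; rewrite mul0r.
Qed.

Lemma cc_add f g : cc f -> cc g -> cc (fun x => f x + g x).
Proof.
move=> cf cg; have [X X0 H] := cc_bound cf cg.
split; first by apply: continuousT_add; [exact: cf.1|exact: cg.1].
by exists X => // x /H[-> ->]; rewrite addr0.
Qed.

Lemma cc_opp f : cc f -> cc (fun x => - f x).
Proof.
move=> [cf [X X0 H]]; split; first exact: continuousT_opp.
by exists X => // x /H ->; rewrite oppr0.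
Qed.

Lemma integral_space0 : I (fun=> 0) = 0.
Proof.
have := integral_add cal cc0 cc0; under eq_fun do rewrite addr0.
by move=> h; apply/eqP; rewrite -[X in X == _](addrK (I (fun=> 0))) -h subrr.
Qed.

Lemma integral_sub f g : cc f -> cc g -> I (fun x => f x - g x) = I f - I g.
Proof.
move=> cf cg.
have := integral_add cal (cc_add cf (cc_opp cg)) cg.
under eq_fun do rewrite subrK.
by move=> ->; rewrite addrK.
Qed.

Lemma re_Kintegral u : re (Kintegral u) = I (fun x => re (u x)).
Proof. exact: re_of_parts. Qed.

Lemma im_Kintegral u : im (Kintegral u) = I (fun x => im (u x)).
Proof.
rewrite /Kintegral im_of_parts // => kR.
by rewrite (im_funE u kR) integral_space0.
Qed.

Lemma test_bounded psi : test psi ->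
  exists2 X : R, 0 <= X & forall x, X < `|x| -> psi x = 0.
Proof.
move=> [_ [C [cC _ Cpsi]]]; have [M [_ HM]] := compact_bounded cC.
exists (`|M| + 1) => [|x hx]; first by rewrite addr_ge0.
apply: Cpsi => Cx; have := HM (`|M| + 1) _ x Cx.
rewrite (le_lt_trans (ler_norm M)) ?ltrDl // => /(_ isT).
by rewrite /= leNgt hx.
Qed.

Lemma ball_closed (X : R) : closed [set x : E | `|x| <= X].
Proof. by apply: compact_closed; [exact: norm_hausdorff|exact: (@ball_compact R E cal X)]. Qed.

Lemma smooth_bounded_test (psi : E -> K) (X : R) : smooth psi ->
  (forall x, X < `|x| -> psi x = 0) -> test psi.
Proof.
move=> sp pX; apply: (test_supported sp (@ball_compact R E cal X)) => x xX.
by apply: pX; rewrite ltNge; apply/negP.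
Qed.

Lemma test_partial psi l : test psi -> test (partial l psi).
Proof.
move=> tp; have [X X0 pX] := test_bounded tp; have sp := tp.1.
have pX' x : ~ [set x : E | `|x| <= X] x -> psi x = 0.
  by move=> xX; apply: pX; rewrite ltNge; apply/negP.
apply: (@smooth_bounded_test _ X).
  exact: (smooth_of_re_im (rsmooth_rpartial l (smooth_re sp)) (rsmooth_rpartial l (smooth_im sp))
    (re_partial l psi) (im_partial l psi)).
move=> x hx; have xX : ~ [set x : E | `|x| <= X] x by rewrite /= leNgt hx.
apply: scalar_eq; rewrite ?re_partial ?im_partial ?re0 ?im0.
  by apply: (rpartial_supp l (@ball_closed X) _ xX) => y /pX' ->; rewrite re0.
by apply: (rpartial_supp l (@ball_closed X) _ xX) => y /pX' ->; rewrite im0.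
Qed.

Lemma test_lipschitz_bounded psi : test psi -> exists2 C : R, 0 <= C & forall x y,
  [/\ `|re (psi x)| <= C, `|im (psi x)| <= C, `|re (psi x) - re (psi y)| <= C * `|x - y|
    & `|im (psi x) - im (psi y)| <= C * `|x - y|].
Proof.
move=> tp; have [X X0 pX] := test_bounded tp; have sp := tp.1.
have pr x : X < `|x| -> re (psi x) = 0 by move/pX ->; rewrite re0.
have pi x : X < `|x| -> im (psi x) = 0 by move/pX ->; rewrite im0.
have [C1 C10 H1] := lipschitz_test cal (smooth_re sp) pr.
have [C2 C20 H2] := lipschitz_test cal (smooth_im sp) pi.
have bx : compact [set x : E | `|x| <= X]  := @ball_compact R E cal X.
have nX x : ~ [set x : E | `|x| <= X] x -> X < `|x| by move=> h; rewrite ltNge; apply/negP.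
have [C3 C30 H3] := continuous_bounded_supp (rsmooth_continuous (smooth_re sp)) bx (fun x nx => pr x (nX x nx)).
have [C4 C40 H4] := continuous_bounded_supp (rsmooth_continuous (smooth_im sp)) bx (fun x nx => pi x (nX x nx)).
exists (C1 + C2 + C3 + C4); first by rewrite !addr_ge0.
move=> x y; split.
- by apply: le_trans (H3 x) _; lra.
- by apply: le_trans (H4 x) _; lra.
- by apply: le_trans (H1 x y) _; rewrite ler_wpM2r //; lra.
- by apply: le_trans (H2 x y) _; rewrite ler_wpM2r //; lra.
Qed.

Lemma test_cc_re psi : test psi -> cc (fun x => re (psi x)).
Proof.
move=> tp; split; first exact: rsmooth_continuous (smooth_re tp.1).
by have [X X0 pX] := test_bounded tp; exists X => // x /pX ->; rewrite re0.
Qed.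

Lemma test_cc_im psi : test psi -> cc (fun x => im (psi x)).
Proof.
move=> tp; split; first exact: rsmooth_continuous (smooth_im tp.1).
by have [X X0 pX] := test_bounded tp; exists X => // x /pX ->; rewrite im0.
Qed.

Lemma smooth_family_mul_affine (a u : E -> K) (c : R) :
  continuous (fun x => re (a x)) -> continuous (fun x => im (a x)) -> smooth u ->
  smooth_family_K (fun s y => a s * u (c *: y + s)).
Proof.
move=> car cai su.
have fr := smooth_param_affine c (@continuousT_id E) (smooth_re su).
have fi := smooth_param_affine c (@continuousT_id E) (smooth_im su).
split.
  under eq_fun do under eq_fun do rewrite reM.
  by apply: smooth_param_add; [|apply: smooth_param_opp]; exact: smooth_param_scale.
under eq_fun do under eq_fun do rewrite imM.
by apply: smooth_param_add; exact: smooth_param_scale.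
Qed.

Lemma partial_mul_affine l (a : K) u (c : R) (p : E) : smooth u ->
  (rpartial l (fun y => re (a * u (c *: y + p))) =
     fun y => c ^+ size l * re (a * partial l u (c *: y + p))) /\
  (rpartial l (fun y => im (a * u (c *: y + p))) =
     fun y => c ^+ size l * im (a * partial l u (c *: y + p))).
Proof.
move=> su; have sr := smooth_re su; have si := smooth_im su.
have ar := rsmooth_affine c p sr; have ai := rsmooth_affine c p si.
split.
  under [X in rpartial l X]eq_fun do rewrite reM.
  rewrite rpartial_sub; [|exact: rsmooth_scale..].
  rewrite !rpartial_scale // (rpartial_affine l c p sr) (rpartial_affine l c p si).
  by apply/funext => y; rewrite reM re_partial im_partial; ring.
under [X in rpartial l X]eq_fun do rewrite imM.
rewrite rpartial_add; [|exact: rsmooth_scale..].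
rewrite !rpartial_scale // (rpartial_affine l c p sr) (rpartial_affine l c p si).
by apply/funext => y; rewrite imM re_partial im_partial; ring.
Qed.

(* Both integrals are [\int a(s) u(c y + s) ds], with [(a, u, c)] equal to
   [(psi, theta, -1)] and [(theta, psi, 1)]. *)
Lemma convolution_change_of_variable (theta psi : E -> K) y : test theta -> test psi ->
  Kintegral (fun s => psi s * theta (-1 *: y + s)) =
  Kintegral (fun s => theta s * psi (1 *: y + s)).
Proof.
move=> tt tp.
have cp := smooth_affine 1 (- y) tt.1; have [cr ci] := (smooth_re cp, smooth_im cp).
have E1 x : -1 *: y + x = 1 *: x + - y by rewrite scaleN1r scale1r addrC.
apply: scalar_eq; rewrite ?re_Kintegral ?im_Kintegral.
  have cc1 : cc (fun s => re (psi s * theta (1 *: s + - y))).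
    under eq_fun do rewrite reM.
    apply: cc_add; [|apply: cc_opp]; apply: cc_mull; try exact: rsmooth_continuous.
      exact: test_cc_re.
    exact: test_cc_im.
  under eq_fun do rewrite E1.
  rewrite -(integral_shift cal y cc1); congr I; apply/funext => x.
  by rewrite scale1r addrK mulrC scale1r addrC.
have cc1 : cc (fun s => im (psi s * theta (1 *: s + - y))).
  under eq_fun do rewrite imM.
  apply: cc_add; apply: cc_mull; try exact: rsmooth_continuous.
    exact: test_cc_re.
  exact: test_cc_im.
under eq_fun do rewrite E1.
rewrite -(integral_shift cal y cc1); congr I; apply/funext => x.
by rewrite scale1r addrK mulrC scale1r addrC.
Qed.

(** Pairing the convolution of [T] and [theta] with [psi] transposes to [T J]. The two forms of [J]
    serve different ends: in [F] the parameter sits inside [theta], so that [T] can pass under the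
    integral; in [G] the variable sits inside [psi], so that the derivatives fall on [psi] and not
    on the concentrating kernel. *)
Lemma distribution_convolution (T : (E -> K) -> K) (theta psi : E -> K) :
  is_distribution T -> test theta -> test psi ->
  let J y := Kintegral (fun s => theta s * psi (1 *: y + s)) in
  [/\ Kintegral (fun x => T (fun y => theta (x - y)) * psi x) = T J,
   (exists2 X : R, 0 <= X & forall y, X < `|y| -> J y = 0 /\ psi y = 0),
   smooth J &
   forall l, (rpartial l (fun y => re (J y)) = fun y => re (Kintegral (fun s => theta s * partial l psi (1 *: y + s)))) /\
     (rpartial l (fun y => im (J y)) = fun y => im (Kintegral (fun s => theta s * partial l psi (1 *: y + s))))].
Proof.
move=> dT tt tp J.
have [X X0 tX] := test_bounded tt; have [Y Y0 pY] := test_bounded tp.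
have [ctr cti] := (rsmooth_continuous (smooth_re tt.1), rsmooth_continuous (smooth_im tt.1)).
have [cpr cpi] := (rsmooth_continuous (smooth_re tp.1), rsmooth_continuous (smooth_im tp.1)).
pose F s y := psi s * theta (-1 *: y + s).
pose G s y := theta s * psi (1 *: y + s).
have sF : smooth_family_K F by exact: smooth_family_mul_affine cpr cpi tt.1.
have sG : smooth_family_K G by exact: smooth_family_mul_affine ctr cti tp.1.
have JF y : J y = Kintegral (F ^~ y) by rewrite convolution_change_of_variable.
have Gs s y : X < `|s| -> G s y = 0 by move=> /tX h; rewrite /G h mul0r.
have Fs s y : Y < `|s| -> F s y = 0 by move=> /pY h; rewrite /F h mul0r.
have cF y : continuous (fun s => re (F s y)) /\ continuous (fun s => im (F s y)).
  have ca : continuous (fun s : E => (s, y)) by apply: continuousT_pair; [exact: continuousT_id|exact: continuousT_cst].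
  by split; [exact: (continuousT_comp (sF.1.2 [::]) ca)|exact: (continuousT_comp (sF.2.2 [::]) ca)].
have cG l y : continuous (fun s => rpartial l (fun y => re (G s y)) y) /\ continuous (fun s => rpartial l (fun y => im (G s y)) y).
  have ca : continuous (fun s : E => (s, y)) by apply: continuousT_pair; [exact: continuousT_id|exact: continuousT_cst].
  by split; [exact: (continuousT_comp (sG.1.2 l) ca)|exact: (continuousT_comp (sG.2.2 l) ca)].
have FC s : supported_in [set x : E | `|x| <= X + Y] (F s).
  move=> y hy; rewrite /F; have [h|h] := ltP Y `|s|; first by rewrite pY // mul0r.
  rewrite tX ?mulr0 // ltNge; apply/negP => h2; apply: hy => /=.
  rewrite -[y](subrK s) (le_trans (ler_normD _ _)) // lerD //.
  by move: h2; rewrite scaleN1r addrC distrC.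
have cC := @ball_compact R E cal (X + Y); have clC := @ball_closed (X + Y).
have JE : J = fun y => of_parts k (bint cal Y (fun s => re (F s y))) (bint cal Y (fun s => im (F s y))).
  apply/funext => y; rewrite JF; congr of_parts; apply: bint_integral => //.
  - exact: (cF y).1.
  - by move=> s hs /=; rewrite Fs ?re0.
  - exact: (cF y).2.
  - by move=> s hs /=; rewrite Fs ?im0.
have JR : (fun y => re (J y)) = fun y => bint cal X (fun s => re (G s y)).
  apply/funext => y; rewrite re_Kintegral; apply: bint_integral => //.
    exact: (cG [::] y).1.
  by move=> s hs; have := Gs s y hs; rewrite /G => ->; rewrite re0.
have JI : (fun y => im (J y)) = fun y => bint cal X (fun s => im (G s y)).
  apply/funext => y; rewrite im_Kintegral; apply: bint_integral => //.
    exact: (cG [::] y).2.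
  by move=> s hs; have := Gs s y hs; rewrite /G => ->; rewrite im0.
split.
- have -> : (fun x => T (fun y => theta (x - y)) * psi x) = fun x => T (F x).
    apply/funext => x; rewrite /F (distribution_scale dT (psi x) (psi := fun y => theta (-1 *: y + x))).
      rewrite mulrC; congr (_ * T _); apply/funext => y; rewrite scaleN1r addrC //.
    apply: (@smooth_bounded_test _ (X + `|x|)); first exact: smooth_affine tt.1.
    move=> y hy; apply: tX; rewrite scaleN1r -(ltrD2r `|x|); apply: lt_le_trans hy _.
    by have := ler_normB (- y + x) x; rewrite addrK normrN.
  rewrite JE (bint_distribution cal Y dT sF cC clC FC).
  have [cTr cTi] := distribution_family_continuous dT sF cC clC FC.
  have T0 s : Y < `|s| -> T (F s) = 0.
    by move=> hs; rewrite -(distribution0 dT); congr T; apply/funext => y; exact: Fs.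
  congr of_parts; apply: bint_integral => //.
    by move=> s hs /=; rewrite T0 ?re0.
  by move=> s hs /=; rewrite T0 ?im0.
- exists (X + Y); first by rewrite addr_ge0.
  move=> y hy; split; last by apply: pY; apply: le_lt_trans hy; rewrite lerDr.
  rewrite JF (_ : (fun s => _) = fun=> 0).
    by apply: scalar_eq; rewrite ?re_Kintegral ?im_Kintegral ?re0 ?im0 integral_space0.
  by apply/funext => s; apply: FC => /=; rewrite leNgt hy.
- apply/smoothE; split.
    by have := (bint_param cal X sG.1).1; rewrite -JR.
  by have := (bint_param cal X sG.2).1; rewrite -JI.
- move=> l; rewrite JR JI (bint_param cal X sG.1).2 (bint_param cal X sG.2).2.
  split; apply/funext => y; rewrite ?re_Kintegral ?im_Kintegral; apply/esym.
    rewrite -[RHS](bint_integral cal X0); last 2 first.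
    - exact: (cG l y).1.
    - by move=> s hs; rewrite (partial_mul_affine _ _ _ _ tp.1).1 tX // mul0r re0 mulr0.
    by congr I; apply/funext => s; rewrite (partial_mul_affine _ _ _ _ tp.1).1 expr1n mul1r.
  rewrite -[RHS](bint_integral cal X0); last 2 first.
  - exact: (cG l y).2.
  - by move=> s hs; rewrite (partial_mul_affine _ _ _ _ tp.1).2 tX // mul0r im0 mulr0.
  by congr I; apply/funext => s; rewrite (partial_mul_affine _ _ _ _ tp.1).2 expr1n mul1r.
Qed.

(** There are finitely many words of length at most [m]. The induction is on the first letter, and
    the constants obtained for the directions are added; monotonicity in the constant makes the sum
    serve for all. *)
Lemma bound_all_words (P : seq 'I_(sp_dim E) -> R -> Prop) m :
  (forall l C D, P l C -> C <= D -> P l D) -> (forall l, exists2 C, 0 <= C & P l C) ->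
  exists2 C, 0 <= C & forall l, (size l <= m)%N -> P l C.
Proof.
move=> mono; elim: m P mono => [|m IH] P mono HP.
  by have [C C0 HC] := HP [::]; exists C => // -[].
have [C C0 HC] := IH P mono HP.
have HD i : exists C, 0 <= C /\ forall l, (size l <= m)%N -> P (i :: l) C.
  have [D D0 HD] := IH (fun l => P (i :: l)) (fun l => mono (i :: l)) (fun l => HP (i :: l)).
  by exists D.
have [D HD'] := choice HD.
exists (C + \sum_i D i) => [|l].
  by rewrite addr_ge0 // sumr_ge0 // => i _; have [] := HD' i.
case: l => [_|i l lm].
  by apply: mono (HC [::] _) _ => //; rewrite lerDl sumr_ge0 // => i _; have [] := HD' i.
apply: mono ((HD' i).2 l lm) _; rewrite (bigD1 i) //= addrCA lerDl addr_ge0 //.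
by rewrite sumr_ge0 // => j _; have [] := HD' j.
Qed.

Variables phi chi : E -> K.
Hypothesis mphi : mollifier phi.
Hypothesis cchi : cutoff chi.

Definition kernel (e : R) (z : E) : K :=
  chi z * (of_real k (e ^- sp_dim E) * phi (e^-1 *: z)).

Lemma smooth_dilation (e : R) : smooth (fun z => phi (e^-1 *: z)).
Proof.
have [[sp _] _ _] := mphi; have := smooth_affine e^-1 0 sp.
by under eq_fun do rewrite addr0.
Qed.

Lemma kernel_test e : test (kernel e).
Proof.
have [X X0 cX] := test_bounded cchi.1.
apply: (@smooth_bounded_test _ X); last by move=> x /cX h; rewrite /kernel h mul0r.
exact: (smooth_mul cchi.1.1 (smooth_scale _ (smooth_dilation e))).
Qed.

Lemma cutoff_at0 : chi 0 = 1.
Proof. exact: (nbhs_singleton cchi.2). Qed.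

(** After the substitution [z = e z'] the function [h (e z')] has Lipschitz constant [L e] at 0.
    This is the whole source of the rate O(e). *)
Lemma schwartz_moment (b : E -> R) :
  (b = fun x => re (phi x)) \/ (b = fun x => im (phi x)) ->
  exists2 C : R, 0 <= C & forall (h : E -> R) (L e : R), 0 < e -> 0 <= L -> cc h ->
    (forall z, `|h z - h 0| <= L * `|z|) ->
    `|I (fun z => e ^- sp_dim E * b (e^-1 *: z) * h z) - h 0 * I b| <= C * (L * e).
Proof.
move=> hb; have [[sp dec] _ _] := mphi.
have cb : continuous b.
  by case: hb => ->; apply: rsmooth_continuous; [exact: smooth_re|exact: smooth_im].
have db alpha : exists c : R, forall x, `|monomial alpha x| * `|b x| <= c.
  have [c Hc] := dec alpha [::]; exists c => x; apply: le_trans (Hc x).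
  rewrite ler_wpM2l // /partial /= of_parts_re_im.
  by case: hb => ->; [exact: re_le_modulus|exact: im_le_modulus].
have [C C0 HC] := moment_bound cal cb db.
exists C => // h L e e0 L0 ch hL.
have che : continuous (fun z => h (e *: z)).
  by apply: (continuousT_comp ch.1); apply: continuousT_scale; [exact: continuousT_cst|exact: continuousT_id].
have cg : cc (fun z => b z * h (e *: z)).
  split; first exact: continuousT_mul.
  have [Y Y0 hY] := ch.2; exists (e^-1 * Y); first by rewrite mulr_ge0 // invr_ge0 ltW.
  move=> x; rewrite ltr_pdivrMl // => hx; rewrite hY ?mulr0 //.
  by rewrite normrZ gtr0_norm.
have := HC (fun z => h (e *: z)) (L * e) _ che.
rewrite scaler0 -(integral_scale cal e0 cg) mulr_ge0 ?(ltW e0) // => /(_ isT).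
rewrite (_ : (fun x => _) = fun z => e ^- sp_dim E * b (e^-1 *: z) * h z); last first.
  by apply/funext => x; rewrite scalerA divff ?gt_eqF // scale1r mulrA.
move=> HH; apply: HH => z; apply: le_trans (hL _) _.
by rewrite normrZ gtr0_norm // mulrA.
Qed.

(** By transposition the error is [T (J - psi)]. Each derivative of [J] at [y] is the integral of
    the rescaled [phi] against [H = chi * q (y + .)], with [q] the same derivative of [psi]. As
    [H 0 = q y] and [H] is Lipschitz uniformly in [y], the first moment estimate makes the
    difference O(e) uniformly. *)
Lemma regularization_converges (T : (E -> K) -> K) (psi : E -> K) :
  is_distribution T -> test psi ->
  exists2 C : R, 0 <= C & forall e : R, 0 < e ->
    modulus (Kintegral (fun x => regularization phi chi T e x * psi x) - T psi) <= C * e.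
Proof.
move=> dT tp.
have [Br Br0 HBr] := schwartz_moment (or_introl erefl).
have [Bi Bi0 HBi] := schwartz_moment (or_intror erefl).
have [[sp _] ip _] := mphi.
have Ire : I (fun x => re (phi x)) = 1 by rewrite -re_Kintegral ip re1.
have Iim : I (fun x => im (phi x)) = 0 by rewrite -im_Kintegral ip im1.
have [Lc Lc0 HLc] := test_lipschitz_bounded cchi.1.
have est l : exists2 C : R, 0 <= C & forall e y, 0 < e ->
   `|re (Kintegral (fun s => kernel e s * partial l psi (1 *: y + s))) - re (partial l psi y)| <= C * e /\
   `|im (Kintegral (fun s => kernel e s * partial l psi (1 *: y + s))) - im (partial l psi y)| <= C * e.
  have tq := test_partial l tp; set q := partial l psi in tq *.
  have [Lq Lq0 HLq] := test_lipschitz_bounded tq.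
  (* A product of two real functions with bound and Lipschitz constant [Lc] and [Lq] has Lipschitz
     constant [2 Lc Lq], and the real or imaginary part of a product of scalars contains two such
     products. *)
  pose L := 4 * (Lc * Lq); exists (Br * L + Bi * L).
    by rewrite addr_ge0 // mulr_ge0 // mulr_ge0 // mulr_ge0.
  move=> e y e0; pose H z := chi z * q (1 *: y + z).
  have sH : smooth H.
    apply: (smooth_mul cchi.1.1); have := smooth_affine 1 y tq.1.
    by under eq_fun do rewrite scale1r addrC -[X in X + _]scale1r.
  have tH : test H.
    have [X X0 cX] := test_bounded cchi.1.
    by apply: (@smooth_bounded_test _ X) => // x /cX h; rewrite /H h mul0r.
  have H0 : H 0 = q y by rewrite /H cutoff_at0 mul1r addr0 scale1r.
  have prodL (a b : E -> R) z : (forall x x', `|a x| <= Lc /\ `|a x - a x'| <= Lc * `|x - x'|) ->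
      (forall x x', `|b x| <= Lq /\ `|b x - b x'| <= Lq * `|x - x'|) ->
      `|a z * b (1 *: y + z) - a 0 * b (1 *: y + 0)| <= 2 * (Lc * Lq) * `|z|.
    move=> ha hb.
    have -> : a z * b (1 *: y + z) - a 0 * b (1 *: y + 0) =
       (a z - a 0) * b (1 *: y + z) + a 0 * (b (1 *: y + z) - b (1 *: y + 0)) by ring.
    rewrite (le_trans (ler_normD _ _)) // !normrM.
    have [_ a1] := ha z 0; have [a2 _] := ha 0 0.
    have [b2 _] := hb (1 *: y + z) 0; have [_ b1] := hb (1 *: y + z) (1 *: y + 0).
    rewrite subr0 in a1.
    have Ez : 1 *: y + z - (1 *: y + 0) = z by rewrite addr0 addrAC subrr add0r.
    rewrite Ez in b1.
    have -> : 2 * (Lc * Lq) * `|z| = Lc * `|z| * Lq + Lc * (Lq * `|z|) by ring.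
    by rewrite lerD // ler_pM.
  have har x x' : `|re (chi x)| <= Lc /\ `|re (chi x) - re (chi x')| <= Lc * `|x - x'| by case: (HLc x x').
  have hai x x' : `|im (chi x)| <= Lc /\ `|im (chi x) - im (chi x')| <= Lc * `|x - x'| by case: (HLc x x').
  have hbr x x' : `|re (q x)| <= Lq /\ `|re (q x) - re (q x')| <= Lq * `|x - x'| by case: (HLq x x').
  have hbi x x' : `|im (q x)| <= Lq /\ `|im (q x) - im (q x')| <= Lq * `|x - x'| by case: (HLq x x').
  have L0 : 0 <= L by rewrite mulr_ge0 // mulr_ge0.
  have HrL z : `|re (H z) - re (H 0)| <= L * `|z|.
    rewrite /H !reM.
    have := prodL _ _ z har hbr; have := prodL _ _ z hai hbi => /= h1 h2.
    rewrite (_ : _ - _ = (re (chi z) * re (q (1 *: y + z)) - re (chi 0) * re (q (1 *: y + 0))) -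
       (im (chi z) * im (q (1 *: y + z)) - im (chi 0) * im (q (1 *: y + 0)))); last by ring.
    by rewrite (le_trans (ler_normB _ _)) // /L; lra.
  have HiL z : `|im (H z) - im (H 0)| <= L * `|z|.
    rewrite /H !imM.
    have := prodL _ _ z har hbi; have := prodL _ _ z hai hbr => /= h1 h2.
    rewrite (_ : _ - _ = (re (chi z) * im (q (1 *: y + z)) - re (chi 0) * im (q (1 *: y + 0))) +
       (im (chi z) * re (q (1 *: y + z)) - im (chi 0) * re (q (1 *: y + 0)))); last by ring.
    by rewrite (le_trans (ler_normD _ _)) // /L; lra.
  have [cHr cHi] := (test_cc_re tH, test_cc_im tH).
  have m1 := HBr _ _ e e0 L0 cHr HrL; have m2 := HBi _ _ e e0 L0 cHi HiL.
  have m3 := HBr _ _ e e0 L0 cHi HiL; have m4 := HBi _ _ e e0 L0 cHr HrL.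
  rewrite Ire mulr1 H0 in m1; rewrite Iim mulr0 subr0 in m2.
  rewrite Ire mulr1 H0 in m3; rewrite Iim mulr0 subr0 in m4.
  have sd := smooth_dilation e.
  have cb1 (h : E -> R) : cc h -> cc (fun z => e ^- sp_dim E * re (phi (e^-1 *: z)) * h z).
    move=> ch; under eq_fun do rewrite mulrC; apply: cc_mull => //.
    by apply: continuousT_mul; [exact: continuousT_cst|exact: rsmooth_continuous (smooth_re sd)].
  have cb2 (h : E -> R) : cc h -> cc (fun z => e ^- sp_dim E * im (phi (e^-1 *: z)) * h z).
    move=> ch; under eq_fun do rewrite mulrC; apply: cc_mull => //.
    by apply: continuousT_mul; [exact: continuousT_cst|exact: rsmooth_continuous (smooth_im sd)].
  have kE s : kernel e s * q (1 *: y + s) = of_real k (e ^- sp_dim E) * phi (e^-1 *: s) * H s.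
    by rewrite /kernel /H; ring.
  split.
    rewrite re_Kintegral (_ : (fun s => _) = fun s => e ^- sp_dim E * re (phi (e^-1 *: s)) * re (H s) -
        e ^- sp_dim E * im (phi (e^-1 *: s)) * im (H s)); last first.
      by apply/funext => s; rewrite kE reM re_real_mul im_real_mul.
    rewrite integral_sub //; [|exact: cb1|exact: cb2].
    rewrite addrAC (le_trans (ler_normB _ _)) // mulrDl lerD //.
      by rewrite -mulrA.
    by rewrite -mulrA.
  rewrite im_Kintegral (_ : (fun s => _) = fun s => e ^- sp_dim E * re (phi (e^-1 *: s)) * im (H s) +
      e ^- sp_dim E * im (phi (e^-1 *: s)) * re (H s)); last first.
    by apply/funext => s; rewrite kE imM re_real_mul im_real_mul.
  rewrite (integral_add cal) //; [|exact: cb1|exact: cb2].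
  rewrite addrAC (le_trans (ler_normD _ _)) // mulrDl lerD //.
    by rewrite -mulrA.
  by rewrite -mulrA.
have [X X0 cX] := test_bounded cchi.1; have [Y Y0 pY] := test_bounded tp.
(* This ball contains the supports of [psi] and of [J] for every [e], so that one seminorm estimate
   of [T] serves for all [e]. *)
have cC := @ball_compact R E cal (X + Y).
have [c [m [c0 Hc]]] := distribution_bound dT cC.
have [C C0 HC] := @bound_all_words (fun l C => forall e y, 0 < e ->
   `|re (Kintegral (fun s => kernel e s * partial l psi (1 *: y + s))) - re (partial l psi y)| <= C * e /\
   `|im (Kintegral (fun s => kernel e s * partial l psi (1 *: y + s))) - im (partial l psi y)| <= C * e) m
   (fun l C D hC CD e y e0 => conj (le_trans (hC e y e0).1 (ler_wpM2r (ltW e0) CD))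
       (le_trans (hC e y e0).2 (ler_wpM2r (ltW e0) CD))) est.
exists (c * C); first by rewrite mulr_ge0.
move=> e e0; have [-> [Z Z0 JZ] sJ HJ] := distribution_convolution dT (kernel_test e) tp.
set J := (fun y => Kintegral _) in JZ sJ HJ *.
have tJ : test J by apply: (@smooth_bounded_test _ Z) => // x /JZ[].
rewrite -distribution_sub // -mulrA; apply: Hc.
- exact: smooth_sub sJ tp.1.
- move=> y hy; rewrite pY; last first.
    by apply: (@le_lt_trans _ _ (X + Y)); [rewrite lerDr|rewrite ltNge; apply/negP].
  rewrite subr0 /J (_ : (fun s => _) = fun=> 0).
    by apply: scalar_eq; rewrite ?re_Kintegral ?im_Kintegral ?re0 ?im0 integral_space0.
  apply/funext => s; have [hs|hs] := ltP X `|s|; first by rewrite /kernel cX // !mul0r.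
  rewrite pY ?mulr0 // ltNge; apply/negP => h; apply: hy => /=.
  rewrite scale1r in h; rewrite -[y](addrK s) (le_trans (ler_normB _ _)) // addrC lerD //.
- move=> l y lm; have [h1 h2] := HC l lm e y e0.
  under eq_fun do rewrite reB; under [X in _ /\ `|rpartial l X _| <= _]eq_fun do rewrite imB.
  rewrite !rpartial_sub; [|exact: smooth_im sJ|exact: smooth_im tp.1|exact: smooth_re sJ|exact: smooth_re tp.1].
  rewrite (HJ l).1 (HJ l).2.
  by move: h1 h2; rewrite re_partial im_partial.
Qed.

(** As [x] varies over the whole space the test functions have no common compact support. Near [x0]
    the family is multiplied by the cutoff [rho] centred at [x0], which changes nothing close to
    [x0] and confines the supports. *)
Lemma regularization_continuous (T : (E -> K) -> K) (e : R) : is_distribution T ->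
  continuous (fun x => re (regularization phi chi T e x)) /\
  continuous (fun x => im (regularization phi chi T e x)).
Proof.
move=> dT; have tk := kernel_test e; have [X X0 kX] := test_bounded tk.
have [Y Y0 cY] := test_bounded cchi.1.
suff key (x0 : E) : exists2 S : E -> K, continuous (fun x => re (S x)) /\ continuous (fun x => im (S x)) &
   \forall x \near x0, regularization phi chi T e x = S x.
  split=> x0; have [S [cr ci] H] := key x0.
    apply: (cvg_trans _ (_ : re (S x) @[x --> x0] --> _)); last first.
      by rewrite /= (nbhs_singleton H); exact: cr.
    by apply: near_eq_cvg; apply: filterS H => x /= ->.
  apply: (cvg_trans _ (_ : im (S x) @[x --> x0] --> _)); last first.
    by rewrite /= (nbhs_singleton H); exact: ci.
  by apply: near_eq_cvg; apply: filterS H => x /= ->.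
pose rho s := chi (1 *: s + - x0).
have srho : smooth rho by exact: smooth_affine cchi.1.1.
have sF := smooth_family_mul_affine (-1) (rsmooth_continuous (smooth_re srho)) (rsmooth_continuous (smooth_im srho)) tk.1.
have FC s : supported_in [set x : E | `|x| <= X + Y + `|x0|] (fun y => rho s * kernel e (-1 *: y + s)).
  move=> y hy; rewrite /rho scale1r; have [h|h] := ltP Y `|s - x0|; first by rewrite cY // mul0r.
  rewrite kX ?mulr0 // ltNge; apply/negP => h2; apply: hy => /=.
  have Ey : y = (y - s) + ((s - x0) + x0) by rewrite !subrK.
  have := ler_normD (y - s) (s - x0 + x0); have := ler_normD (s - x0) x0.
  rewrite -Ey => n1 n2; have n3 : `|y - s| <= X by move: h2; rewrite scaleN1r addrC distrC.
  have := lerD n3 (le_trans n1 (lerD h (lexx _))); rewrite addrA; exact: le_trans n2.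
have cC := @ball_compact R E cal (X + Y + `|x0|); have clC := @ball_closed (X + Y + `|x0|).
exists (fun s => T (fun y => rho s * kernel e (-1 *: y + s))).
  by have := distribution_family_continuous dT sF cC clC FC.
have [d d0 Hd] := proj1 (nbhs_normE _ _) cchi.2.
apply/nbhs_normE; exists d => // x hx.
have -> : rho x = 1 by apply: Hd; rewrite scale1r subr0.
congr T; apply/funext => y; rewrite mul1r /kernel.
by rewrite scaleN1r [- y + x]addrC.
Qed.

End Regularization.

(** * Regularizations away from the support *)

Section OffSupport.
Context {R : realType} {k : scalar_kind}.
Local Notation K := (scalar_field R k).
Local Notation L := (line R).
Local Notation cal := (@line_calculus R).
Variables phi chi : L -> K.
Hypothesis mphi : mollifier phi.
Hypothesis cchi : cutoff chi.

Lemma bounded_partials (g : L -> R) (X : R) m : rsmooth g -> (forall z, X < `|z| -> g z = 0) ->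
  exists2 A : R, 0 <= A & forall l, (size l <= m)%N -> forall z, `|rpartial l g z| <= A.
Proof.
move=> sg gX.
apply: (@bound_all_words R (line R) (fun l A => forall z, `|rpartial l g z| <= A)).
  by move=> l C D H CD z; exact: le_trans (H z) CD.
move=> l; apply: (continuous_bounded_supp (rsmooth_continuous (rsmooth_rpartial l sg)) (@ball_compact R L cal X)).
move=> z; apply: (rpartial_supp l (@ball_closed R L cal X)) => y hy.
by apply: gX; rewrite ltNge; apply/negP.
Qed.

(* The rescaled Schwartz function is rapidly small where [g] does not vanish. *)
Lemma rescaled_decay (g b : L -> R) (d X : R) l : rsmooth g -> 0 < d ->
  (forall z, `|z| < d -> g z = 0) -> (forall z, X < `|z| -> g z = 0) ->
  (b = fun x => re (phi x)) \/ (b = fun x => im (phi x)) ->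
  exists2 C : R, 0 <= C & forall e z : R, 0 < e ->
    `|rpartial l (fun z : L => g z * (e^-1 * b (e^-1 *: z))) z| <= C * e.
Proof.
move=> sg d0 gd gX hb; have [[sp dec] _ _] := mphi.
have sb : rsmooth b by case: hb => ->; [exact: smooth_re sp|exact: smooth_im sp].
have [A A0 HA] := bounded_partials (size l) sg gX.
(* A derivative of order n of [e^-1 b (e^-1 z)] costs [e^-(n+1)]. Decay of order n + 2 gives back
   [e^(n+2)] where [|z|] is bounded below, so that one power of [e] is left. *)
have [B B0 HB] := @bound_all_words R L (fun l' B => forall z : R, `|z| ^+ (size l').+2 * `|rpartial l' b z| <= B)
   (size l) (fun l' C D H CD z => le_trans (H z) CD) (fun l' => ltac:(
     have [c Hc] := dec (fun=> (size l').+2) l';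
     exists `|c| => // z; apply: le_trans (le_trans (Hc z) (ler_norm c));
     rewrite /monomial big_ord1 /= normrX; rewrite ler_wpM2l ?exprn_ge0 //;
     case: hb => ->; rewrite -?re_partial -?im_partial; [exact: re_le_modulus|exact: im_le_modulus])).
(* Raising [1 + d^-1] to the largest exponent dominates [d^-(n+2)] for all orders n up to [size l]
   at once, whether [d] is below or above 1. *)
pose Bd := B * (1 + d^-1) ^+ (size l).+2.
have Bd0 : 0 <= Bd by rewrite mulr_ge0 // exprn_ge0 // addr_ge0 // invr_ge0 ltW.
exists (2 ^+ size l * (A * Bd)); first by rewrite mulr_ge0 ?exprn_ge0 // mulr_ge0.
move=> e z e0.
have sbe : rsmooth (fun z : L => e^-1 * b (e^-1 *: z)).
  apply: rsmooth_scale; have := rsmooth_affine e^-1 0 sb.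
  by under eq_fun do rewrite addr0.
have [zd|dz] := ltP `|z| d.
  rewrite (@rpartial_near R L l _ (fun=> 0) [set y : L | `|y| < d]) //.
  - by rewrite rpartial0 normr0; apply: mulr_ge0; [apply: mulr_ge0; [exact: exprn_ge0|exact: mulr_ge0]|exact: ltW].
  - rewrite (_ : [set _ | _] = `]- d, d[%classic); first exact: interval_open.
    by apply/seteqP; split => y /=; rewrite in_itv /= ltr_norml.
  - by move=> y yd; rewrite gd // mul0r.
have z0 : 0 < `|z| by exact: lt_le_trans dz.
have -> : 2 ^+ size l * (A * Bd) * e = 2 ^+ size l * (A * (Bd * e)) by rewrite !mulrA.
apply: rpartial_mul_le => //; first by rewrite mulr_ge0 // ltW.
  by move=> l' hl; exact: HA.
move=> l' hl.
have sbe' : rsmooth (fun z : L => b (e^-1 *: z + 0)) by exact: rsmooth_affine.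
rewrite (_ : (fun y => _) = (fun y => e^-1 * b (e^-1 *: y + 0))); last by apply/funext => y; rewrite addr0.
rewrite rpartial_scale // (rpartial_affine l' e^-1 0 sb) addr0.
have := HB l' hl (e^-1 *: z); set w := `|rpartial l' b _|.
rewrite normrZ [`|e^-1|]ger0_norm ?invr_ge0 ?(ltW e0) // !normrM normrX.
rewrite [`|e^-1|]ger0_norm ?invr_ge0 ?(ltW e0) // -/w exprMn => H.
set n := size l' in hl H *.
have en0 : 0 < e^-1 ^+ n.+2 by rewrite exprn_gt0 // invr_gt0.
have H2 : e^-1 ^+ n.+2 * w <= B / `|z| ^+ n.+2.
  by rewrite ler_pdivlMr ?exprn_gt0 // mulrAC.
have -> : e^-1 * (e^-1 ^+ n * w) = e^-1 ^+ n.+2 * w * e.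
  rewrite 2!exprS; field; rewrite ?gt_eqF //.
rewrite ler_wpM2r ?(ltW e0) //; apply: le_trans H2 _.
rewrite /Bd ler_wpM2l // -exprVn.
apply: (@le_trans _ _ ((1 + d^-1) ^+ n.+2)).
  rewrite lerXn2r ?nnegrE ?invr_ge0 ?addr_ge0 ?invr_ge0 ?(ltW d0) //.
  by rewrite (@le_trans _ _ d^-1) ?lerDr // lef_pV2.
by rewrite ler_weXn2l ?lerDl ?invr_ge0 ?(ltW d0).
Qed.

(** The kernel is split by a cutoff [eta] that is one near 0. For [x] near [x0] the inner part tests
    [T] inside an open set where it vanishes; the outer part lives away from 0, where the rescaled
    Schwartz function and all its derivatives are O(e). *)
Lemma regularization_off_support (T : (L -> K) -> K) (x0 : L) :
  is_distribution T -> ~ dsupport T x0 ->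
  exists2 r : R, 0 < r & exists2 C : R, 0 <= C & forall e x : R, 0 < e -> `|x - x0| < r ->
    modulus (regularization phi chi T e x) <= C * e.
Proof.
move=> dT nx0.
have [U [oU Ux0 HU]] : exists U : set L, [/\ open U, U x0 & forall psi, test_in U psi -> T psi = 0].
  apply: contrapT => H; apply: nx0 => U oU Ux; apply: contrapT => H2; apply: H; exists U; split => // psi tp.
  by apply: contrapT => /eqP Tp; apply: H2; exists psi.
have [r2 r20 Hr2] := proj1 (nbhs_normE _ _) (open_nbhs_nbhs (conj oU Ux0)).
(* With [|x - x0| < r] and [|y - x| <= r] the point [y] stays within [2 r < r2] of [x0], inside the
   set where [T] vanishes. *)
pose r := r2 / 3; have r0 : 0 < r by rewrite divr_gt0.
have [X X0 cX] := test_bounded cchi.1.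
(* Contracting [chi] by [lam] produces a cutoff supported in the ball of radius [r]; [X + 1] in
   place of [X] makes it vanish on the sphere as well. *)
pose lam := (X + 1) / r; have lam0 : 0 < lam by rewrite divr_gt0 // ltr_pwDr.
pose eta (z : L) := chi (lam *: z).
have seta : smooth eta.
  by have := smooth_affine lam 0 cchi.1.1; under eq_fun do rewrite addr0.
have etar z : r <= `|z| -> eta z = 0.
  move=> hz; apply: cX; rewrite normrZ gtr0_norm //.
  apply: (@lt_le_trans _ _ (lam * r)); first by rewrite /lam divfK ?gt_eqF // ltrDl.
  by rewrite ler_wpM2l // ltW.
have [d1 d10 Hd1] := proj1 (nbhs_normE _ _) cchi.2.
pose d := d1 / lam; have d0 : 0 < d by rewrite divr_gt0.
have eta1 z : `|z| < d -> eta z = 1.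
  by move=> hz; apply: Hd1; rewrite subr0 normrZ gtr0_norm // mulrC -ltr_pdivlMr.
pose g (z : L) := (1 - eta z) * chi z.
have sg : smooth g by apply: smooth_mul cchi.1.1; apply: smooth_sub seta; exact: smooth_cst.
have gd z : `|z| < d -> g z = 0 by move=> /eta1; rewrite /g => ->; rewrite subrr mul0r.
have gX z : X < `|z| -> g z = 0 by move=> /cX; rewrite /g => ->; rewrite mulr0.
pose zeta e (z : L) := g z * (of_real k (e ^- 1) * phi (e^-1 *: z)).
have szeta e : smooth (zeta e) by exact: (smooth_mul sg (smooth_scale _ (smooth_dilation mphi e))).
have est l : exists2 C : R, 0 <= C & forall (e : R) (z : L), 0 < e ->
    `|rpartial l (fun z => re (zeta e z)) z| <= C * e /\ `|rpartial l (fun z => im (zeta e z)) z| <= C * e.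
  have sgr := smooth_re sg; have sgi := smooth_im sg.
  have gdr z : `|z| < d -> re (g z) = 0 by move=> /gd ->; rewrite re0.
  have gdi z : `|z| < d -> im (g z) = 0 by move=> /gd ->; rewrite im0.
  have gXr z : X < `|z| -> re (g z) = 0 by move=> /gX ->; rewrite re0.
  have gXi z : X < `|z| -> im (g z) = 0 by move=> /gX ->; rewrite im0.
  have [C1 C10 H1] := rescaled_decay l sgr d0 gdr gXr (or_introl erefl).
  have [C2 C20 H2] := rescaled_decay l sgi d0 gdi gXi (or_intror erefl).
  have [C3 C30 H3] := rescaled_decay l sgr d0 gdr gXr (or_intror erefl).
  have [C4 C40 H4] := rescaled_decay l sgi d0 gdi gXi (or_introl erefl).
  exists (C1 + C2 + C3 + C4); first by rewrite !addr_ge0.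
  move=> e z e0.
  have sd := smooth_dilation mphi e; have sdr := rsmooth_scale e^-1 (smooth_re sd); have sdi := rsmooth_scale e^-1 (smooth_im sd).
  have hr : (fun z => re (zeta e z)) = (fun z => re (g z) * (e^-1 * re (phi (e^-1 *: z))) - im (g z) * (e^-1 * im (phi (e^-1 *: z)))).
    by apply/funext => y; rewrite /zeta reM re_real_mul im_real_mul expr1.
  have hi : (fun z => im (zeta e z)) = (fun z => re (g z) * (e^-1 * im (phi (e^-1 *: z))) + im (g z) * (e^-1 * re (phi (e^-1 *: z)))).
    by apply/funext => y; rewrite /zeta imM re_real_mul im_real_mul expr1.
  rewrite hr hi rpartial_sub ?rpartial_add; try exact: rsmooth_mul.
  have := H1 e z e0; have := H2 e z e0; have := H3 e z e0; have := H4 e z e0 => h4 h3 h2 h1.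
  have e1 := ltW e0.
  have p1 : 0 <= C1 * e by rewrite mulr_ge0. have p2 : 0 <= C2 * e by rewrite mulr_ge0.
  have p3 : 0 <= C3 * e by rewrite mulr_ge0. have p4 : 0 <= C4 * e by rewrite mulr_ge0.
  split; first by apply: (le_trans (ler_normB _ _)); lra.
  by apply: (le_trans (ler_normD _ _)); lra.
have cC := @ball_compact R L cal (`|x0| + r + X).
have [c [m [c0 Hc]]] := distribution_bound dT cC.
have [C C0 HC] := @bound_all_words R L (fun l C => forall (e : R) (z : L), 0 < e ->
    `|rpartial l (fun z => re (zeta e z)) z| <= C * e /\ `|rpartial l (fun z => im (zeta e z)) z| <= C * e) m
   (fun l C D hC CD e y e0 => conj (le_trans (hC e y e0).1 (ler_wpM2r (ltW e0) CD))
       (le_trans (hC e y e0).2 (ler_wpM2r (ltW e0) CD))) est.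
exists r => //; exists (c * C); first by rewrite mulr_ge0.
move=> e x e0 hx.
have st := (kernel_test cal mphi cchi e).1.
have s1 : smooth (fun y : L => eta (-1 *: y + x) * kernel phi chi e (-1 *: y + x)).
  exact: smooth_mul (@smooth_affine R k L (-1) x eta seta) (@smooth_affine R k L (-1) x _ st).
have s2 : smooth (fun y : L => zeta e (-1 *: y + x)) := @smooth_affine R k L (-1) x (zeta e) (szeta e).
have z1 : T (fun y : L => eta (-1 *: y + x) * kernel phi chi e (-1 *: y + x)) = 0.
  apply: HU; split => //; exists [set y : L | `|x - y| <= r]; split.
  - rewrite (_ : [set _ | _] = `[x - r, x + r]%classic); first exact: segment_compact.
    by apply/seteqP; split => y /=; rewrite in_itv /= distrC ler_distl.
  - move=> y /= hy; apply: Hr2; rewrite -[y](subrK x) -addrA.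
    apply: le_lt_trans (ler_normD _ _) _; rewrite distrC.
    apply: (@lt_trans _ _ (r + r)); first exact: ler_ltD.
    by rewrite /r; lra.
  - move=> y hy; rewrite etar ?mul0r //; rewrite scaleN1r addrC ltW // ltNge; exact/negP.
have bx (y : L) : ~ [set z : L | `|z| <= `|x0| + r + X] y -> X < `|-1 *: y + x|.
  move=> hy; rewrite ltNge; apply/negP => h; apply: hy => /=; rewrite scaleN1r addrC distrC in h.
  have n1 := ler_normD (y - x) x; rewrite subrK in n1.
  have n2 := ler_normD (x - x0) x0; rewrite subrK in n2.
  have := ltW hx; lra.
have supp1 : supported_in [set z : L | `|z| <= `|x0| + r + X] (fun y : L => eta (-1 *: y + x) * kernel phi chi e (-1 *: y + x)).
  by move=> y /bx /cX h; rewrite /kernel h mul0r mulr0.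
have supp2 : supported_in [set z : L | `|z| <= `|x0| + r + X] (fun y : L => zeta e (-1 *: y + x)).
  by move=> y /bx /gX h; rewrite /zeta h mul0r.
have -> : regularization phi chi T e x = T (fun y : L => zeta e (-1 *: y + x)).
  rewrite -[RHS]add0r -z1 -(distribution_add dT).
  - congr T; apply/funext => y; rewrite /zeta /g /kernel -[sp_dim L]/1%N.
    by rewrite scaleN1r [- y + x]addrC; ring.
  - exact: test_supported s1 cC supp1.
  - exact: test_supported s2 cC supp2.
rewrite -mulrA; apply: Hc => // l y lm.
have szr := smooth_re (szeta e); have szi := smooth_im (szeta e).
rewrite (rpartial_affine l (-1) (x : L) szr) (rpartial_affine l (-1) (x : L) szi).
by rewrite !normrM !normrX normrN1 expr1n !mul1r; exact: HC.
Qed.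

End OffSupport.

(** * D'Alembert's formula *)

Section DAlembert.
Context {R : realType}.

Lemma is_derive_fst (F : R * R -> R) (r s d : R) :
  is_derive r 1 (fun r => F (r, s)) d <-> is_derive (r, s) ((1, 0) : R * R) F d.
Proof.
have E u : u *: ((1, 0) : R * R) + (0, s) = (u, s).
  by rewrite [LHS]surjective_pairing /= [u *: 0]mulr0 [u *: 1]mulr1 addr0 add0r.
have Ef : (fun u : R => F (u *: ((1, 0) : R * R) + (0, s))) = (fun r => F (r, s)).
  by apply/funext => u; rewrite E.
have := is_derive_lineE F ((0, s) : R * R) ((1, 0) : R * R) r d.
by rewrite E Ef => ->.
Qed.

Lemma is_derive_snd (F : R * R -> R) (r s d : R) :
  is_derive s 1 (fun s => F (r, s)) d <-> is_derive (r, s) ((0, 1) : R * R) F d.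
Proof.
have E u : u *: ((0, 1) : R * R) + (r, 0) = (r, u).
  by rewrite [LHS]surjective_pairing /= [u *: 0]mulr0 [u *: 1]mulr1 addr0 add0r.
have Ef : (fun u : R => F (u *: ((0, 1) : R * R) + (r, 0))) = (fun s => F (r, s)).
  by apply/funext => u; rewrite E.
have := is_derive_lineE F ((r, 0) : R * R) ((0, 1) : R * R) s d.
by rewrite E Ef => ->.
Qed.

(* After the substitution [y = r z], the endpoints no longer depend on [r]. *)
Lemma continuous_ri_endpoint (X : topologicalType) (g : R -> X -> R) :
  continuous (fun p : R * X => g p.1 p.2) ->
  continuous (fun p : R * X => ri 0 p.1 (g ^~ p.2)).
Proof.
move=> cg.
have -> : (fun p : R * X => ri 0 p.1 (g ^~ p.2)) =
    fun p => p.1 * ri 0 1 (fun z => g (p.1 * z) p.2).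
  apply/funext => p; have := @ri_affine R (g ^~ p.2) 0 1 p.1 0 (continuous_uncurry_fst cg).
  by rewrite mulr0 mulr1 !addr0 => <-; congr (_ * ri _ _ _); apply/funext => z; rewrite addr0.
apply: continuousT_mul; first by cont.
apply: (@continuous_param_ri R _ (fun z (p : R * X) => g (p.1 * z) p.2)).
by apply: (continuousT_comp cg (f := fun q : R * (R * X) => (q.2.1 * q.1, q.2.2))); cont.
Qed.

Lemma ri_split0 (g : R -> R) a b : continuous g -> ri a b g = ri 0 b g - ri 0 a g.
Proof. by move=> cg; rewrite (ri_chasles 0 a b cg) addrAC subrr add0r. Qed.

Lemma continuous_ri_endpoints (X : topologicalType) (g : R -> X -> R) (l r : X -> R) :
  continuous (fun p : R * X => g p.1 p.2) -> continuous l -> continuous r ->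
  continuous (fun x => ri (l x) (r x) (g ^~ x)).
Proof.
move=> cg cl cr.
have -> : (fun x => ri (l x) (r x) (g ^~ x)) = fun x => ri 0 (r x) (g ^~ x) - ri 0 (l x) (g ^~ x).
  by apply/funext => x; rewrite ri_split0 //; exact: continuous_uncurry_fst.
have c1 (f : X -> R) : continuous f -> continuous (fun x => ri 0 (f x) (g ^~ x)).
  move=> cf; apply: (continuousT_comp (continuous_ri_endpoint cg) (f := fun x => (f x, x))).
  by apply: continuousT_pair; [|exact: continuousT_id].
by apply: continuousT_add; [exact: c1|apply: continuousT_opp; exact: c1].
Qed.

Local Notation Dx g := ('D_(sp_axis (dir_x R)) g).
Local Notation Dt g := ('D_(sp_axis (dir_t R)) g).

Lemma rsmooth_derive_x (g : plane R -> R) (x t : R) : rsmooth g ->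
  is_derive x 1 (fun x => g (x, t)) (Dx g (x, t)).
Proof. by move=> sg; apply/is_derive_fst; exact: (@rsmooth_is_derive R (plane R) g (x, t) (dir_x R) sg). Qed.

Lemma rsmooth_derive_t (g : plane R -> R) (x t : R) : rsmooth g ->
  is_derive t 1 (fun t => g (x, t)) (Dt g (x, t)).
Proof. by move=> sg; apply/is_derive_snd; exact: (@rsmooth_is_derive R (plane R) g (x, t) (dir_t R) sg). Qed.

Lemma continuous_section_x (g : R * R -> R) t : continuous g -> continuous (fun x => g (x, t)).
Proof. by move=> cg; apply: (continuousT_comp cg); cont. Qed.

Lemma is_derive_alternating (f1 f2 f3 f4 : R -> R) (s d1 d2 d3 d4 : R) :
  is_derive s 1 f1 d1 -> is_derive s 1 f2 d2 -> is_derive s 1 f3 d3 -> is_derive s 1 f4 d4 ->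
  is_derive s 1 (fun s => f1 s + f2 s + (f3 s - f4 s)) (d1 + d2 + (d3 - d4)).
Proof. by move=> h1 h2 h3 h4; exact: is_deriveD (is_deriveD h1 h2) (is_deriveB h3 h4). Qed.

(** Fix the vertex [(x, t)] and let [F s] be the sum of [U] at the two ends of the horizontal
    section of the triangle at height [s], plus the integral of [U_t] over that section. Along the
    characteristics the boundary terms cancel, and [F'] is the integral of [U_tt - U_xx] over the
    section. Integrating from 0 to [t] gives the formula for either sign of [t], since
    [F t = 2 U (x, t)]. *)
Lemma dalembert_formula (U : plane R -> R) (x t : R) : rsmooth U ->
  U (x, t) = 2^-1 * (U (x - t, 0) + U (x + t, 0)) +
    2^-1 * ri (x - t) (x + t) (fun y => Dt U (y, 0)) +
    2^-1 * ri 0 t (fun s => ri (x - t + s) (x + t - s) (fun y => Dt (Dt U) (y, s) - Dx (Dx U) (y, s))).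
Proof.
move=> sU.
have sUt := rsmooth_D (dir_t R) sU; have sUx := rsmooth_D (dir_x R) sU.
have sUtt := rsmooth_D (dir_t R) sUt; have sUxx := rsmooth_D (dir_x R) sUx.
have [cUt cUtt cUx cUxx] := And4 (rsmooth_continuous sUt) (rsmooth_continuous sUtt) (rsmooth_continuous sUx) (rsmooth_continuous sUxx).
(* The integral over a section with two moving ends is a difference of values of [Phi], so that the
   chain rule along straight lines applies to all four terms of [F]. *)
pose Phi (z : R * R) := ri 0 z.1 (fun y => Dt U (y, z.2)).
pose Phis (z : R * R) := ri 0 z.1 (fun y => Dt (Dt U) (y, z.2)).
have dPr z : is_derive z ((1, 0) : R * R) Phi (Dt U z).
  case: z => r s; apply/is_derive_fst.
  have := @ri_derive R (fun y => Dt U (y, s)) 0 r (continuous_section_x (t := s) cUt); exact.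
have dPs z : is_derive z ((0, 1) : R * R) Phi (Phis z).
  case: z => r s; apply/is_derive_snd.
  apply: (@is_derive_param_ri R R (fun y s => Dt U (y, s)) (fun y s => Dt (Dt U) (y, s)) 0 r s 1).
  - by move=> y s'; exact: rsmooth_derive_t.
  - by move=> s'; exact: (continuous_section_x cUt).
  - by apply: (continuousT_comp cUtt (f := fun p : R * R => (p.1, p.2))); cont.
have cPs : continuous Phis.
  apply: (@continuous_ri_endpoint R (fun y s => Dt (Dt U) (y, s))).
  by apply: (continuousT_comp cUtt (f := fun p : R * R => (p.1, p.2))); cont.
pose l (s : R) : R := x - t + 1 * s; pose r (s : R) : R := x + t + (-1) * s.
pose F s := U (l s, 0 + 1 * s) + U (r s, 0 + 1 * s) + (Phi (r s, 0 + 1 * s) - Phi (l s, 0 + 1 * s)).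
pose G s := ri (l s) (r s) (fun y => Dt (Dt U) (y, s) - Dx (Dx U) (y, s)).
have dF (s : R) : is_derive s 1 F (G s).
  have h1 := rsmooth_plane_line (x - t) 0 1 1 s sU.
  have h2 := rsmooth_plane_line (x + t) 0 (-1) 1 s sU.
  have h3 := is_derive_along_line (x + t) 0 (-1) 1 s dPr dPs cUt cPs.
  have h4 := is_derive_along_line (x - t) 0 1 1 s dPr dPs cUt cPs.
  have ds : is_derive s 1 F (1 * Dx U (l s, 0 + 1 * s) + 1 * Dt U (l s, 0 + 1 * s) +
      (-1 * Dx U (r s, 0 + 1 * s) + 1 * Dt U (r s, 0 + 1 * s)) +
      ((-1 * Dt U (r s, 0 + 1 * s) + 1 * Phis (r s, 0 + 1 * s)) -
       (1 * Dt U (l s, 0 + 1 * s) + 1 * Phis (l s, 0 + 1 * s)))).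
    exact: (is_derive_alternating h1 h2 h3 h4).
  have GE : G s = Phis (r s, s) - Phis (l s, s) - (Dx U (r s, s) - Dx U (l s, s)).
    rewrite /G (riB _ _ (continuous_section_x (t := s) cUtt) (continuous_section_x (t := s) cUxx)).
    congr (_ - _); first exact: (ri_split0 _ _ (continuous_section_x (t := s) cUtt)).
    have dxx (y : R) : is_derive y 1 (fun y => Dx U (y, s)) (Dx (Dx U) (y, s)) by exact: rsmooth_derive_x.
    exact: (ri_FTC _ _ (continuous_section_x (t := s) cUxx) dxx).
  have alg (a b c d e f : R) : 1 * a + 1 * b + (-1 * c + 1 * d) + (-1 * d + 1 * e - (1 * b + 1 * f)) =
    e - f - (c - a) by ring.
  by move: ds; rewrite alg GE [0 + _]add0r [1 * s]mul1r.
have cG : continuous G.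
  apply: (@continuous_ri_endpoints R (fun y s => Dt (Dt U) (y, s) - Dx (Dx U) (y, s))).
  - by apply: continuousT_add; [|apply: continuousT_opp];
      [apply: (continuousT_comp cUtt (f := fun p : R * R => (p.1, p.2)))|
       apply: (continuousT_comp cUxx (f := fun p : R * R => (p.1, p.2)))]; cont.
  - by rewrite /l; cont.
  - by rewrite /r; cont.
have := ri_FTC 0 t cG dF.
have -> : F t = U (x, t) + U (x, t).
  have lt : l t = x by rewrite /l mul1r subrK.
  have rt : r t = x by rewrite /r mulN1r addrK.
  by rewrite /F lt rt subrr addr0 add0r mul1r.
have -> : F 0 = U (x - t, 0) + U (x + t, 0) + ri (x - t) (x + t) (fun y => Dt U (y, 0)).
  rewrite /F /l /r !mulr0 !addr0 (ri_split0 _ _ (continuous_section_x (t := 0) cUt)) //.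
have -> : (fun s => ri (x - t + s) (x + t - s) (fun y => Dt (Dt U) (y, s) - Dx (Dx U) (y, s))) = G.
  by apply/funext => s; rewrite /G /l /r mul1r mulN1r.
move=> ->; lra.
Qed.

End DAlembert.

(** * The transpose of d'Alembert's formula *)

Section Duality.
Context {R : realType}.
Local Notation Dx g := (derive g ^~ (sp_axis (dir_x R))).
Local Notation I1 := (@integral_space R (line R)).
Local Notation I2 := (@integral_space R (plane R)).
Local Notation cc := compactly_supported_continuous.

(* [sg = 1] or [sg = -1] selects the family of characteristics. *)
Definition charint (sg : R) (p : plane R -> R) : line R -> R :=
  fun y => I1 (fun t => p (y + sg * t, t)).

(** A shear moves the first coordinate by [|t| <= X] at most on the support, which explains the
    radius [2 X]. *)
Lemma supp_shear (p : plane R -> R) (X sg y t : R) : (sg = 1 \/ sg = -1) ->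
  (forall z, X < `|z| -> p z = 0) -> 2 * X < `|(y, t)| -> p (y + sg * t, t) = 0.
Proof.
move=> hs pX h; apply: pX; rewrite plane_norm_lt; rewrite plane_norm_lt in h.
have [tX|Xt] := leP `|t| X; last by rewrite orbT.
apply/orP; left.
have st : `|sg * t| = `|t| by case: hs => ->; rewrite ?mul1r // mulN1r normrN.
have n1 := ler_normB (y + sg * t) (sg * t); rewrite addrK st in n1.
have := normr_ge0 t; case/orP: h => h h0; lra.
Qed.

(** In the inner integral at fixed t the substitution [y = x - sg t] separates [A y] from the
    sheared [p]; exchanging the integrals then leaves [A] against [charint sg p]. *)
Lemma shear_integral (A : R -> R) (p : plane R -> R) (sg : R) : (sg = 1 \/ sg = -1) ->
  continuous A -> cc p ->
  I2 (fun z => A (z.1 - sg * z.2) * p z) = I1 (fun y => A y * charint sg p y).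
Proof.
move=> hs cA [cp [X X0 pX]].
pose g (z : plane R) := A (z.1 - sg * z.2) * p z.
pose h (z : plane R) := A z.1 * p (z.1 + sg * z.2, z.2).
have cg : continuous g.
  by apply: continuousT_mul => //; apply: (continuousT_comp cA); cont.
have ch : continuous h.
  apply: continuousT_mul; first by apply: (continuousT_comp cA); cont.
  by apply: (continuousT_comp cp); cont.
have hX z : 2 * X < `|z| -> h z = 0.
  by case: z => y t hz; rewrite /h (supp_shear hs pX hz) mulr0.
(* [Z] bounds the support of [h] with room for the closed condition in [ri_supp], and [W] leaves
   room for the shift by [|t| <= X]. *)
pose Z := 2 * X + 1; pose W := Z + X.
have Z0 : 0 <= Z by rewrite /Z; lra.
have W0 : 0 <= W by rewrite /W; lra.
rewrite -/g (@plane_integral_supp R g W) //; last first.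
  by move=> z hz; rewrite /g pX ?mulr0 //; apply: le_lt_trans hz; rewrite /W lerDr.
have XZ : X <= Z by rewrite /Z; lra.
have ph (y : R) : @compactly_supported_continuous R (line R) (fun t : R => p (y + sg * t, t)).
  split; first by apply: (continuousT_comp cp); cont.
  by exists X => // t ht; apply: pX; rewrite plane_norm_lt ht orbT.
have inner t : ri (- W) W (fun x => g (x, t)) = ri (- W) W (fun y => h (y, t)).
  have chs : continuous (fun y => h (y, t)) by exact: continuous_section_x.
  have hZ y : Z <= `|y| -> h (y, t) = 0.
    by move=> hy; apply: hX; rewrite plane_norm_lt (lt_le_trans _ hy) // /Z; lra.
  have [tX|Xt] := leP `|t| X.
    have -> : (fun x => g (x, t)) = (fun x => h (x + - (sg * t), t)).
      by apply/funext => x; rewrite /g /h /= subrK.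
    rewrite (@ri_supp_shift R (fun y => h (y, t)) Z W (- (sg * t))) //; last first.
      by rewrite normrN; case: hs => ->; rewrite ?mul1r ?mulN1r ?normrN /W lerD2l.
    by apply/esym; apply: ri_supp => //; rewrite /W; lra.
  congr ri; apply/funext => x; rewrite /g /h !pX ?mulr0 //;
    by rewrite plane_norm_lt Xt orbT.
rewrite /pint; under [X in ri _ _ X = _]eq_fun do rewrite inner.
have bh : bounded_supp h W.
  by apply: continuous_bounded_supp_plane => // z hz; apply: hX; apply: le_lt_trans hz; rewrite /W /Z; lra.
rewrite -(plane_fubini W0 bh) (plane_fubini2 W0 bh).
rewrite (@line_integral_supp R (fun y => A y * charint sg p y) W) //; last first.
  move=> y hy; rewrite /charint (_ : (fun t => _) = fun=> 0).
    by rewrite (integral_space0 (@line_calculus R)) mulr0.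
  apply/funext => t; apply: (supp_shear hs pX); rewrite plane_norm_lt.
  by rewrite (le_lt_trans _ hy) // /W /Z; lra.
congr ri; apply/funext => y; rewrite /h /= riZ; last exact: (ph y).1.
congr (_ * _); rewrite /charint (@line_integral_supp R _ W) // => t ht.
by apply: pX; rewrite plane_norm_lt (le_lt_trans _ ht) ?orbT // /W; lra.
Qed.

Definition charprim (p : plane R -> R) : line R -> R :=
  fun y => I1 (fun t => ri (y - t) (y + t) (fun x => p (x, t))).

Lemma charprim_supp (p : plane R -> R) (X y : R) : (forall z, X < `|z| -> p z = 0) ->
  2 * X < `|y| -> charprim p y = 0.
Proof.
move=> pX hy; rewrite /charprim (_ : (fun t => _) = fun=> 0).
  by rewrite (integral_space0 (@line_calculus R)).
apply/funext => t; rewrite -[RHS](ri0 (R := R) (y - t) (y + t)); apply: ri_eq => x hx.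
apply: pX; rewrite plane_norm_lt; have [tX|Xt] := leP `|t| X; last by rewrite orbT.
apply/orP; left.
have := ler_norm t; have := ler_norm (- t); rewrite normrN => t1 t2.
case: (leP 0 y) hy => y0.
  rewrite ger0_norm // => hy; apply: lt_le_trans (ler_norm x).
  by case: hx => /andP[h1 h2]; lra.
rewrite ltr0_norm // => hy; rewrite -normrN; apply: lt_le_trans (ler_norm (- x)).
by case: hx => /andP[h1 h2]; lra.
Qed.

Lemma charint_bound (p : plane R -> R) (X sg y : R) : (sg = 1 \/ sg = -1) ->
  (forall z, X < `|z| -> p z = 0) -> 2 * X < `|y| -> charint sg p y = 0.
Proof.
move=> hs pX hy; rewrite /charint (_ : (fun t => _) = fun=> 0).
  by rewrite (integral_space0 (@line_calculus R)).
by apply/funext => t; apply: (supp_shear hs pX); rewrite plane_norm_lt hy.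
Qed.

(** The inner integral has derivative [p (y + t, t) - p (y - t, t)]. This yields both the smoothness
    of [charprim] and the integration by parts in [dalembert_duality]. *)
Lemma charprim_derive (p : plane R -> R) (y : R) : cc p ->
  is_derive y 1 (charprim p : R -> R) (charint 1 p y - charint (-1) p y).
Proof.
move=> [cp [X X0 pX]].
have pt t : X < `|t| -> forall x, p (x, t) = 0.
  by move=> ht x; apply: pX; rewrite plane_norm_lt ht orbT.
have -> : charprim p = fun y => ri (- X) X (fun t => ri (y - t) (y + t) (fun x => p (x, t))).
  apply/funext => z; rewrite /charprim (@line_integral_supp R _ X) // => t ht.
  by rewrite -[RHS](ri0 (R := R) (z - t) (z + t)); congr ri; apply/funext => x; exact: pt.
have -> : charint 1 p y - charint (-1) p y =
    ri (- X) X (fun t => p (y + t, t) - p (y - t, t)).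
  rewrite riB; last 2 first.
  - by apply: (continuousT_comp cp (f := fun t : R => (y + t, t))); cont.
  - by apply: (continuousT_comp cp (f := fun t : R => (y - t, t))); cont.
  rewrite /charint !(@line_integral_supp R _ X) //; last 2 first.
  - by move=> t ht; exact: pt.
  - by move=> t ht; exact: pt.
  by congr (_ - _); congr ri; apply/funext => t; rewrite ?mul1r ?mulN1r.
apply: (@is_derive_param_ri R R (fun t y => ri (y - t) (y + t) (fun x => p (x, t)))
   (fun t y => p (y + t, t) - p (y - t, t))).
- move=> t z; have ct := continuous_section_x (t := t) cp.
  have [P dP] := primitive_exists ct.
  have -> : (fun z => ri (z - t) (z + t) (fun x => p (x, t))) = fun z => P (1 * z + t) - P (1 * z - t).
    by apply/funext => w; rewrite (ri_FTC _ _ ct dP) !mul1r.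
  have h1 := is_derive_affine (dP (1 * z + t)); have h2 := is_derive_affine (dP (1 * z - t)).
  by have := is_deriveB h1 h2; rewrite !mul1r.
- move=> z; apply: (@continuous_ri_endpoints R R (fun x t => p (x, t))); cont.
  by apply: (continuousT_comp cp (f := fun q : R * R => (q.1, q.2))); cont.
- by apply: continuousT_add; [|apply: continuousT_opp];
    apply: (continuousT_comp cp); cont.
Qed.

Lemma charint_continuous (p : plane R -> R) sg : cc p -> continuous (charint sg p).
Proof.
move=> [cp [X X0 pX]].
have -> : charint sg p = fun y => ri (- X) X (fun t => p (y + sg * t, t)).
  apply/funext => z; rewrite /charint (@line_integral_supp R _ X) // => t ht.
  by apply: pX; rewrite plane_norm_lt ht orbT.
apply: (@continuous_param_ri R R (fun t y => p (y + sg * t, t))).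
by apply: (continuousT_comp cp); cont.
Qed.

Lemma charint_cc (p : plane R -> R) sg : (sg = 1 \/ sg = -1) -> cc p -> cc (charint sg p).
Proof.
move=> hs ccp; split; first exact: charint_continuous.
have [_ [X X0 pX]] := ccp; exists (2 * X); first by rewrite mulr_ge0.
by move=> y; exact: charint_bound.
Qed.

Lemma charprim_cc (p : plane R -> R) : cc p -> cc (charprim p).
Proof.
move=> ccp; split.
  by move=> y; exact: is_derive_continuous (charprim_derive y ccp).
have [_ [X X0 pX]] := ccp; exists (2 * X); first by rewrite mulr_ge0.
by move=> y; exact: charprim_supp.
Qed.

(** With a primitive [Bp] of [B] the integral term becomes [Bp (x + t) - Bp (x - t)], so that every
    term is a function of [x - t] or of [x + t] and [shear_integral] applies. An integration by
    parts on the line then restores [B]. *)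
Lemma dalembert_duality (A B : R -> R) (p : plane R -> R) : continuous A -> continuous B -> cc p ->
  I2 (fun z => (2^-1 * (A (z.1 - z.2) + A (z.1 + z.2)) + 2^-1 * ri (z.1 - z.2) (z.1 + z.2) B) * p z) =
  2^-1 * (I1 (fun y => A y * charint 1 p y) + I1 (fun y => A y * charint (-1) p y)) +
  2^-1 * I1 (fun y => B y * charprim p y).
Proof.
move=> cA cB ccp; have [Bp dBp] := primitive_exists cB.
have cBp : continuous Bp by move=> x; exact: is_derive_continuous (dBp x).
(* The boundary terms vanish because [charprim p] is supported in [[- 2 X, 2 X]] and the integration
   extends to [2 X + 1]. *)
have parts : I1 (fun y => B y * charprim p y) =
   I1 (fun y => Bp y * charint (-1) p y) - I1 (fun y => Bp y * charint 1 p y).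
  have [_ [X X0 pX]] := ccp.
  have W0 : 0 <= 2 * X + 1 by lra.
  have W1 : 2 * X < 2 * X + 1 by lra.
  have sW y : 2 * X + 1 < `|y| -> 2 * X < `|y| by apply: lt_trans.
  have cP := (charprim_cc ccp).1; have c1 := charint_continuous (sg := 1) ccp; have c2 := charint_continuous (sg := -1) ccp.
  have lp := @line_integral_supp R _ (2 * X + 1) W0.
  rewrite !lp; first last.
  - by move=> y /sW hy; rewrite (charprim_supp pX hy) mulr0.
  - by move=> y /sW hy; rewrite (charint_bound (or_intror erefl) pX hy) mulr0.
  - by move=> y /sW hy; rewrite (charint_bound (or_introl erefl) pX hy) mulr0.
  have dprod (y : R) : is_derive y 1 (fun y : R => Bp y * charprim p y)
      (B y * charprim p y + Bp y * (charint 1 p y - charint (-1) p y)).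
    exact: (@is_derive_mul R (line R) Bp (charprim p) y 1 _ _ (dBp y) (charprim_derive y ccp)).
  have := ri_FTC (- (2 * X + 1)) (2 * X + 1) _ dprod.
  rewrite !(charprim_supp pX) ?normrN ?(ger0_norm W0) // !mulr0 subrr.
  have -> : (fun y => B y * charprim p y + Bp y * (charint 1 p y - charint (-1) p y)) =
     (fun y => B y * charprim p y + (Bp y * charint 1 p y - Bp y * charint (-1) p y)).
    by apply/funext => y; ring.
  have k1 : continuous (fun y => B y * charprim p y) by exact: continuousT_mul.
  have k2 : continuous (fun y => Bp y * charint 1 p y) by exact: continuousT_mul.
  have k3 : continuous (fun y => Bp y * charint (-1) p y) by exact: continuousT_mul.
  have k4 : continuous (fun y => Bp y * charint 1 p y - Bp y * charint (-1) p y).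
    by apply: continuousT_add => //; exact: continuousT_opp.
  have lin (a b c : R) : a + (b - c) = 0 -> a = c - b by lra.
  by rewrite (riD _ _ k1 k4) (riB _ _ k2 k3) => /(_ (continuousT_add k1 k4))/lin.
have E1 := shear_integral (or_introl erefl) cA ccp.
have E2 := shear_integral (or_intror erefl) cA ccp.
have E3 := shear_integral (or_introl erefl) cBp ccp.
have E4 := shear_integral (or_intror erefl) cBp ccp.
rewrite parts -E1 -E2 -E3 -E4.
have ccF (F : R -> R) sg c : continuous F -> cc (fun z : plane R => c * (F (z.1 - sg * z.2) * p z)).
  move=> cF; under eq_fun => z do rewrite mulrA mulrC.
  apply: cc_mull => //; apply: continuousT_mul; first exact: continuousT_cst.
  by apply: (continuousT_comp cF); cont.
have I2Z c (F : R -> R) sg : (sg = 1 \/ sg = -1) -> continuous F ->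
    c * I2 (fun z => F (z.1 - sg * z.2) * p z) = I2 (fun z => c * (F (z.1 - sg * z.2) * p z)).
  move=> hs cF; have cFc : continuous (fun y => c * F y) by apply: continuousT_mul => //; exact: continuousT_cst.
  have -> : (fun z : plane R => c * (F (z.1 - sg * z.2) * p z)) =
      (fun z : plane R => (fun y => c * F y) (z.1 - sg * z.2) * p z).
    by apply/funext => z; rewrite mulrA.
  rewrite (shear_integral hs cF ccp) (shear_integral hs cFc ccp).
  have [_ [Y Y0 cY]] := charint_cc hs ccp.
  have cY' y : Y < `|y| -> F y * charint sg p y = 0 by move/cY ->; rewrite mulr0.
  rewrite !(@line_integral_supp R _ Y) //; last by move=> y /cY ->; rewrite mulr0.
  rewrite -riZ; last by apply: continuousT_mul => //; exact: charint_continuous.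
  by congr ri; apply/funext => y; rewrite mulrA.
have hp : (1 : R) = 1 \/ (1 : R) = -1 by left.
have hm : (-1 : R) = 1 \/ (-1 : R) = -1 by right.
rewrite !mulrDr mulrN !I2Z //.
rewrite -(integral_add (@plane_calculus R)); [|exact: ccF..].
rewrite -(integral_sub (@plane_calculus R)); [|exact: ccF..].
rewrite -(integral_add (@plane_calculus R)).
- congr I2; apply/funext => z; rewrite (ri_FTC _ _ cB dBp) !mul1r !mulN1r !opprK; ring.
- by apply: cc_add; exact: ccF.
- by apply: cc_add; [|apply: cc_opp]; exact: ccF.
Qed.

Lemma rsmooth_plane_section (q : plane R -> R) (c d : R) : rsmooth q ->
  rsmooth ((fun y => q (y + c, d)) : line R -> R) /\
  forall l : seq 'I_(sp_dim (line R)), rpartial l ((fun y => q (y + c, d)) : line R -> R) =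
    fun y : line R => rpartial (map (fun=> dir_x R) l) q (y + c, d).
Proof.
have dq (q' : plane R -> R) (y : R) : rsmooth q' ->
    is_derive (y : line R) (1 : R) ((fun y => q' (y + c, d)) : line R -> R) (Dx q' (y + c, d)).
  move=> sq'; have := is_derive_affine (c := 1) (d := c) (x := y) (rsmooth_derive_x (1 * y + c) d sq').
  by under [X in is_derive _ _ X]eq_fun do rewrite mul1r; rewrite !mul1r.
move=> sq; split.
  pose P (h : line R -> R) := exists2 q' : plane R -> R, rsmooth q' & h = fun y : line R => q' (y + c, d).
  apply: (@rsmooth_coind R (line R) P); last by exists q.
  move=> _ [q' sq' ->]; split.
    by apply: (continuousT_comp (rsmooth_continuous sq')); cont.
  move=> i; exists (fun y => Dx q' (y + c, d)) => [|y]; last exact: dq.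
  by exists (Dx q') => //; exact: rsmooth_D.
elim=> // i l IH /=; rewrite -/(rpartial l _) IH.
apply: (@is_derive_fun R (line R) _ (fun y => Dx (rpartial [seq dir_x R | _ <- l] q) (y + c, d))) => y.
by apply: dq; exact: rsmooth_rpartial.
Qed.

Lemma charint_rsmooth (p : plane R -> R) sg : rsmooth p -> cc p -> rsmooth (charint sg p).
Proof.
move=> sp [cp [X X0 pX]].
have -> : charint sg p = fun y => ri (- X) X (fun t => p (y + sg * t, t)).
  apply/funext => z; rewrite /charint (@line_integral_supp R _ X) // => t ht.
  by apply: pX; rewrite plane_norm_lt ht orbT.
apply: (@rsmooth_param_ri R (line R) (fun t y => p (y + sg * t, t))).
split=> [t|l]; first exact: (rsmooth_plane_section (sg * t) t sp).1.
have -> : (fun q : R * line R => rpartial l ((fun y => p (y + sg * q.1, q.1)) : line R -> R) q.2) =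
   fun q => rpartial (map (fun=> dir_x R) l) p (q.2 + sg * q.1, q.1).
  by apply/funext => q; rewrite (rsmooth_plane_section (sg * q.1) q.1 sp).2.
by apply: (continuousT_comp (rsmooth_continuous (rsmooth_rpartial _ sp))); cont.
Qed.

(** Its derivative is a difference of two functions [charint], already known to be smooth; the
    coinductive class is the smooth functions together with this one function. *)
Lemma charprim_rsmooth (p : plane R -> R) : rsmooth p -> cc p -> rsmooth (charprim p).
Proof.
move=> sp ccp.
have sd : rsmooth (fun y => charint 1 p y - charint (-1) p y).
  by apply: rsmooth_sub; exact: charint_rsmooth.
pose P (h : line R -> R) := h = charprim p \/ rsmooth h.
apply: (@rsmooth_coind R (line R) P); last by left.
move=> h [->|sh].
  split; first exact: (charprim_cc ccp).1.
  by move=> i; eexists; [right; exact: sd|move=> y; exact: charprim_derive].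
split; first exact: rsmooth_continuous.
by move=> i; exists ('D_(sp_axis i) h); [right; exact: rsmooth_D|move=> x; exact: rsmooth_is_derive].
Qed.

End Duality.

(** * Pairing with test functions *)

Section IntegralOrder.
Context {R : realType}.
Local Notation cc := compactly_supported_continuous.

Record integral_order (E : coord_space R) := IntegralOrder {
  integral_mono : forall g h : E -> R, cc g -> cc h -> (forall x, g x <= h x) ->
    integral_space g <= integral_space h;
  integral_homog : forall (c : R) (g : E -> R), cc g ->
    integral_space (fun x => c * g x) = c * integral_space g }.

Lemma line_integrable_cc (g : line R -> R) : cc g -> mu.-integrable setT (EFin \o g).
Proof.
move=> [cg [X X0 gX]].
have gX' x : ~ [set x : line R | `|x| <= X] x -> g x = 0.
  by move=> /negP; rewrite -ltNge; exact: gX.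
have [B _ gB] := continuous_bounded_supp cg (@ball_compact R (line R) (@line_calculus R) X) gX'.
apply: (@integrable_bounded_supp1 R g X B) => //; first exact: continuous_measurable_fun.
by move=> x hx; apply: gX; rewrite ltNge ler_norml; apply/negP.
Qed.

Lemma plane_integrable_cc (g : plane R -> R) : cc g ->
  ((@lebesgue_measure R) \x (@lebesgue_measure R))%E.-integrable setT (EFin \o g).
Proof.
by move=> [cg [X X0 gX]]; apply: (@integrable_bounded_supp R g X); exact: continuous_bounded_supp_plane.
Qed.

Definition line_order : integral_order (line R).
Proof.
split=> [g h cg ch gh|c g cg].
  by apply: le_Rintegral => //; exact: line_integrable_cc.
exact: RintegralZl (line_integrable_cc cg).
Defined.

Definition plane_order : integral_order (plane R).
Proof.
split=> [g h cg ch gh|c g cg].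
  by apply: le_Rintegral => //; exact: plane_integrable_cc.
exact: RintegralZl (plane_integrable_cc cg).
Defined.

End IntegralOrder.

Section Modulus.
Context {R : realType} {k : scalar_kind}.
Local Notation K := (scalar_field R k).

Lemma modulusD (x y : K) : modulus (x + y) <= modulus x + modulus y.
Proof.
rewrite /modulus -reD; case: k x y => [x y|x y]; first exact: ler_normD.
by have := ler_normD x y; rewrite lecE => /andP[].
Qed.

Lemma modulusN (x : K) : modulus (- x) = modulus x.
Proof. by rewrite /modulus normrN. Qed.

Lemma modulusM (x y : K) : modulus (x * y) = modulus x * modulus y.
Proof.
by rewrite !modulusE -sqrtrM ?addr_ge0 ?sqr_ge0 // reM imM; congr Num.sqrt; ring.
Qed.

Lemma modulus_half (x : K) : modulus (2^-1 * x) = 2^-1 * modulus x.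
Proof.
rewrite modulusM; congr (_ * _).
have -> : (2^-1 : K) = 2^-1 * 1 by rewrite mulr1.
by rewrite modulusE re_half im_half re1 im1 mulr1 mulr0 expr0n addr0 sqrtr_sqr ger0_norm.
Qed.

End Modulus.

Section TestPairing.
Context {R : realType} {k : scalar_kind} {E : coord_space R}.
Variable cal : space_calculus E.
Variable ord : integral_order E.
Local Notation K := (scalar_field R k).
Local Notation I := (@integral_space R E).
Local Notation cc := compactly_supported_continuous.

Lemma integral_norm_le (F h : E -> R) (c : R) : cc F -> cc h ->
  (forall x, `|F x| <= c * h x) -> `|I F| <= c * I h.
Proof.
move=> cF ch Fh.
have cch : cc (fun x => c * h x).
  by under eq_fun do rewrite mulrC; apply: cc_mull => //; exact: continuousT_cst.
rewrite -(integral_homog ord c ch) ler_norml; apply/andP; split.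
  have cN : cc (fun x => -1 * (c * h x)).
    by under eq_fun do rewrite mulrC; apply: cc_mull => //; exact: continuousT_cst.
  rewrite -mulN1r -(integral_homog ord) //; apply: (integral_mono ord) => // x.
  by have := Fh x; rewrite ler_norml mulN1r => /andP[].
by apply: (integral_mono ord) => // x; have := Fh x; rewrite ler_norml => /andP[].
Qed.

Lemma cc_norm (h : E -> R) : cc h -> cc (fun x => `|h x|).
Proof.
move=> [ch [X X0 hX]]; split; first exact: continuousT_norm.
by exists X => // x /hX ->; rewrite normr0.
Qed.

Lemma cc_mulr (f g : E -> R) : continuous f -> cc g -> cc (fun x => f x * g x).
Proof. by move=> cf cg; under eq_fun do rewrite mulrC; exact: cc_mull. Qed.

Lemma cc_re_mul (g psi : E -> K) : continuous_scalar g -> test psi ->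
  cc (fun x => re (g x * psi x)).
Proof.
move=> [cr ci] tp; under eq_fun do rewrite reM.
apply: cc_add; first by apply: cc_mulr => //; exact: test_cc_re.
by apply: cc_opp; apply: cc_mulr => //; exact: test_cc_im.
Qed.

Lemma cc_im_mul (g psi : E -> K) : continuous_scalar g -> test psi ->
  cc (fun x => im (g x * psi x)).
Proof.
move=> [cr ci] tp; under eq_fun do rewrite imM.
by apply: cc_add; apply: cc_mulr => //; [exact: test_cc_im|exact: test_cc_re].
Qed.

Lemma Kintegral_mulB (g1 g2 psi : E -> K) : continuous_scalar g1 -> continuous_scalar g2 ->
  test psi -> Kintegral (fun x => (g1 x - g2 x) * psi x) =
    Kintegral (fun x => g1 x * psi x) - Kintegral (fun x => g2 x * psi x).
Proof.
move=> c1 c2 tp; apply: scalar_eq.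
  rewrite reB !(re_Kintegral) -(integral_sub cal); [|exact: cc_re_mul..].
  by congr I; apply/funext => x; rewrite mulrBl reB.
rewrite imB !(im_Kintegral cal) -(integral_sub cal); [|exact: cc_im_mul..].
by congr I; apply/funext => x; rewrite mulrBl imB.
Qed.

Lemma Kintegral_small (psi : E -> K) : test psi -> exists2 M : R, 0 <= M &
  forall (g : E -> K) (d : R), continuous_scalar g -> 0 <= d ->
    (forall x, psi x != 0 -> modulus (g x) <= d) ->
    modulus (Kintegral (fun x => g x * psi x)) <= M * d.
Proof.
move=> tp; pose h x := `|re (psi x)| + `|im (psi x)|.
have ch : cc h by apply: cc_add; apply: cc_norm; [exact: test_cc_re|exact: test_cc_im].
have h0 x : 0 <= h x by rewrite addr_ge0.
have Ih : 0 <= I h by rewrite -(integral_space0 cal); apply: (integral_mono ord) => //; exact: cc0.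
(* [h] is a continuous, compactly supported majorant of the modulus of [psi], and the factor 2
   counts the real and the imaginary part of the integral. *)
exists (2 * I h) => [|g d cg d0 gd]; first by rewrite mulr_ge0.
have gh x : modulus (g x * psi x) <= d * h x.
  have [->|p0] := eqVneq (psi x) 0.
    by rewrite mulr0 (le_trans (modulus_le _)) // re0 im0 normr0 addr0 mulr_ge0.
  rewrite modulusM; apply: ler_pM; [exact: modulus_ge0|exact: modulus_ge0|exact: gd|exact: modulus_le].
have H1 := integral_norm_le (cc_re_mul cg tp) ch (fun x => le_trans (re_le_modulus _) (gh x)).
have H2 := integral_norm_le (cc_im_mul cg tp) ch (fun x => le_trans (im_le_modulus _) (gh x)).
apply: le_trans (modulus_le _) _; rewrite re_Kintegral (im_Kintegral cal).
apply: le_trans (lerD H1 H2) _; lra.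
Qed.

Lemma continuous_scalar_cst (c : K) : continuous_scalar (fun _ : E => c).
Proof. by split; exact: continuousT_cst. Qed.

Lemma continuous_scalar_sub (g1 g2 : E -> K) : continuous_scalar g1 -> continuous_scalar g2 ->
  continuous_scalar (fun x => g1 x - g2 x).
Proof.
move=> [r1 i1] [r2 i2]; split.
  rewrite (_ : _ \o _ = fun x => re (g1 x) - re (g2 x)); last by apply/funext => x /=; rewrite reB.
  by apply: continuousT_add => //; exact: continuousT_opp.
rewrite (_ : _ \o _ = fun x => im (g1 x) - im (g2 x)); last by apply/funext => x /=; rewrite imB.
by apply: continuousT_add => //; exact: continuousT_opp.
Qed.

Lemma continuous_scalar_add (g1 g2 : E -> K) : continuous_scalar g1 -> continuous_scalar g2 ->
  continuous_scalar (fun x => g1 x + g2 x).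
Proof.
move=> [r1 i1] [r2 i2]; split.
  rewrite (_ : _ \o _ = fun x => re (g1 x) + re (g2 x)); last by apply/funext => x /=; rewrite reD.
  exact: continuousT_add.
rewrite (_ : _ \o _ = fun x => im (g1 x) + im (g2 x)); last by apply/funext => x /=; rewrite imD.
exact: continuousT_add.
Qed.

Lemma smooth_continuous_scalar (g : E -> K) : smooth g -> continuous_scalar g.
Proof.
by move=> sg; split; [exact: rsmooth_continuous (smooth_re sg)|exact: rsmooth_continuous (smooth_im sg)].
Qed.

End TestPairing.

(** * Representatives modulo null families *)

Section Cosets.
Context {R : realType} {k : scalar_kind} {E : coord_space R}.
Local Notation K := (scalar_field R k).

Lemma coset_refl (r : eps_family E k) : coset r r.
Proof.
have z e x : r e x - r e x = 0 by rewrite subrr.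
split=> [e _|C l q cC q0].
  by under eq_fun do rewrite z; exact: smooth_cst.
exists 0; apply: nearW => e x _; rewrite mul0r.
under [X in partial l X]eq_fun do rewrite z.
rewrite /partial modulusE re_partial im_partial; under eq_fun do rewrite re0.
by under [X in _ + (rpartial _ X _) ^+ 2]eq_fun do rewrite im0;
  rewrite !rpartial0 expr0n addr0 sqrtr0.
Qed.

Lemma partial_nil (u : E -> K) x : partial [::] u x = u x.
Proof. exact: of_parts_re_im. Qed.

(* Only the zeroth order bound by [O(e)] of a null family is used. *)
Lemma negligible_bound (cal : space_calculus E) (r : eps_family E k) (X : R) :
  negligible_family r -> exists2 C : R, 0 <= C &
    \forall e \near 0^'+, forall x, `|x| <= X -> modulus (r e x) <= C * e.
Proof.
move=> nr; have [c Hc] := nr.2 _ [::] 1 (@ball_compact R E cal X) ler01.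
exists `|c| => //; near=> e => x xX.
have e0 : 0 < e by [].
have H : forall x : E, `|x| <= X -> modulus (partial [::] (r e) x) <= c * e `^ 1 by near: e.
have := H x xX; rewrite partial_nil powRr1 ?(ltW e0) // => /le_trans; apply.
by rewrite ler_wpM2r ?(ltW e0) // ler_norm.
Unshelve. all: by end_near. Qed.

End Cosets.

Section EmbeddedPairing.
Context {R : realType} {k : scalar_kind} {E : coord_space R}.
Variable cal : space_calculus E.
Variable ord : integral_order E.
Local Notation K := (scalar_field R k).
Variables phi chi : E -> K.
Hypothesis mphi : mollifier phi.
Hypothesis cchi : cutoff chi.
Local Notation I := (@integral_space R E).
Local Notation cc := compactly_supported_continuous.

(** The properties retained of a representative of an embedded distribution. They are stated for any
    family so as to cover the traces of [u] and [u_t] at t = 0 as well as the representatives of the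
    embedded sum v + w. *)
Definition represents (A : R -> E -> K) (T : (E -> K) -> K) : Prop :=
  (\forall e \near 0^'+, continuous_scalar (A e)) /\
  forall X : R, exists2 C : R, 0 <= C & \forall e \near 0^'+,
    forall x, `|x| <= X -> modulus (A e x - regularization phi chi T e x) <= C * e.

Lemma represents_pairing (A : R -> E -> K) (T : (E -> K) -> K) psi :
  is_distribution T -> represents A T -> test psi ->
  exists2 C : R, 0 <= C & \forall e \near 0^'+,
    modulus (Kintegral (fun x => A e x * psi x) - T psi) <= C * e.
Proof.
move=> dT [cA nA] tp.
have [X X0 pX] := test_bounded tp.
have [C C0 HC] := nA X; have [D D0 HD] := regularization_converges cal mphi cchi dT tp.
have [M M0 HM] := Kintegral_small cal ord tp.
exists (M * C + D); first by rewrite addr_ge0 // mulr_ge0.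
near=> e.
have e0 : 0 < e by [].
have cAe : continuous_scalar (A e) by near: e.
have cr : continuous_scalar (regularization phi chi T e).
  by have [] := regularization_continuous cal mphi cchi e dT.
have Ce0 : 0 <= C * e by rewrite mulr_ge0 // ltW.
have HCe : forall x, `|x| <= X -> modulus (A e x - regularization phi chi T e x) <= C * e by near: e.
have h1 := HM _ (C * e) (continuous_scalar_sub cAe cr) Ce0.
have h2 := HD e e0.
rewrite -(subrK (Kintegral (fun x => regularization phi chi T e x * psi x))
  (Kintegral (fun x => A e x * psi x))) -addrA.
apply: le_trans (modulusD _ _) _; rewrite mulrDl; apply: lerD => //.
rewrite -(Kintegral_mulB cal cAe cr tp) -mulrA; apply: h1 => x px.
by apply: HCe; rewrite leNgt; apply: contra px => /pX ->.
Unshelve. all: by end_near. Qed.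

Lemma Kintegral_mul_parts (A q : E -> K) (a b r i : E -> R) :
  continuous a -> continuous b -> cc r -> cc i ->
  (forall x, re (A x) = a x /\ im (A x) = b x) -> (forall x, re (q x) = r x /\ im (q x) = i x) ->
  re (Kintegral (fun x => A x * q x)) = I (fun x => a x * r x) - I (fun x => b x * i x) /\
  im (Kintegral (fun x => A x * q x)) = I (fun x => a x * i x) + I (fun x => b x * r x).
Proof.
move=> ca cb cr ci Aab qri; rewrite re_Kintegral (im_Kintegral cal).
rewrite -(integral_sub cal); [|exact: cc_mulr..].
rewrite -(integral_add cal); [|exact: cc_mulr..].
by split; congr I; apply/funext => x; have [h1 h2] := qri x; have [h3 h4] := Aab x;
  rewrite ?reM ?imM h1 h2 h3 h4.
Qed.

End EmbeddedPairing.

(** * The linear wave equation and Duhamel's term *)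

Section LinearWave.
Context {R : realType} {k : scalar_kind}.
Local Notation K := (scalar_field R k).
Local Notation I1 := (@integral_space R (line R)).
Local Notation I2 := (@integral_space R (plane R)).
Local Notation cc := compactly_supported_continuous.

Definition dalembert_fun (A B : R -> K) (z : R * R) : K :=
  2^-1 * (A (z.1 - z.2) + A (z.1 + z.2)) + 2^-1 * interval_integral (z.1 - z.2) (z.1 + z.2) B.

(** Duhamel's term, in the iterated form of [weak_solution]. For negative times both integrals are
    reversed, so the two signs cancel. *)
Definition cone (g : R * R -> K) (z : R * R) : K :=
  2^-1 * interval_integral 0 z.2 (fun s =>
    interval_integral (z.1 - z.2 + s) (z.1 + z.2 - s) (fun y => g (y, s))).

Definition rdalembert (A B : R -> R) (z : R * R) : R :=
  2^-1 * (A (z.1 - z.2) + A (z.1 + z.2)) + 2^-1 * ri (z.1 - z.2) (z.1 + z.2) B.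

Definition rcone (g : R * R -> R) (z : R * R) : R :=
  2^-1 * ri 0 z.2 (fun s => ri (z.1 - z.2 + s) (z.1 + z.2 - s) (fun y => g (y, s))).

Lemma re_dalembert_fun A B z :
  re (dalembert_fun A B z) = rdalembert (fun y => re (A y)) (fun y => re (B y)) z.
Proof. by rewrite /dalembert_fun reD !re_half reD re_interval_integral. Qed.

Lemma im_dalembert_fun A B z :
  im (dalembert_fun A B z) = rdalembert (fun y => im (A y)) (fun y => im (B y)) z.
Proof. by rewrite /dalembert_fun imD !im_half imD im_interval_integral. Qed.

Lemma re_cone g z : re (cone g z) = rcone (fun p => re (g p)) z.
Proof.
rewrite /cone re_half re_interval_integral; congr (_ * ri _ _ _).
by apply/funext => s; rewrite re_interval_integral.
Qed.

Lemma im_cone g z : im (cone g z) = rcone (fun p => im (g p)) z.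
Proof.
rewrite /cone im_half im_interval_integral; congr (_ * ri _ _ _).
by apply/funext => s; rewrite im_interval_integral.
Qed.

Lemma rdalembert_continuous A B : continuous A -> continuous B -> continuous (rdalembert A B).
Proof.
move=> cA cB.
have c1 : continuous (fun z : R * R => z.1 - z.2) by cont.
have c2 : continuous (fun z : R * R => z.1 + z.2) by cont.
have c3 : continuous (fun p : R * (R * R) => B p.1).
  by apply: (continuousT_comp cB (f := fst)); cont.
have c4 := @continuous_ri_endpoints R (R * R)%type (fun y _ => B y) _ _ c3 c1 c2.
have c5 := continuousT_add (continuousT_comp cA c1) (continuousT_comp cA c2).
have ch : continuous (fun _ : R * R => 2^-1 : R) by exact: continuousT_cst.
exact: (continuousT_add (continuousT_mul ch c5) (continuousT_mul ch c4)).
Qed.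

Lemma dalembert_fun_continuous (A B : line R -> K) : continuous_scalar A -> continuous_scalar B ->
  @continuous_scalar R (plane R) k (dalembert_fun A B).
Proof.
move=> [rA iA] [rB iB]; split.
  rewrite (_ : _ \o _ = rdalembert (fun y => re (A y)) (fun y => re (B y))).
    exact: rdalembert_continuous.
  by apply/funext => z /=; rewrite re_dalembert_fun.
rewrite (_ : _ \o _ = rdalembert (fun y => im (A y)) (fun y => im (B y))).
  exact: rdalembert_continuous.
by apply/funext => z /=; rewrite im_dalembert_fun.
Qed.

Definition wave_op (u : plane R -> K) (z : plane R) : K :=
  partial [:: dir_t R; dir_t R] u z - partial [:: dir_x R; dir_x R] u z.

Lemma re_wave_op u z : re (wave_op u z) =
  rpartial [:: dir_t R; dir_t R] (fun z => re (u z)) z - rpartial [:: dir_x R; dir_x R] (fun z => re (u z)) z.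
Proof. by apply: etrans (reB _ _) _; congr (_ - _); exact: re_partial. Qed.

Lemma im_wave_op u z : im (wave_op u z) =
  rpartial [:: dir_t R; dir_t R] (fun z => im (u z)) z - rpartial [:: dir_x R; dir_x R] (fun z => im (u z)) z.
Proof. by apply: etrans (imB _ _) _; congr (_ - _); exact: im_partial. Qed.

(** An exact identity for every smooth function, obtained from d'Alembert's formula for the real and
    imaginary parts. The differential equation enters later, when [wave_op u] is compared with
    [f (u)]. *)
Lemma smooth_wave_decomposition (u : plane R -> K) (z : plane R) : smooth u ->
  u z = dalembert_fun (fun y => u (y, 0)) (fun y => partial [:: dir_t R] u (y, 0)) z +
    cone (wave_op u) z.
Proof.
move=> su; case: z => x t; apply: scalar_eq.
  rewrite reD re_dalembert_fun re_cone.
  have -> : (fun y => re (partial [:: dir_t R] u (y, 0))) =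
      fun y => rpartial [:: dir_t R] (fun z => re (u z)) (y, 0).
    by apply/funext => y; exact: re_partial.
  have -> := funext (re_wave_op u).
  exact: (dalembert_formula x t (smooth_re su)).
rewrite imD im_dalembert_fun im_cone.
have -> : (fun y => im (partial [:: dir_t R] u (y, 0))) =
    fun y => rpartial [:: dir_t R] (fun z => im (u z)) (y, 0).
  by apply/funext => y; exact: im_partial.
have -> := funext (im_wave_op u).
exact: (dalembert_formula x t (smooth_im su)).
Qed.

Section Characteristics.
Variable psi : plane R -> K.
Hypothesis tp : test psi.

Let Psi1 : line R -> K := fun y => Kintegral (fun t : line R => psi (y + t, t)).
Let Psi2 : line R -> K := fun y => Kintegral (fun t : line R => psi (y - t, t)).
Let Psi3 : line R -> K := fun y => Kintegral (fun t : line R =>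
  interval_integral (y - t) (y + t) (fun x => psi (x, t))).
Let rp (z : plane R) := re (psi z).
Let ip (z : plane R) := im (psi z).

Let parts1 y : re (Psi1 y) = charint 1 rp y /\ im (Psi1 y) = charint 1 ip y.
Proof.
by rewrite re_Kintegral (im_Kintegral (@line_calculus R)); split; congr I1;
  apply/funext => t; rewrite /rp /ip mul1r.
Qed.

Let parts2 y : re (Psi2 y) = charint (-1) rp y /\ im (Psi2 y) = charint (-1) ip y.
Proof.
by rewrite re_Kintegral (im_Kintegral (@line_calculus R)); split; congr I1;
  apply/funext => t; rewrite /rp /ip mulN1r.
Qed.

Let parts3 y : re (Psi3 y) = charprim rp y /\ im (Psi3 y) = charprim ip y.
Proof.
by rewrite re_Kintegral (im_Kintegral (@line_calculus R)); split; congr I1;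
  apply/funext => t; rewrite ?re_interval_integral ?im_interval_integral.
Qed.

Let ccr : cc rp. Proof. exact: test_cc_re. Qed.
Let cci : cc ip. Proof. exact: test_cc_im. Qed.

Lemma characteristic_tests : [/\ test Psi1, test Psi2 & test Psi3].
Proof.
have sr := smooth_re tp.1; have si := smooth_im tp.1.
have [X X0 pX] := test_bounded tp.
have rX z : X < `|z| -> rp z = 0 by move=> /pX h; rewrite /rp h re0.
have iX z : X < `|z| -> ip z = 0 by move=> /pX h; rewrite /ip h im0.
have hp : (1 : R) = 1 \/ (1 : R) = -1 by left.
have hm : (-1 : R) = 1 \/ (-1 : R) = -1 by right.
split; apply: (@smooth_bounded_test R k (line R) (@line_calculus R) _ (2 * X)).
- apply: (smooth_of_re_im (charint_rsmooth 1 sr ccr) (charint_rsmooth 1 si cci)) => y; by case: (parts1 y).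
- move=> y hy; have [h1 h2] := parts1 y.
  apply: scalar_eq; rewrite ?h1 ?h2 ?re0 ?im0; exact: charint_bound hp _ hy.
- apply: (smooth_of_re_im (charint_rsmooth (-1) sr ccr) (charint_rsmooth (-1) si cci)) => y; by case: (parts2 y).
- move=> y hy; have [h1 h2] := parts2 y.
  apply: scalar_eq; rewrite ?h1 ?h2 ?re0 ?im0; exact: charint_bound hm _ hy.
- apply: (smooth_of_re_im (charprim_rsmooth sr ccr) (charprim_rsmooth si cci)) => y; by case: (parts3 y).
- move=> y hy; have [h1 h2] := parts3 y.
  apply: scalar_eq; rewrite ?h1 ?h2 ?re0 ?im0; exact: charprim_supp hy.
Qed.

Lemma dalembert_fun_pairing (A B : line R -> K) : continuous_scalar A -> continuous_scalar B ->
  Kintegral (fun z : plane R => dalembert_fun A B z * psi z) =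
  2^-1 * (Kintegral (fun y => A y * Psi1 y) + Kintegral (fun y => A y * Psi2 y)) +
  2^-1 * Kintegral (fun y => B y * Psi3 y).
Proof.
move=> cA cB; have cD := dalembert_fun_continuous cA cB.
have [[rA iA] [rB iB]] := (cA, cB).
have crr := rdalembert_continuous rA rB; have cri := rdalembert_continuous iA iB.
have [t1 t2 t3] := characteristic_tests.
have E1 (F G : R -> R) p : continuous F -> continuous G -> cc p ->
   I2 (fun z => rdalembert F G z * p z) =
   2^-1 * (I1 (fun y => F y * charint 1 p y) + I1 (fun y => F y * charint (-1) p y)) +
   2^-1 * I1 (fun y => G y * charprim p y).
  by move=> cF cG cp; exact: dalembert_duality.
have hp : (1 : R) = 1 \/ (1 : R) = -1 by left.
have hm : (-1 : R) = 1 \/ (-1 : R) = -1 by right.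
have lp A' q a b p p' := @Kintegral_mul_parts R k (line R) (@line_calculus R) A' q a b p p'.
have [r1 i1] := lp A Psi1 _ _ _ _ rA iA (charint_cc hp ccr) (charint_cc hp cci) (fun=> conj erefl erefl) parts1.
have [r2 i2] := lp A Psi2 _ _ _ _ rA iA (charint_cc hm ccr) (charint_cc hm cci) (fun=> conj erefl erefl) parts2.
have [r3 i3] := lp B Psi3 _ _ _ _ rB iB (charprim_cc ccr) (charprim_cc cci) (fun=> conj erefl erefl) parts3.
have [r0 i0] := @Kintegral_mul_parts R k (plane R) (@plane_calculus R) _ psi _ _ _ _ crr cri ccr cci
  (fun z => conj (re_dalembert_fun A B z) (im_dalembert_fun A B z)) (fun z => conj erefl erefl).
have alg (a b c d e f : R) : 2^-1 * (a + b) + 2^-1 * c - (2^-1 * (d + e) + 2^-1 * f) =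
  2^-1 * (a - d + (b - e)) + 2^-1 * (c - f) by ring.
have alg' (a b c d e f : R) : 2^-1 * (a + b) + 2^-1 * c + (2^-1 * (d + e) + 2^-1 * f) =
  2^-1 * (a + d + (b + e)) + 2^-1 * (c + f) by ring.
have hre (x y z : K) : re (2^-1 * (x + y) + 2^-1 * z) = 2^-1 * (re x + re y) + 2^-1 * re z.
  by rewrite reD !re_half reD.
have him (x y z : K) : im (2^-1 * (x + y) + 2^-1 * z) = 2^-1 * (im x + im y) + 2^-1 * im z.
  by rewrite imD !im_half imD.
apply: scalar_eq.
  rewrite [LHS]r0 [X in X - _](E1 _ _ _ rA rB ccr) [X in _ - X](E1 _ _ _ iA iB cci) alg.
  rewrite [RHS]hre; apply: esym; exact: (congr2 +%R (congr1 ( *%R 2^-1) (congr2 +%R r1 r2)) (congr1 ( *%R 2^-1) r3)).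
rewrite [LHS]i0 [X in X + _](E1 _ _ _ rA rB cci) [X in _ + X](E1 _ _ _ iA iB ccr) alg'.
rewrite [RHS]him; apply: esym; exact: (congr2 +%R (congr1 ( *%R 2^-1) (congr2 +%R i1 i2)) (congr1 ( *%R 2^-1) i3)).
Qed.

(** The pairing formula reduces the difference to three pairings on the line with test functions
    that do not depend on [e], and each of them is O(e) by [represents_pairing]. *)
Lemma dalembert_fun_converges (phi chi : line R -> K) (a b : (line R -> K) -> K)
    (A B : R -> line R -> K) : mollifier phi -> cutoff chi ->
  is_distribution a -> is_distribution b ->
  represents phi chi A a -> represents phi chi B b ->
  exists2 C : R, 0 <= C & \forall e \near 0^'+,
    modulus (Kintegral (fun z : plane R => dalembert_fun (A e) (B e) z * psi z) -
      dalembert a b psi) <= C * e.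
Proof.
move=> mphi cchi da db rA rB; have [t1 t2 t3] := characteristic_tests.
have rep T F := @represents_pairing R k (line R) (@line_calculus R) (@line_order R) _ _ mphi cchi F T.
have [C1 C10 H1] := rep _ _ _ da rA t1; have [C2 C20 H2] := rep _ _ _ da rA t2.
have [C3 C30 H3] := rep _ _ _ db rB t3.
exists (C1 + C2 + C3); first by rewrite !addr_ge0.
near=> e.
have e0 : 0 < e by [].
rewrite (dalembert_fun_pairing (A := A e) (B := B e)); last 2 first.
- by near: e; exact: rA.1.
- by near: e; exact: rB.1.
rewrite /dalembert.
have alg (x y z x' y' z' : K) : 2^-1 * (x + y) + 2^-1 * z - (2^-1 * (x' + y') + 2^-1 * z') =
   2^-1 * ((x - x') + (y - y')) + 2^-1 * (z - z') by ring.
rewrite alg.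
have h1 : modulus (Kintegral (fun y => A e y * Psi1 y) - a Psi1) <= C1 * e by near: e.
have h2 : modulus (Kintegral (fun y => A e y * Psi2 y) - a Psi2) <= C2 * e by near: e.
have h3 : modulus (Kintegral (fun y => B e y * Psi3 y) - b Psi3) <= C3 * e by near: e.
apply: le_trans (modulusD _ _) _; rewrite !modulus_half.
have h4 := modulusD (Kintegral (fun y => A e y * Psi1 y) - a Psi1)
  (Kintegral (fun y => A e y * Psi2 y) - a Psi2).
have k1 : 0 <= C1 * e by rewrite mulr_ge0 // ltW.
have k2 : 0 <= C2 * e by rewrite mulr_ge0 // ltW.
have k3 : 0 <= C3 * e by rewrite mulr_ge0 // ltW.
rewrite !mulrDl.
have lin (m1 m2 m3 m4 c1 c2 c3 : R) : m1 <= c1 -> m2 <= c2 -> m3 <= c3 -> m4 <= m1 + m2 ->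
  0 <= c1 -> 0 <= c2 -> 0 <= c3 -> 2^-1 * m4 + 2^-1 * m3 <= c1 + c2 + c3 by lra.
exact: lin h1 h2 h3 h4 k1 k2 k3.
Unshelve. all: by end_near. Qed.

End Characteristics.

End LinearWave.

(** * Limits off the characteristics *)

Section Bump.
Context {R : realType}.
Local Notation I2 := (@integral_space R (plane R)).
Local Notation cc := compactly_supported_continuous.

Lemma le_small_eq0 (x C : R) : (\forall e \near 0^'+, x <= C * e) -> x <= 0.
Proof.
move=> H; rewrite leNgt; apply/negP => x0.
have [e [e0 [he1 he2]]] : exists e : R, 0 < e /\ (x <= C * e /\ e < x / (`|C| + 1)).
  near ((0:R)^'+) => e; exists e; split; first by [].
  split; first by near: e.
  by near: e; apply: nbhs_right_lt; rewrite divr_gt0 // ltr_wpDl.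
have : x < x.
  apply: le_lt_trans he1 _; move: he2; rewrite ltr_pdivlMr ?ltr_wpDl //; apply: le_lt_trans.
  rewrite mulrC ler_wpM2l ?(ltW e0) //; apply: le_trans (ler_norm C) _; lra.
by rewrite ltxx.
Unshelve. all: by end_near. Qed.

Lemma square_bump_integral (h : plane R -> R) (d : R) : 0 < d -> cc h -> (forall z, 0 <= h z) ->
  (forall z, `|z| <= d -> h z = 1) -> 0 < I2 h.
Proof.
move=> d0 ch h0 h1.
pose g : R * R -> R := \1_(box d).
have bg : bounded_supp g d.
  split.
  - by apply: measurable_indic; exact: measurable_box.
  - by exists 1 => z; rewrite /g indicE; case: (_ \in _); rewrite ?normr1 ?normr0.
  - by move=> z hz; rewrite /g indicE memNset.
apply: (@lt_le_trans _ _ (\int[(@lebesgue_measure R \x @lebesgue_measure R)%E]_z g z)).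
  rewrite (plane_fubini (ltW d0) bg).
  have E (t : R) : - d <= t <= d -> ri (- d) d (fun x => g (x, t)) = d - - d.
    move=> ht; rewrite -[RHS]mul1r -(ri_cst (R := R)); apply: ri_eq => x hx.
    rewrite /g indicE mem_set //; split => /=; rewrite in_itv //=.
    by case: hx => // /andP[u w]; apply/andP; split; lra.
  rewrite (_ : ri _ _ _ = ri (- d) d (fun=> d - - d)).
    by rewrite ri_cst mulr_gt0 // opprK addr_gt0.
  by apply: ri_eq => t ht; apply: E; case: ht => // /andP[u w]; apply/andP; split; lra.
apply: le_Rintegral => //.
- exact: (integrable_bounded_supp bg).
- exact: plane_integrable_cc.
- move=> z _; rewrite /g indicE; have [zb|zb] := boolP (z \in box d); last exact: h0.
  by rewrite h1 //; apply/boxE; rewrite inE in zb.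
Qed.

(** The bump is made from the given cutoff: the square of its real part is smooth, nonnegative and
    one near 0, so its integral is positive; it remains to contract, translate and normalize. *)
Lemma bump_exists (k : scalar_kind) (chi : plane R -> scalar_field R k) (z0 : plane R) (r : R) :
  cutoff chi -> 0 < r -> exists h : plane R -> R,
  [/\ rsmooth h, forall z, 0 <= h z, forall z, r <= `|z - z0| -> h z = 0, cc h & I2 h = 1].
Proof.
move=> [tchi chi1] r0; pose h0 (z : plane R) := re (chi z) * re (chi z).
have s0 : rsmooth h0 by apply: rsmooth_mul; exact: smooth_re tchi.1.
have c0 : cc h0 by apply: cc_mull; [exact: test_cc_re|exact: (test_cc_re tchi).1].
have p0 z : 0 <= h0 z by rewrite /h0 -expr2 sqr_ge0.
have [d d0 Hd] := proj1 (nbhs_normE _ _) chi1.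
have I0 : 0 < I2 h0.
  apply: (@square_bump_integral h0 (d / 2)) => //; first by rewrite divr_gt0.
  move=> z hz; rewrite /h0 Hd ?re1 ?mulr1 // subr0; apply: le_lt_trans hz _.
  by rewrite ltr_pdivrMr // ltr_pMr // ltr1n.
have [_ [X X0 hX]] := c0.
(* [h0] vanishes beyond radius [X]; dilation by [s] brings this radius to [s X], which is less than
   [s (X + 1) = r]. *)
pose s := r / (X + 1).
have X1 : 0 < X + 1 by rewrite ltr_wpDl.
have sp : 0 < s by rewrite divr_gt0.
pose g (z : plane R) := s ^- 2 * h0 (s^-1 *: z).
have sg : rsmooth g.
  have := rsmooth_scale (s ^- 2) (rsmooth_affine s^-1 0 s0).
  by under eq_fun do rewrite addr0.
have gX z : r <= `|z| -> g z = 0.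
  move=> hz; rewrite /g hX ?mulr0 // normrZ gtr0_norm ?invr_gt0 // ltr_pdivlMl //.
  have E : s * (X + 1) = r by rewrite /s divfK // gt_eqF.
  by apply: lt_le_trans hz; rewrite -E ltr_pM2l // ltrDl.
have cg : cc g.
  split; first exact: rsmooth_continuous sg.
  by exists r; [exact: ltW|move=> z /ltW; exact: gX].
have Ig : I2 g = I2 h0 by have := integral_scale (@plane_calculus R) sp c0.
pose h (z : plane R) := (I2 h0)^-1 * g (z + - z0).
have cgs : cc (fun z : plane R => g (z + - z0)).
  have sgs := rsmooth_affine 1 (- z0) sg.
  split.
    by have := rsmooth_continuous sgs; under eq_fun do rewrite scale1r.
  exists (`|z0| + r); first by rewrite addr_ge0 // ltW.
  move=> z hz; apply: gX; have := ler_normD (z - z0) z0; rewrite subrK; move: hz; lra.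
exists h; split.
- have := rsmooth_scale (I2 h0)^-1 (rsmooth_affine 1 (- z0) sg).
  by under eq_fun do rewrite scale1r.
- move=> z; rewrite /h /g mulr_ge0 ?invr_ge0 ?(ltW I0) // mulr_ge0 //.
  by rewrite invr_ge0 exprn_ge0 // ltW.
- by move=> z hz; rewrite /h gX // mulr0.
- by apply: (cc_mulr (f := fun=> (I2 h0)^-1)) => //; exact: continuousT_cst.
- rewrite (integral_homog (@plane_order R)) // (integral_shift (@plane_calculus R)) // Ig.
  by rewrite mulVf // gt_eqF.
Qed.

(** Although [g] is regular on [U] only, the product is continuous everywhere: the open sets [U] and
    the complement of [C] cover the plane, and the product is zero on the latter. *)
Lemma cc_mul_local (U C : set (plane R)) (g h : plane R -> R) : open U -> closed C -> C `<=` U ->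
  (forall z, U z -> {for z, continuous g}) -> cc h -> (forall z, ~ C z -> h z = 0) ->
  cc (fun z => g z * h z).
Proof.
move=> oU cC CU cg [ch [X X0 hX]] hC; split; last by exists X => // z /hX ->; rewrite mulr0.
move=> z; have [Uz|nUz] := pselect (U z).
  by apply: (@continuousM R _ g h); [exact: cg|exact: ch].
have nC : (~` C) z by move=> /CU.
rewrite /continuous_at hC // mulr0; apply: cvg_near_cst.
have zC : nbhs z (~` C) by apply: open_nbhs_nbhs; split => //; exact: closed_openC.
by apply: filterS zC => y Cy; rewrite hC ?mulr0.
Qed.

Lemma local_average (g h : plane R -> R) (U C : set (plane R)) (z0 : plane R) (d : R) :
  open U -> closed C -> C `<=` U -> (forall z, U z -> {for z, continuous g}) ->
  cc h -> (forall z, ~ C z -> h z = 0) -> (forall z, 0 <= h z) -> I2 h = 1 ->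
  (forall z, h z != 0 -> `|g z - g z0| <= d) -> `|I2 (fun z => g z * h z) - g z0| <= d.
Proof.
move=> oU cC CU cg ch hC h0 Ih gd.
have c1 := cc_mul_local oU cC CU cg ch hC.
have c2 : cc (fun z => g z0 * h z) by apply: cc_mulr => //; exact: continuousT_cst.
rewrite -[in X in _ - X](mulr1 (g z0)) -Ih -(integral_homog (@plane_order R) (g z0) ch).
rewrite -(integral_sub (@plane_calculus R)) // -[leRHS]mulr1 -Ih.
apply: (integral_norm_le (@plane_order R)) => //; first by apply: cc_add => //; exact: cc_opp.
move=> z; rewrite -mulrBl normrM (ger0_norm (h0 z)).
have [->|hz] := eqVneq (h z) 0; first by rewrite !mulr0.
by rewrite ler_wpM2r // gd.
Qed.

End Bump.

(** * Identification of the limit with the regular part *)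

Section RegularPart.
Context {R : realType} {k : scalar_kind}.
Local Notation K := (scalar_field R k).
Local Notation I2 := (@integral_space R (plane R)).
Local Notation cc := compactly_supported_continuous.

Lemma Kintegral_cst_mul (c : K) (psi : plane R -> K) : test psi ->
  Kintegral (fun x => c * psi x) = c * Kintegral psi.
Proof.
move=> tp; have cr := test_cc_re tp; have ci := test_cc_im tp.
have [rc ic] := @continuous_scalar_cst R k (plane R) c.
have [h1 h2] := @Kintegral_mul_parts R k (plane R) (@plane_calculus R) (fun=> c) psi _ _ _ _ rc ic cr ci (fun=> conj erefl erefl) (fun=> conj erefl erefl).
apply: scalar_eq.
  rewrite [LHS]h1 reM re_Kintegral (im_Kintegral (@plane_calculus R)).
  by rewrite !(integral_homog (@plane_order R)).
rewrite [LHS]h2 imM re_Kintegral (im_Kintegral (@plane_calculus R)).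
by rewrite !(integral_homog (@plane_order R)).
Qed.

Variables phi chi : line R -> K.
Hypothesis mphi : mollifier phi.
Hypothesis cchi : cutoff chi.

Lemma represents_off_support (T : (line R -> K) -> K) (A : R -> line R -> K) (y0 : line R) :
  is_distribution T -> represents phi chi A T -> ~ dsupport T y0 ->
  exists2 r : R, 0 < r & exists2 C : R, 0 <= C &
    \forall e \near 0^'+, forall y : line R, `|y - y0| < r -> modulus (A e y) <= C * e.
Proof.
move=> dT [_ nA] ny; have [r r0 [C C0 HC]] := regularization_off_support mphi cchi dT ny.
have [D D0 HD] := nA (`|y0| + r).
exists r => //; exists (C + D); first by rewrite addr_ge0.
near=> e => y hy.
have e0 : 0 < e by [].
have h1 := HC e y e0 hy.
have h2 : modulus (A e y - regularization phi chi T e y) <= D * e.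
  have H : forall x : line R, `|x| <= `|y0| + r ->
    modulus (A e x - regularization phi chi T e x) <= D * e by near: e.
  apply: H; rewrite -[y](subrK y0) addrC; apply: le_trans (ler_normD _ _) _.
  by rewrite lerD2l ltW.
rewrite -[A e y](subrK (regularization phi chi T e y)) mulrDl addrC.
by apply: le_trans (modulusD _ _) _; exact: lerD.
Unshelve. all: by end_near. Qed.

(** The two integrals of [B] differ by integrals over the short intervals between the feet of the
    characteristics through [z] and [z0], where [B] is at most [d]; between the feet [B] may be
    arbitrarily large. The four values of [A] contribute [2 d], the two short integrals [r d], after
    the factor one half. A foot moves by at most the sum of the coordinate differences, hence the
    radius [r / 2]. *)
Lemma rdalembert_near (A B : R -> R) (z z0 : R * R) (r d : R) : continuous B -> 0 <= d ->
  `|z - z0| < r / 2 ->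
  (forall y, `|y - (z0.1 - z0.2)| < r -> `|A y| <= d /\ `|B y| <= d) ->
  (forall y, `|y - (z0.1 + z0.2)| < r -> `|A y| <= d /\ `|B y| <= d) ->
  `|rdalembert A B z - rdalembert A B z0| <= (2 + r) * d.
Proof.
case: z => x t; case: z0 => x0 t0 cB d0 hz H1 H2 /=; rewrite /= in H1 H2.
have := hz; rewrite -[_ - _]/(x - x0, t - t0) prod_normE /= gt_max => /andP[hx ht].
have r0 : 0 < r.
  by have := le_lt_trans (normr_ge0 _) hx; rewrite pmulr_lgt0.
have rh : r = r / 2 + r / 2 by rewrite -splitr.
have k1 : `|x - t - (x0 - t0)| < r.
  rewrite (_ : _ - _ = (x - x0) - (t - t0)); last by ring.
  by rewrite rh; apply: le_lt_trans (ler_normB _ _) _; exact: ltrD.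
have k2 : `|x + t - (x0 + t0)| < r.
  rewrite (_ : _ - _ = (x - x0) + (t - t0)); last by ring.
  by rewrite rh; apply: le_lt_trans (ler_normD _ _) _; exact: ltrD.
have z1 (c : R) : `|c - c| < r by rewrite subrr normr0.
have bt (p0 p : R) : (forall y, `|y - p0| < r -> `|A y| <= d /\ `|B y| <= d) -> `|p - p0| < r ->
   `|ri p0 p B| <= d * r.
  move=> H hp; apply: (@le_trans _ _ (d * `|p - p0|)); last by rewrite ler_wpM2l // ltW.
  by apply: ri_le => // y hy; apply: (H y _).2; apply: le_lt_trans hp; exact: between_dist.
have a1 := (H1 _ k1).1; have a2 := (H2 _ k2).1.
have a3 := (H1 _ (z1 _)).1; have a4 := (H2 _ (z1 _)).1.
have b1 := bt _ _ H1 k1; have b2 := bt _ _ H2 k2.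
rewrite /rdalembert /=.
have -> : ri (x - t) (x + t) B = ri (x0 - t0) (x0 + t0) B + ri (x0 + t0) (x + t) B - ri (x0 - t0) (x - t) B.
  rewrite (ri_chasles (x0 - t0) (x0 - t0) (x0 + t0) cB) rixx add0r.
  rewrite -(ri_chasles (x0 - t0) (x0 + t0) (x + t) cB).
  by rewrite (ri_chasles (x0 - t0) (x - t) (x + t) cB) addrAC subrr add0r.
move: a1 a2 a3 a4 b1 b2; move: (A _) (A _) (A _) (A _) (ri (x0 - t0) (x - t) B) (ri (x0 + t0) (x + t) B) (ri _ _ B).
move=> A1 A2 A3 A4 B1 B2 B3; rewrite !ler_norml => /andP[] ? ? /andP[] ? ? /andP[] ? ? /andP[] ? ? /andP[] ? ? /andP[] ? ?.
by apply/andP; split; lra.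
Qed.

Variables a b : (line R -> K) -> K.
Hypotheses (da : is_distribution a) (db : is_distribution b).
Variables A B : R -> line R -> K.
Hypotheses (rA : represents phi chi A a) (rB : represents phi chi B b).

Definition characteristics : set (plane R) := [set z |
  (dsupport a `|` dsupport b) (z.1 - z.2) \/ (dsupport a `|` dsupport b) (z.1 + z.2)].

Let V e := dalembert_fun (A e) (B e).

Lemma dalembert_fun_near (z0 : plane R) : ~ characteristics z0 ->
  exists2 r : R, 0 < r & exists2 C : R, 0 <= C &
    \forall e \near 0^'+, forall z : plane R, `|z - z0| < r -> modulus (V e z - V e z0) <= C * e.
Proof.
move=> /not_orP[/not_orP[na1 nb1] /not_orP[na2 nb2]].
have [r1 r10 [C1 C10 H1]] := represents_off_support da rA na1.
have [r2 r20 [C2 C20 H2]] := represents_off_support da rA na2.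
have [r3 r30 [C3 C30 H3]] := represents_off_support db rB nb1.
have [r4 r40 [C4 C40 H4]] := represents_off_support db rB nb2.
pose r := Num.min (Num.min r1 r2) (Num.min r3 r4).
have r0 : 0 < r by rewrite !lt_min r10 r20 r30 r40.
pose C := C1 + C2 + C3 + C4.
have [CC1 CC2 CC3 CC4] : [/\ C1 <= C, C2 <= C, C3 <= C & C4 <= C].
  by rewrite /C; split; lra.
exists (r / 2); first by rewrite divr_gt0.
exists ((2 + r) * C + (2 + r) * C).
  by rewrite addr_ge0 // mulr_ge0 ?addr_ge0 // ltW.
near=> e => z hz.
have e0 : 0 < e by [].
have cA : continuous_scalar (A e) by near: e; exact: rA.1.
have cB : continuous_scalar (B e) by near: e; exact: rB.1.
have HC i : i <= C -> i * e <= C * e by move=> ?; rewrite ler_wpM2r // ltW.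
have G1 : forall y : line R, `|y - (z0.1 - z0.2)| < r1 -> modulus (A e y) <= C1 * e by near: e.
have G2 : forall y : line R, `|y - (z0.1 + z0.2)| < r2 -> modulus (A e y) <= C2 * e by near: e.
have G3 : forall y : line R, `|y - (z0.1 - z0.2)| < r3 -> modulus (B e y) <= C3 * e by near: e.
have G4 : forall y : line R, `|y - (z0.1 + z0.2)| < r4 -> modulus (B e y) <= C4 * e by near: e.
have K1 (y : R) : `|y - (z0.1 - z0.2)| < r -> modulus (A e y) <= C * e /\ modulus (B e y) <= C * e.
  rewrite !lt_min => /andP[/andP[u1 u2] /andP[u3 u4]]; split.
    exact: le_trans (G1 y u1) (HC _ CC1).
  exact: le_trans (G3 y u3) (HC _ CC3).
have K2 (y : R) : `|y - (z0.1 + z0.2)| < r -> modulus (A e y) <= C * e /\ modulus (B e y) <= C * e.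
  rewrite !lt_min => /andP[/andP[u1 u2] /andP[u3 u4]]; split.
    exact: le_trans (G2 y u2) (HC _ CC2).
  exact: le_trans (G4 y u4) (HC _ CC4).
have C0 : 0 <= C * e by rewrite mulr_ge0 ?(ltW e0) // /C; lra.
apply: le_trans (modulus_le _) _; rewrite reB imB /V !re_dalembert_fun !im_dalembert_fun mulrDl -!mulrA.
apply: lerD; apply: rdalembert_near => //.
- exact: cB.1.
- by move=> y /K1[u1 u2]; split; apply: le_trans (re_le_modulus _) _.
- by move=> y /K2[u1 u2]; split; apply: le_trans (re_le_modulus _) _.
- exact: cB.2.
- by move=> y /K1[u1 u2]; split; apply: le_trans (im_le_modulus _) _.
- by move=> y /K2[u1 u2]; split; apply: le_trans (im_le_modulus _) _.
Unshelve. all: by end_near. Qed.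

Variable v : (plane R -> K) -> K.
Hypothesis lv : linear_solution a b v.
Variable chi2 : plane R -> K.
Hypothesis cchi2 : cutoff chi2.

Let vconv psi : test psi -> exists2 C : R, 0 <= C & \forall e \near 0^'+,
  modulus (Kintegral (fun z : plane R => V e z * psi z) - v psi) <= C * e.
Proof. by move=> tp; rewrite (lv.2 _ tp); exact: (dalembert_fun_converges tp mphi cchi da db rA rB). Qed.

Let Vcont : \forall e \near 0^'+, @continuous_scalar R (plane R) k (V e).
Proof.
near=> e; apply: dalembert_fun_continuous; near: e; [exact: rA.1|exact: rB.1].
Unshelve. all: by end_near. Qed.

Lemma real_test (h : plane R -> R) : rsmooth h -> cc h -> test (fun z => of_real k (h z)).
Proof.
move=> sh [_ [X X0 hX]].
apply: (@smooth_bounded_test R k (plane R) (@plane_calculus R) _ X).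
  apply: (smooth_of_re_im sh (rsmooth_cst (0 : R))) => z; [exact: re_of_real|exact: im_of_real].
by move=> z /hX h0; apply: scalar_eq; rewrite ?re_of_real ?im_of_real ?re0 ?im0.
Qed.

Lemma Kintegral_of_real (h : plane R -> R) : I2 h = 1 -> Kintegral (fun z => of_real k (h z)) = 1.
Proof.
move=> Ih; apply: scalar_eq.
  by rewrite re_Kintegral re1 -Ih; congr I2; apply/funext => z; rewrite re_of_real.
rewrite (im_Kintegral (@plane_calculus R)) im1 -[RHS](integral_space0 (@plane_calculus R)).
by congr I2; apply/funext => z; rewrite im_of_real.
Qed.

(* The oscillation of [V e] around [z0] is [O(e)] and its averages converge,
   hence so does [V e] itself, to a constant. *)
Lemma dalembert_fun_limit (z0 : plane R) : ~ characteristics z0 ->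
  exists2 r : R, 0 < r & exists c : K, exists2 C : R, 0 <= C &
    \forall e \near 0^'+, forall z : plane R, `|z - z0| < r -> modulus (V e z - c) <= C * e.
Proof.
move=> nz; have [r r0 [C C0 HC]] := dalembert_fun_near nz.
have [h [sh h0 hr ch Ih]] := bump_exists z0 cchi2 r0.
pose eta (z : plane R) := of_real k (h z).
have te : test eta by exact: real_test.
have Ie : Kintegral eta = 1 by exact: Kintegral_of_real.
have [D D0 HD] := vconv te.
have [M M0 HM] := Kintegral_small (@plane_calculus R) (@plane_order R) te.
(* The limit is the pairing of [v] with a bump [eta] of integral one. [V e z - v eta] is the average
   of [V e z - V e y] over [eta] plus the pairing error; [C + C] appears because [z] and [y] are
   both compared with [z0]. *)
exists r => //; exists (v eta), (M * (C + C) + D); first by rewrite !addr_ge0 // mulr_ge0 // addr_ge0.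
near=> e => z hz.
have e0 : 0 < e by [].
have cV : @continuous_scalar R (plane R) k (V e) by near: e; exact: Vcont.
have HCe : forall z : plane R, `|z - z0| < r -> modulus (V e z - V e z0) <= C * e by near: e.
have HDe : modulus (Kintegral (fun z : plane R => V e z * eta z) - v eta) <= D * e by near: e.
have cz := @continuous_scalar_cst R k (plane R) (V e z).
have E : V e z - v eta = Kintegral (fun y : plane R => (V e z - V e y) * eta y) +
    (Kintegral (fun y : plane R => V e y * eta y) - v eta).
  rewrite (Kintegral_mulB (@plane_calculus R) cz cV te).
  by rewrite Kintegral_cst_mul // Ie mulr1 addrA subrK.
rewrite E mulrDl; apply: le_trans (modulusD _ _) _; apply: lerD => //.
rewrite -mulrA; apply: HM.
- exact: continuous_scalar_sub cz cV.
- by rewrite mulr_ge0 ?(ltW e0) // addr_ge0.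
move=> y hy; have yr : `|y - z0| < r.
  rewrite ltNge; apply: contra hy => /hr hy; apply/eqP.
  by apply: scalar_eq; rewrite ?re_of_real ?im_of_real ?re0 ?im0.
rewrite (_ : V e z - V e y = (V e z - V e z0) + - (V e y - V e z0)); last by ring.
rewrite mulrDl; apply: le_trans (modulusD _ _) _; rewrite modulusN.
by apply: lerD; exact: HCe.
Unshelve. all: by end_near. Qed.

Lemma modulus0_eq (x : K) : modulus x <= 0 -> x = 0.
Proof.
move=> x0; have r0 := le_trans (re_le_modulus x) x0; have i0 := le_trans (im_le_modulus x) x0.
by apply: scalar_eq; rewrite ?re0 ?im0; apply/normr0_eq0/eqP; rewrite eq_le normr_ge0 andbT.
Qed.

Lemma open_ball_plane (z0 : plane R) (r : R) : open [set z : plane R | `|z - z0| < r].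
Proof.
have cn : continuous (fun z : plane R => `|z - z0|).
  by move=> z; apply: cvg_norm; apply: cvgB; [exact: cvg_id|exact: cvg_cst].
by apply: (open_comp (f := fun z : plane R => `|z - z0|) (D := [set x | x < r])); [move=> z _; exact: cn|exact: open_lt].
Qed.

Variable vreg : plane R -> K.
Hypothesis rv : regular_part v vreg.

(** On a disc around [z0] the functions [V e] tend uniformly to a constant [c], so [v] equals [c]
    there and the disc misses the singular support. Hence [vreg] has the same pairings as [c] on the
    disc; being continuous there, it takes the value [c] at [z0]. *)
Lemma dalembert_fun_regular_part (z0 : plane R) : ~ characteristics z0 ->
  [/\ ~ singular_support v z0 & exists2 C : R, 0 <= C &
    \forall e \near 0^'+, modulus (V e z0 - vreg z0) <= C * e].
Proof.
move=> nz; have [r r0 [c [C C0 HC]]] := dalembert_fun_limit nz.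
pose U := [set z : plane R | `|z - z0| < r].
have oU : open U by exact: open_ball_plane.
have zU : U z0 by rewrite /U /= subrr normr0.
have eqU psi : test_in U psi -> v psi = of_function (fun=> c) psi.
  move=> [sp [Cs [cCs CsU sCs]]].
  have tp : test psi by apply: (test_supported sp cCs sCs).
  have [D D0 HD] := vconv tp.
  have [M M0 HM] := Kintegral_small (@plane_calculus R) (@plane_order R) tp.
  apply/eqP; rewrite -subr_eq0; apply/eqP; apply: modulus0_eq.
  apply: (@le_small_eq0 _ _ (D + M * C)); near=> e.
  have e0 : 0 < e by [].
  have cV : @continuous_scalar R (plane R) k (V e) by near: e; exact: Vcont.
  have HDe : modulus (Kintegral (fun z : plane R => V e z * psi z) - v psi) <= D * e by near: e.
  have HCe : forall z : plane R, `|z - z0| < r -> modulus (V e z - c) <= C * e by near: e.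
  rewrite (_ : v psi - _ = - (Kintegral (fun z : plane R => V e z * psi z) - v psi) +
     (Kintegral (fun z : plane R => V e z * psi z) - of_function (fun=> c) psi)); last by ring.
  rewrite mulrDl; apply: le_trans (modulusD _ _) _; rewrite modulusN; apply: lerD => //.
  rewrite /of_function -(Kintegral_mulB (@plane_calculus R)) //; last exact: continuous_scalar_cst.
  rewrite -mulrA; apply: HM.
  - by apply: continuous_scalar_sub => //; exact: continuous_scalar_cst.
  - by rewrite mulr_ge0 // ltW.
  - move=> y hy; apply: HCe; apply: CsU; have [//|ny] := pselect (Cs y).
    by rewrite (sCs y ny) eqxx in hy.
have Ureg z : U z -> ~ singular_support v z.
  move=> Uz sz; apply: sz; exists U, (fun=> c); split => //.
  by have [h1 h2] := @smooth_cst R k (plane R) c; split=> l x _; [exact: h1|exact: h2].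
split; first exact: Ureg.
have [_ [sr si] eqr] := rv.
have cl (g : plane R -> R) : rsmooth_on (~` singular_support v) g -> forall z, U z -> {for z, continuous g}.
  by move=> sg z /Ureg nSz; have [] := sg [::] z nSz.
(* If [g z0] differed from [c'] by [d > 0], a bump supported where [g] varies by less than [d / 2]
   would have an average both equal to [c'] and within [d / 2] of [g z0], giving [d <= d / 2]. *)
have key (g : plane R -> R) (c' : R) : rsmooth_on (~` singular_support v) g ->
    (forall h : plane R -> R, rsmooth h -> cc h -> (forall z, r / 2 <= `|z - z0| -> h z = 0) -> I2 h = 1 ->
      I2 (fun z => g z * h z) = c') -> g z0 = c'.
  move=> sg gh; apply/eqP; rewrite -subr_eq0 -normr_eq0 eq_le normr_ge0 andbT leNgt; apply/negP => d0.
  set d := `|_| in d0.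
  have [s s0 Hs] := proj1 (nbhs_normE _ _) (proj1 (cvgrPdist_lt _ _) (cl g sg z0 zU) (d / 2) (divr_gt0 d0 (ltr0n _ 2))).
  have m0 : 0 < Num.min s (r / 2) by rewrite lt_min s0 divr_gt0.
  have [h [sh h0 hr ch Ih]] := bump_exists z0 cchi2 m0.
  have hr2 z : r / 2 <= `|z - z0| -> h z = 0 by move=> hz; apply: hr; apply: le_trans hz; rewrite ge_min lexx orbT.
  have cC : closed [set z : plane R | `|z - z0| <= r / 2].
    have cn : continuous (fun z : plane R => `|z - z0|).
      by move=> z; apply: cvg_norm; apply: cvgB; [exact: cvg_id|exact: cvg_cst].
    by apply: (closed_comp (f := fun z : plane R => `|z - z0|) (D := [set x | x <= r / 2])); [move=> z _; exact: cn|exact: closed_le].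
  have := @local_average R g h U _ z0 (d / 2) oU cC _ (cl g sg) ch _ h0 Ih _.
  rewrite (gh h sh ch hr2 Ih) distrC -/d => H.
  have : d <= d / 2.
    apply: H.
    - by move=> z /= hz; apply: le_lt_trans hz _; rewrite ltr_pdivrMr // ltr_pMr // ltr1n.
    - by move=> z /= /negP; rewrite -ltNge => /ltW; exact: hr2.
    - move=> z hz; rewrite distrC; apply/ltW/Hs; rewrite ltNge; apply: contra hz => hz.
      by apply/eqP/hr; apply: le_trans hz; rewrite ge_min lexx.
  lra.
have eqh (h : plane R -> R) : rsmooth h -> cc h -> (forall z, r / 2 <= `|z - z0| -> h z = 0) -> I2 h = 1 ->
   Kintegral (fun z => vreg z * of_real k (h z)) = c.
  move=> sh ch hr Ih; have te := real_test sh ch.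
  have tU : test_in U (fun z => of_real k (h z)).
    split; first exact: te.1.
    have [_ [Cs [cCs _ sCs]]] := te.
    exists (Cs `&` [set z : plane R | `|z - z0| <= r / 2]); split.
    - apply: compact_closedI => //.
      have cn : continuous (fun z : plane R => `|z - z0|).
        by move=> z; apply: cvg_norm; apply: cvgB; [exact: cvg_id|exact: cvg_cst].
      by apply: (closed_comp (f := fun z : plane R => `|z - z0|) (D := [set x | x <= r / 2])); [move=> z _; exact: cn|exact: closed_le].
    - move=> z /= [_ hz]; rewrite /U /=; apply: le_lt_trans hz _; by rewrite ltr_pdivrMr // ltr_pMr // ltr1n.
    - move=> z /not_andP[/sCs //|/= /negP]; rewrite -ltNge => /ltW/hr ->.
      by apply: scalar_eq; rewrite ?re_of_real ?im_of_real ?re0 ?im0.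
  have tS : test_in (~` singular_support v) (fun z => of_real k (h z)).
    have [s1 [Cs [c1 c2 c3]]] := tU; split=> //; exists Cs; split => // z /c2; exact: Ureg.
  have := eqU _ tU; rewrite (eqr _ tS) /of_function => ->.
  by rewrite Kintegral_cst_mul // Kintegral_of_real // mulr1.
have -> : vreg z0 = c.
  apply: scalar_eq.
    apply: (key (@re R k \o vreg)) => // h sh ch hr Ih; rewrite -(eqh h sh ch hr Ih) re_Kintegral.
    by congr I2; apply/funext => z; rewrite reM re_of_real im_of_real mulr0 subr0.
  apply: (key (@im R k \o vreg)) => // h sh ch hr Ih; rewrite -(eqh h sh ch hr Ih) (im_Kintegral (@plane_calculus R)).
  by congr I2; apply/funext => z; rewrite imM re_of_real im_of_real mulr0 add0r.
exists C => //; near=> e.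
have HCe : forall z : plane R, `|z - z0| < r -> modulus (V e z - c) <= C * e by near: e.
exact: HCe.
Unshelve. all: by end_near. Qed.

End RegularPart.

(** * Integrals over domains of dependence *)

Section PlaneSets.
Context {R : realType}.
Local Notation mR := (measurableTypeR R).
Local Notation M := ((@lebesgue_measure R) \x (@lebesgue_measure R))%E.

Lemma countable_setU (T : Type) (A B : set T) : countable A -> countable B -> countable (A `|` B).
Proof.
move=> cA cB; have -> : A `|` B = \bigcup_(b in [set: bool]) (if b then A else B).
  by apply/seteqP; split=> [t [ht|ht]|t [[] _ ht]]; [exists true|exists false|left|right].
by apply: bigcup_countable => [|[] _] //; exact: countableP.
Qed.

(** For fixed x the section consists of the points [x - n] and [n - x] with n in [N], a countable
    set; the product measure integrates the measures of the sections. *)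
Lemma countable_characteristics_null (N : set R) : countable N ->
  let L : set (mR * mR) := [set z | N (z.1 - z.2) \/ N (z.1 + z.2)] in
  measurable L /\ M L = 0%E.
Proof.
move=> cN L.
have mN : measurable (N : set mR) by apply: countable_measurable => // t; exact: measurable_set1.
have mL : measurable L.
  have -> : L = ((fun z : mR * mR => z.1 - z.2) @^-1` N) `|` ((fun z : mR * mR => z.1 + z.2) @^-1` N).
    by apply/seteqP; split.
  have c1 : continuous (fun z : R * R => z.1 - z.2) by cont.
  have c2 : continuous (fun z : R * R => z.1 + z.2) by cont.
  apply: measurableU; rewrite -[X in measurable X]setTI.
    exact: (continuous_measurable_plane c1 measurableT mN).
  exact: (continuous_measurable_plane c2 measurableT mN).
split => //.
rewrite /product_measure1 /=; apply: integral0_eq => x _ /=.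
apply: countable_lebesgue_measure0.
have H : xsection L x `<=` ((fun n => x - n) @` N) `|` ((fun n => n - x) @` N).
  move=> t; rewrite /xsection /= inE => -[h|h]; [left|right]; eexists; try exact: h.
    by rewrite /=; ring.
  by rewrite /=; ring.
apply: sub_countable (subset_card_le H) _.
by apply: countable_setU; exact: sub_countable (card_image_le _ _) cN.
Qed.

(** Fits the parts of [vreg], which are continuous off the closed singular support and zero on
    it. *)
Lemma measurable_open_continuous (O : set (R * R)) (g : R * R -> R) : open O ->
  (forall z, O z -> {for z, continuous g}) -> (forall z, ~ O z -> g z = 0) ->
  measurable_fun setT (g : mR * mR -> R).
Proof.
move=> oO cg g0; apply: (measurability _ (RGenOpens.measurableE R)).
move=> _ [_ [a [b ->] <-]]; rewrite setTI.
set J := `]a, b[%classic.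
have -> : g @^-1` J = (O `&` g @^-1` J) `|` (~` O `&` [set _ | J 0]).
  apply/seteqP; split=> z /=.
    by move=> Jz; have [Oz|nOz] := pselect (O z); [left|right; rewrite g0 in Jz].
  by case=> [[]//|[nO J0]]; rewrite g0.
apply: measurableU.
  apply: open_measurable_plane; rewrite openE => z [Oz Jz].
  apply: filterI; first exact: open_nbhs_nbhs.
  by apply: (cg z Oz); apply: open_nbhs_nbhs; split=> //; exact: interval_open.
apply: measurableI; first by apply: measurableC; exact: open_measurable_plane.
have [J0|nJ0] := pselect (J 0).
  by rewrite (_ : [set _ | J 0] = setT) //; apply/seteqP; split.
by rewrite (_ : [set _ | J 0] = set0) //; apply/seteqP; split.
Qed.

Lemma near_eq_cvg_at_right (f g : R -> R) (l : R) : (\forall e \near 0^'+, f e = g e) ->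
  f e @[e --> 0^'+] --> l -> g e @[e --> 0^'+] --> l.
Proof.
move=> fg /cvgrPdist_lt fl; apply/cvgrPdist_lt => d d0; near=> e.
have <- : f e = g e by near: e.
by near: e; exact: fl.
Unshelve. all: by end_near. Qed.

Lemma box_dominated (F : R -> R * R -> R) (X B : R) (N : set (mR * mR)) :
  (\forall e \near 0^'+, measurable_fun setT (F e : mR * mR -> R)) ->
  (forall e z, `|F e z| <= B) -> measurable N -> M N = 0%E ->
  (forall z, ~ N z -> F e z @[e --> 0^'+] --> 0) ->
  \int[M]_(z in box X) F e z @[e --> 0^'+] --> (0 : R).
Proof.
move=> mF FB mN N0 F0.
(* [F e] is measurable for small [e] only. Replacing it by zero elsewhere changes no limit and makes
   every member of a sequence admissible in the dominated convergence theorem. *)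
pose G e z := if `[< measurable_fun setT (F e : mR * mR -> R) >] then F e z else 0.
have FG : \forall e \near 0^'+, F e = G e.
  by near=> e; apply/funext => z; rewrite /G asboolT //; near: e.
have mG e : measurable_fun setT (G e : mR * mR -> R).
  by rewrite /G; case: asboolP => // _; exact: measurable_cst.
have B0 : 0 <= B by apply: le_trans (FB 0 (0, 0)).
have GB e z : `|G e z| <= B by rewrite /G; case: asboolP => // _; rewrite normr0.
have G0 z : ~ N z -> G e z @[e --> 0^'+] --> 0.
  by move=> /F0; apply: near_eq_cvg_at_right; near=> e; have -> : F e = G e by near: e.
suff : \int[M]_(z in box X) G e z @[e --> 0^'+] --> (0 : R).
  by apply: near_eq_cvg_at_right; near=> e; have -> : F e = G e by near: e.
apply/cvg_at_rightP => u [u0 ucv].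
have mX := @measurable_box R X.
have ig : M.-integrable (box X) (cst B%:E).
  apply: (@measurable_bounded_integrable _ _ _ _ (cst B)) => //.
  - exact: box_finite.
  - by exists B; split; [exact: num_real|move=> y By z _ /=; rewrite ger0_norm // ltW].
have [] := @dominated_convergence _ _ _ M (box X) mX (fun n z => (G (u n) z)%:E) (cst 0%E) (cst B%:E).
- by move=> n; apply/measurable_EFinP; apply: measurable_funTS.
- exact: measurable_cst.
- exists N; split => // z /=; apply: contra_notP => nN zX.
  apply: cvg_EFin; first exact: nearW.
  by have /cvg_at_rightP := G0 z nN; apply.
- exact: ig.
- by apply: nearW => z n _ /=; rewrite lee_fin.
move=> _ _; rewrite integral0 => h.
exact: (@fine_cvg R nat _ _ _ 0 h).
Unshelve. all: by end_near. Qed.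

(* The domain of dependence between times [0] and [z.2]. *)
Definition cone_region (z : R * R) : set (mR * mR) :=
  [set p | Num.min 0 z.2 <= p.2 <= Num.max 0 z.2 /\ `|p.1 - z.1| <= `|z.2 - p.2|].

Lemma measurable_cone_region z : measurable (cone_region z).
Proof.
have cl (h : R * R -> R) : continuous h -> measurable ([set p | h p <= 0] : set (mR * mR)).
  move=> ch; rewrite -[X in measurable X]setTI.
  have -> : [set p | h p <= 0] = h @^-1` `]-oo, 0]%classic by apply/seteqP; split=> p /=; rewrite in_itv.
  by apply: (continuous_measurable_plane ch measurableT); exact: measurable_itv.
have c1 : continuous (fun p : R * R => Num.min 0 z.2 - p.2) by cont.
have c2 : continuous (fun p : R * R => p.2 - Num.max 0 z.2) by cont.
have n1 : continuous (fun p : R * R => p.1 - z.1) by cont.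
have n2 : continuous (fun p : R * R => z.2 - p.2) by cont.
have c3 := continuousT_add (continuousT_norm n1) (continuousT_opp (continuousT_norm n2)).
have -> : cone_region z = [set p | Num.min 0 z.2 - p.2 <= 0] `&` [set p | p.2 - Num.max 0 z.2 <= 0] `&`
    [set p | `|p.1 - z.1| - `|z.2 - p.2| <= 0].
  apply/seteqP; split=> p /=; rewrite !subr_le0 => -[].
    by move=> /andP[h1 h2] h3.
  by move=> [h1 h2] h3; split=> //; apply/andP.
by apply: measurableI; [apply: measurableI|]; exact: cl.
Qed.

(** For [p] in the domain of dependence, [|z.2 - p.2| + |p.2| = |z.2|] while the first coordinate
    moves by at most [|z.2 - p.2|]. Hence the diamond [|x| + |t| <= X] contains the domains of
    dependence of its points, which is why the estimates below are stated on diamonds and not on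
    squares. *)
Lemma cone_region_box z p (X : R) : `|z.1| + `|z.2| <= X -> cone_region z p ->
  `|p.1| + `|p.2| <= X /\ box X p.
Proof.
case: z => x t; case: p => y s /= zX [/= hs hy].
have H : `|y| + `|s| <= X.
  have hst : `|t - s| + `|s| = `|t|.
    move: hs; case: (leP 0 t) => t0 /andP[s1 s2].
      by rewrite !ger0_norm ?subr_ge0 // subrK.
    rewrite !ler0_norm ?subr_le0 //; [by ring|exact: ltW].
  have := ler_normD (y - x) x; rewrite subrK; lra.
split => //; apply/boxE; rewrite plane_norm_le.
have y0 := normr_ge0 y; have s0 := normr_ge0 s; have lin (a b : R) : 0 <= b -> a + b <= X -> a <= X by lra.
by apply/andP; split; [exact: lin H|move: H; rewrite addrC; exact: lin].
Qed.

Definition bounded_on_box (X : R) (g : R * R -> R) : Prop :=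
  measurable_fun setT (g : mR * mR -> R) /\ exists B : R, forall z, box X z -> `|g z| <= B.

Lemma cone_restrict g z (X : R) : `|z.1| + `|z.2| <= X -> bounded_on_box X g ->
  bounded_supp (g \_ (cone_region z)) X.
Proof.
move=> zX [mg [B gB]]; split.
- apply/(measurable_restrictT _ (measurable_cone_region z)).
  exact: measurable_funTS.
- exists `|B| => p; rewrite patchE; case: ifPn; last by rewrite normr0.
  rewrite inE => /(cone_region_box zX)[_ /gB pB]; exact: le_trans pB (ler_norm _).
- by move=> p npX; rewrite patchE; case: ifPn => //; rewrite inE => /(cone_region_box zX)[].
Qed.

Lemma Rintegral_segment (h : R -> R) (a b : R) : a <= b -> (forall x, ~ (a <= x <= b) -> h x = 0) ->
  ri a b h = \int[mu]_x h x.
Proof.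
move=> ab h0; rewrite /rinterval_integral ab Rintegral_mkcond; congr (Rintegral _ _ _).
apply/funext => x; rewrite patchE; case: ifPn => //; rewrite notin_setE /= in_itv /= => /h0 ->.
by [].
Qed.

Lemma ri_restrict (h g : R -> R) (a b : R) : a <= b -> (forall x, a <= x <= b -> h x = g x) ->
  (forall x, ~ (a <= x <= b) -> h x = 0) -> ri a b g = \int[mu]_x h x.
Proof.
move=> ab hg h0; rewrite -(Rintegral_segment ab h0); apply: ri_eq => x [/hg -> //|/andP[bx xa]].
by rewrite hg //; apply/andP; split; lra.
Qed.

(** Converts the iterated integral into an integral over the plane, so that linearity and
    monotonicity become available for integrands that are merely bounded and measurable. For
    [z.2 < 0] the outer and the inner orientation both change sign. *)
Lemma cone_integral g z (X : R) : `|z.1| + `|z.2| <= X -> bounded_on_box X g ->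
  rcone g z = 2^-1 * \int[M]_p (g \_ (cone_region z)) p.
Proof.
move=> zX bg; have bh := cone_restrict zX bg; congr (_ * _).
have X0 : 0 <= X by apply: le_trans zX; rewrite addr_ge0.
have I0 : \int[mu]_x (0 : R) = 0 := integral_space0 (@line_calculus R).
set h := g \_ (cone_region z) in bh *.
have ih s : mu.-integrable setT (EFin \o (fun y => h (y, s))).
  have [mh [B hB] _] := bh.
  apply: (@integrable_bounded_supp1 R _ X B) => //; first exact: section_measurable.
  by move=> y ny; exact: section_supp bh ny.
have E (G : R * R -> R) : bounded_supp G X ->
    \int[M]_p G p = \int[mu]_s \int[mu]_y G (y, s).
  move=> bG; rewrite (plane_fubini X0 bG) -(Rintegral_supp X0); last first.
    move=> s ns; rewrite -[RHS](ri0 (R := R) (- X) X); congr ri; apply/funext => y.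
    exact: section_supp2 bG ns.
  congr (Rintegral _ _ _); apply/funext => s; rewrite -(Rintegral_supp X0) // => y ny.
  exact: section_supp bG ny.
have hin y s : cone_region z (y, s) -> h (y, s) = g (y, s) by move=> d; rewrite /h patchE mem_set.
have hout y s : ~ cone_region z (y, s) -> h (y, s) = 0.
  by move=> d; rewrite /h patchE memNset.
case: z zX h bh ih hin hout => x t zX h bh ih hin hout /=.
have [t0|t0] := leP 0 t.
  rewrite (E _ bh).
  apply: ri_restrict => // s.
    move=> /andP[s0 st]; apply/esym/ri_restrict; first by lra.
      move=> y hy; apply: hin; split=> /=; first by rewrite min_l // max_r // s0.
      by rewrite (ger0_norm (x := t - s)) ?subr_ge0 // ler_norml; lra.
    move=> y ny; apply: hout => -[/= _]; rewrite (ger0_norm (x := t - s)) ?subr_ge0 // ler_norml => hy.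
    by apply: ny; lra.
  move=> ns; rewrite -[RHS]I0; congr (Rintegral _ _ _); apply/funext => y.
  by apply: hout => -[/=]; rewrite min_l // max_r.
have bN : bounded_supp (fun p => -1 * h p) X.
  have [mh [B hB] hX] := bh; split.
  - by apply: measurable_funM => //; exact: measurable_cst.
  - by exists B => p; rewrite mulN1r normrN.
  - by move=> p /hX ->; rewrite mulr0.
rewrite ri_oppC -[RHS]opprK; congr (- _); rewrite -[RHS]mulN1r.
rewrite -(RintegralZl _ _ (integrable_bounded_supp bh)) // (E _ bN).
have t0' := ltW t0.
apply: ri_restrict => // s.
  move=> /andP[s0 st]; rewrite ri_oppC RintegralZl // mulN1r; congr (- _).
  apply/esym/ri_restrict; first by lra.
    move=> y hy; apply: hin; split=> /=; first by rewrite min_r // max_l // s0.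
    by rewrite (ler0_norm (x := t - s)) ?subr_le0 // ler_norml; lra.
  move=> y ny; apply: hout => -[/= _]; rewrite (ler0_norm (x := t - s)) ?subr_le0 // ler_norml => hy.
  by apply: ny; lra.
move=> ns; rewrite -[RHS]I0; congr (Rintegral _ _ _); apply/funext => y.
by rewrite hout ?mulr0 // => -[/=]; rewrite min_r // max_l.
Qed.

Lemma bounded_on_box_sub g1 g2 X : bounded_on_box X g1 -> bounded_on_box X g2 ->
  bounded_on_box X (fun p => g1 p - g2 p).
Proof.
move=> [m1 [B1 H1]] [m2 [B2 H2]]; split; first exact: measurable_funB.
exists (B1 + B2) => z zX; apply: le_trans (ler_normB _ _) _.
by apply: lerD; [exact: H1|exact: H2].
Qed.

Lemma bounded_on_box_continuous (g : R * R -> R) X : continuous g -> bounded_on_box X g.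
Proof.
move=> cg; split; first exact: continuous_measurable_plane.
by have [B _ HB] := @continuous_bounded_on R (plane R) g _ cg (@compact_box R X); exists B.
Qed.

Lemma cone_sub g1 g2 z X : `|z.1| + `|z.2| <= X -> bounded_on_box X g1 -> bounded_on_box X g2 ->
  rcone g1 z - rcone g2 z = rcone (fun p => g1 p - g2 p) z.
Proof.
move=> zX b1 b2; have b3 := bounded_on_box_sub b1 b2.
rewrite (cone_integral zX b1) (cone_integral zX b2) (cone_integral zX b3) -mulrBr; congr (_ * _).
rewrite -(RintegralB measurableT (integrable_bounded_supp (cone_restrict zX b1))
  (integrable_bounded_supp (cone_restrict zX b2))).
by congr (Rintegral _ _ _); apply/funext => p; rewrite !patchE; case: ifP => // _; rewrite subr0.
Qed.

Lemma cone_le g h z X : `|z.1| + `|z.2| <= X -> bounded_on_box X g -> bounded_on_box X h ->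
  (forall p, cone_region z p -> `|g p| <= h p) -> `|rcone g z| <= rcone h z.
Proof.
move=> zX bg bh gh; rewrite (cone_integral zX bg) (cone_integral zX bh) normrM ger0_norm //.
rewrite ler_wpM2l //.
have ig := integrable_bounded_supp (cone_restrict zX bg).
have ih := integrable_bounded_supp (cone_restrict zX bh).
apply: le_trans (le_normr_Rintegral measurableT ig) _.
apply: le_Rintegral => //; first by have := integrable_norm ig; apply: eq_integrable.
move=> p _; rewrite !patchE; case: ifP => [|_]; last by rewrite normr0.
by rewrite inE => /gh.
Qed.

(** Deliberately crude: the bound is the same for all vertices in the diamond, which turns L^1
    convergence on the box into uniform convergence of the cone integrals. *)
Lemma cone_le_box g z X : `|z.1| + `|z.2| <= X -> bounded_on_box X g ->
  `|rcone g z| <= \int[M]_(p in box X) `|g p|.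
Proof.
move=> zX bg; rewrite (cone_integral zX bg) normrM ger0_norm //.
have [mg [B gB]] := bg.
have bn : bounded_supp ((fun p => `|g p|) \_ (box X)) X.
  split.
  - apply/(measurable_restrictT _ (@measurable_box R X)); apply: measurable_funTS.
    exact: measurableT_comp.
  - exists `|B| => p; rewrite patchE; case: ifPn; last by rewrite normr0.
    by rewrite inE normr_id => /gB pB; exact: le_trans pB (ler_norm _).
  - by move=> p npX; rewrite patchE memNset.
have ig := integrable_bounded_supp (cone_restrict zX bg).
have ib := integrable_bounded_supp bn.
have N0 : 0 <= \int[M]_p `|(g \_ (cone_region z)) p| by apply: Rintegral_ge0.
apply: (@le_trans _ _ (\int[M]_p `|(g \_ (cone_region z)) p|)).
  have := le_normr_Rintegral measurableT ig => /= H.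
  by apply: le_trans (ler_piMl _ _) H => //; rewrite invf_le1 // ler1n.
rewrite [leRHS]Rintegral_mkcond; apply: le_Rintegral => //.
  by have := integrable_norm ig; apply: eq_integrable.
move=> p _; rewrite !patchE; case: ifPn => [|_].
  by rewrite inE => /(cone_region_box zX)[_ pX]; rewrite mem_set.
by case: ifP => _; rewrite normr0.
Qed.

End PlaneSets.

(** * The nonlinear part *)

Section Gronwall.
Context {R : realType}.

Lemma exponential_moment (c t : R) : c != 0 ->
  ri 0 t (fun s => expR (c * s) * (2 * (t - s))) =
  2 * (expR (c * t) / c ^+ 2 - t / c - (c ^+ 2)^-1).
Proof.
move=> c0.
(* The antiderivative found by integration by parts; the summand 0 in the exponent only fits the
   shape of [is_derive_affine]. *)
pose F s := expR (c * s + 0) * ((- 2 / c) * s + (2 * t / c + 2 / c ^+ 2)).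
have dF (s : R) : is_derive s 1 F (expR (c * s) * (2 * (t - s))).
  have h1 := is_derive_affine (is_derive_expR (c * s + 0)).
  have h2 := is_derive_affine (c := - 2 / c) (d := 2 * t / c + 2 / c ^+ 2) (x := s)
    (@is_derive_id R R _ 1).
  have h := @is_derive_mul R (line R) _ _ s 1 _ _ h1 h2.
  rewrite (_ : _ * (2 * _) = c * expR (c * s + 0) * (- 2 / c * s + (2 * t / c + 2 / c ^+ 2)) +
     expR (c * s + 0) * (- 2 / c * 1)); first exact: h.
  by rewrite addr0; field.
have cf : continuous (fun s => expR (c * s) * (2 * (t - s))).
  have c1 : continuous (fun s : R => c * s) by cont.
  have c2 : continuous (fun s : R => 2 * (t - s)) by cont.
  exact: continuousT_mul (continuousT_comp (@continuous_expR R) c1) c2.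
rewrite (ri_FTC 0 t cf dF) /F !mulr0 !addr0 expR0 add0r; field; exact: c0.
Qed.

(** The section of the triangle at height s has length [2 |t - s|], so the left side equals
    [N (exp (l |t|) - l |t| - 1) / l^2] exactly. The factor [1 / l^2] is what the contraction
    argument exploits. *)
Lemma cone_weight (N l : R) (z : R * R) : 0 <= N -> 0 < l ->
  rcone (fun p => N * expR (l * `|p.2|)) z <= N / l ^+ 2 * expR (l * `|z.2|).
Proof.
case: z => x t N0 l0; rewrite /rcone /=.
(* [c] is [l] with the sign of [t], so that [l |s| = c s] between 0 and [t], and one computation of
   the exponential integral covers both signs. *)
have [c [c0 c2 ct tc Ec]] : exists c, [/\ c != 0, c ^+ 2 = l ^+ 2, c * t = l * `|t|, 0 <= t / c &
    forall s, 0 <= s <= t \/ t <= s <= 0 -> l * `|s| = c * s].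
  have [t0|t0] := leP 0 t.
    exists l; split; rewrite ?gt_eqF ?divr_ge0 ?(ltW l0) ?ger0_norm //.
    by move=> s [/andP[s0 _]|/andP[s0 s1]]; rewrite ger0_norm //; lra.
  exists (- l); split.
  - by rewrite oppr_eq0 gt_eqF.
  - by rewrite sqrrN.
  - by rewrite ltr0_norm // mulNr mulrN.
  - by rewrite invrN mulrN -mulNr divr_ge0 ?(ltW l0) // oppr_ge0 ltW.
  - move=> s h; rewrite ler0_norm; first by rewrite mulNr mulrN.
    by case: h => [/andP[s0 s1]|/andP[s0 s1]]; lra.
have -> : ri 0 t (fun s => ri (x - t + s) (x + t - s) (fun=> N * expR (l * `|s|))) =
   ri 0 t (fun s => N * (expR (c * s) * (2 * (t - s)))).
  by apply: ri_eq => s hs; rewrite ri_cst Ec //; ring.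
have cf : continuous (fun s => expR (c * s) * (2 * (t - s))).
  have c1 : continuous (fun s : R => c * s) by cont.
  have c3 : continuous (fun s : R => 2 * (t - s)) by cont.
  exact: continuousT_mul (continuousT_comp (@continuous_expR R) c1) c3.
rewrite riZ // exponential_moment // c2 ct.
have E : N / l ^+ 2 * expR (l * `|t|) - 2^-1 * (N * (2 * (expR (l * `|t|) / l ^+ 2 - t / c - (l ^+ 2)^-1))) =
  N * (t / c + (l ^+ 2)^-1) by field; rewrite c0 gt_eqF.
by rewrite -subr_ge0 E mulr_ge0 // addr_ge0 // invr_ge0 exprn_ge0 // ltW.
Qed.

Lemma weight_ge1 (l s : R) : 0 < l -> 1 <= expR (l * `|s|).
Proof. by move=> l0; rewrite -expR0 ler_expR mulr_ge0 // ltW. Qed.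

Lemma weight_continuous (N l : R) : continuous (fun p : R * R => N * expR (l * `|p.2|)).
Proof.
have c1 : continuous (fun p : R * R => l * `|p.2|) by cont.
exact: continuousT_mul (continuousT_cst (y := N)) (continuousT_comp (@continuous_expR R) c1).
Qed.

(* The weight [exp (l |t|)], with [l] large, turns the integral inequality into
   a contraction estimate for the weighted supremum of [D]. *)
Lemma gronwall (X L : R) : 0 <= X -> 0 <= L -> exists2 C : R, 0 <= C &
  forall (D : R * R -> R) (d : R), continuous D -> (forall p, 0 <= D p) -> 0 <= d ->
    (forall z, `|z.1| + `|z.2| <= X -> D z <= d + 2 * rcone (fun p => L * D p) z) ->
    forall z, `|z.1| + `|z.2| <= X -> D z <= C * d.
Proof.
(* With this [l] one has [4 L <= l^2], so the doubled integral term is at most half of the weighted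
   supremum. The constant combines the resulting factor 2 with the largest weight on the diamond. *)
move=> X0 L0; pose l := 4 * L + 1; exists (2 * expR (l * X)); first by rewrite mulr_ge0 ?expR_ge0.
have l0 : 0 < l by rewrite /l; lra.
move=> D d cD D0 d0 HD.
(* The supremum [N] of this set is finite because [D] is continuous on a compact box; only then does
   [N <= d + N / 2] imply [N <= 2 d]. *)
pose A := [set D z * expR (- (l * `|z.2|)) | z in [set z : R * R | `|z.1| + `|z.2| <= X]].
have e1 (s : R) : expR (- (l * `|s|)) * expR (l * `|s|) = 1 by rewrite -expRD addNr expR0.
have [B B0 HB] := @continuous_bounded_on R (plane R) D _ cD (@compact_box R X).
have Qbox z : `|z.1| + `|z.2| <= X -> box X z.
  case: z => y s /= H; apply/boxE; rewrite plane_norm_le.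
  have y0 := normr_ge0 y; have s0 := normr_ge0 s; have lin (a b : R) : 0 <= b -> a + b <= X -> a <= X by lra.
  by apply/andP; split; [exact: lin H|move: H; rewrite addrC; exact: lin].
have hA : has_sup A.
  split; first by exists (D (0, 0) * expR (- (l * `|0 : R|))); exists (0, 0) => //=; rewrite normr0 addr0.
  exists B => _ [z zX <-]; apply: (@le_trans _ _ (D z)).
    by rewrite ler_piMr // -expR0 ler_expR oppr_le0 mulr_ge0 ?(ltW l0).
  by have := HB z (Qbox z zX); rewrite ger0_norm.
pose N := sup A.
have leN x : A x -> x <= N by move=> Ax; apply: sup_upper_bound.
have N0 : 0 <= N.
  apply: (@le_trans _ _ (D (0, 0) * expR (- (l * `|0 : R|)))).
    by rewrite mulr_ge0 ?expR_ge0.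
  by apply: leN; exists (0, 0) => //=; rewrite normr0 addr0.
have DN z : `|z.1| + `|z.2| <= X -> D z <= N * expR (l * `|z.2|).
  move=> zX; rewrite -[D z]mulr1 -(e1 z.2) mulrA ler_wpM2r ?expR_ge0 //.
  by apply: leN; exists z.
have step z : `|z.1| + `|z.2| <= X -> D z <= (d + N / 2) * expR (l * `|z.2|).
  move=> zX; apply: le_trans (HD z zX) _.
  have cLD : continuous (fun p => L * D p) by exact: continuousT_mul (continuousT_cst (y := L)) cD.
  have H1 : rcone (fun p => L * D p) z <= L * N / l ^+ 2 * expR (l * `|z.2|).
    apply: le_trans (ler_norm _) _; apply: le_trans (cone_weight z (mulr_ge0 L0 N0) l0).
    apply: (cone_le zX).
    - exact: bounded_on_box_continuous.
    - by apply: bounded_on_box_continuous; exact: weight_continuous.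
    - move=> p /(cone_region_box zX)[pX _]; rewrite ger0_norm ?mulr_ge0 // -mulrA ler_wpM2l //.
      exact: DN.
  have H2 : L * N / l ^+ 2 <= N / 4.
    rewrite ler_pdivrMr ?exprn_gt0 //; have : 4 * L <= l ^+ 2.
      by have LL : 0 <= L * L by [rewrite mulr_ge0]; rewrite /l expr2; lra.
    by move=> h; have := ler_wpM2l N0 h; lra.
  have w1 := weight_ge1 z.2 l0.
  have H3 := ler_wpM2r (expR_ge0 (l * `|z.2|)) H2.
  have H4 : d <= d * expR (l * `|z.2|) by rewrite ler_peMr.
  move: H1 H3 H4; rewrite mulrDl; lra.
have NN : N <= d + N / 2.
  apply: ge_sup; first exact: hA.1.
  move=> _ [z zX <-]; have := ler_wpM2r (expR_ge0 (- (l * `|z.2|))) (step z zX).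
  by rewrite -[X in _ <= X]mulrA [X in _ <= _ * X]mulrC e1 mulr1.
have N2 : N <= 2 * d by lra.
move=> z zX; apply: le_trans (DN z zX) _.
rewrite [leRHS]mulrAC; apply: ler_pM => //.
rewrite ler_expR ler_wpM2l ?(ltW l0) //; have := normr_ge0 z.1; lra.
Qed.

End Gronwall.

(** * Continuity and measurability of the nonlinear term *)

Section Nonlinearity.
Context {R : realType} {k : scalar_kind}.
Local Notation K := (scalar_field R k).
Local Notation mR := (measurableTypeR R).

(** [f] is read as a function of two real coordinates, the second being ignored over the reals.
    Compositions with [f] then inherit both continuity and measurability from those of a pair of
    real functions. *)
Lemma lipschitz_parts_continuous (f : K -> K) (L : R) :
  (forall y z, modulus (f y - f z) <= L * modulus (y - z)) ->
  continuous (fun p : R * R => re (f (of_parts k p.1 p.2))) /\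
  continuous (fun p : R * R => im (f (of_parts k p.1 p.2))).
Proof.
move=> fL.
have mp (p q : R * R) : modulus (of_parts k p.1 p.2 - of_parts k q.1 q.2) <= 2 * `|p - q|.
  have h1 : `|p.1 - q.1| <= `|p - q| by rewrite prod_normE le_max lexx.
  have h2 : `|p.2 - q.2| <= `|p - q| by rewrite prod_normE le_max lexx orbT.
  apply: le_trans (modulus_le _) _; rewrite reB imB !re_of_parts.
  have h3 : `|im (of_parts k p.1 p.2) - im (of_parts k q.1 q.2)| <= `|p.2 - q.2|.
    by case: k => //=; rewrite subrr normr0.
  move: h1 h2 h3; lra.
have key (g : R * R -> R) : (forall p q, `|g p - g q| <= modulus (f (of_parts k p.1 p.2) - f (of_parts k q.1 q.2))) ->
    continuous g.
  move=> gf p; apply/cvgrPdist_le => d d0.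
  have L0 : 0 < `|L| + 1 by rewrite ltr_wpDl.
  have s0 : 0 < d / (2 * (`|L| + 1)) by rewrite divr_gt0 // mulr_gt0.
  apply: (proj2 (@nbhs_normE R (plane R) p (fun t => `|g p - g t| <= d))).
  exists (d / (2 * (`|L| + 1))) => // q hq.
  apply: le_trans (gf p q) _; apply: le_trans (fL _ _) _.
  apply: (@le_trans _ _ ((`|L| + 1) * (2 * `|p - q|))).
    apply: (@le_trans _ _ ((`|L| + 1) * modulus (of_parts k p.1 p.2 - of_parts k q.1 q.2))).
      by rewrite ler_wpM2r ?modulus_ge0 //; have := ler_norm L; lra.
    by rewrite ler_wpM2l ?(ltW L0).
  move: hq; rewrite distrC ltr_pdivlMr ?mulr_gt0 // => /ltW; apply: le_trans.
  by rewrite mulrCA mulrA mulrC.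
by split; apply: key => p q; rewrite -?reB -?imB; [exact: re_le_modulus|exact: im_le_modulus].
Qed.

Lemma lipschitz_comp_continuous (f : K -> K) (L : R) (g : plane R -> K) :
  (forall y z, modulus (f y - f z) <= L * modulus (y - z)) -> continuous_scalar g ->
  continuous_scalar (fun z => f (g z)).
Proof.
move=> fL [gr gi]; have [c1 c2] := lipschitz_parts_continuous fL.
have cp := continuousT_pair gr gi.
split.
  rewrite (_ : _ \o _ = fun z => re (f (of_parts k (re (g z)) (im (g z))))); first exact: (continuousT_comp c1 cp).
  by apply/funext => z /=; rewrite of_parts_re_im.
rewrite (_ : _ \o _ = fun z => im (f (of_parts k (re (g z)) (im (g z))))); first exact: (continuousT_comp c2 cp).
by apply/funext => z /=; rewrite of_parts_re_im.
Qed.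

Definition measurable_scalar (g : R * R -> K) : Prop :=
  measurable_fun setT ((fun z => re (g z)) : mR * mR -> R) /\
  measurable_fun setT ((fun z => im (g z)) : mR * mR -> R).

Lemma lipschitz_comp_measurable (f : K -> K) (L : R) (g : R * R -> K) :
  (forall y z, modulus (f y - f z) <= L * modulus (y - z)) -> measurable_scalar g ->
  measurable_scalar (fun z => f (g z)).
Proof.
move=> fL [gr gi]; have [c1 c2] := lipschitz_parts_continuous fL.
have mp : measurable_fun setT ((fun z => (re (g z), im (g z))) : mR * mR -> mR * mR).
  exact: measurable_fun_pair.
split.
  rewrite (_ : (fun z => _) = (fun p : mR * mR => re (f (of_parts k p.1 p.2))) \o
    ((fun z => (re (g z), im (g z))) : mR * mR -> mR * mR)).
    exact: measurableT_comp (continuous_measurable_plane c1) mp.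
  by apply/funext => z /=; rewrite of_parts_re_im.
rewrite (_ : (fun z => _) = (fun p : mR * mR => im (f (of_parts k p.1 p.2))) \o
  ((fun z => (re (g z), im (g z))) : mR * mR -> mR * mR)).
  exact: measurableT_comp (continuous_measurable_plane c2) mp.
by apply/funext => z /=; rewrite of_parts_re_im.
Qed.

Lemma continuous_measurable_scalar (g : plane R -> K) : continuous_scalar g -> measurable_scalar g.
Proof. by move=> [gr gi]; split; exact: continuous_measurable_plane. Qed.

Lemma measurable_scalar_add (g1 g2 : R * R -> K) : measurable_scalar g1 -> measurable_scalar g2 ->
  measurable_scalar (fun z => g1 z + g2 z).
Proof.
move=> [r1 i1] [r2 i2]; split.
  by under eq_fun do rewrite reD; exact: measurable_funD.
by under eq_fun do rewrite imD; exact: measurable_funD.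
Qed.

Lemma open_regular_set (v : (plane R -> K) -> K) : open (~` singular_support v).
Proof.
rewrite openE => z /= /contrapT[U [g [oU Uz sg eg]]].
apply: (filterS _ (open_nbhs_nbhs (conj oU Uz))) => y Uy nS; apply: nS.
by exists U, g.
Qed.

Lemma regular_part_measurable (v : (plane R -> K) -> K) (g : plane R -> K) :
  regular_part v g -> measurable_scalar g.
Proof.
move=> [g0 [sr si] _]; have oS := open_regular_set (v := v).
split; apply: (measurable_open_continuous oS).
- by move=> z nz; exact: (sr [::] z nz).1.
- by move=> z /contrapT/g0 ->; rewrite re0.
- by move=> z nz; exact: (si [::] z nz).1.
- by move=> z /contrapT/g0 ->; rewrite im0.
Qed.

End Nonlinearity.

(** * Convergence of the generalized solution *)

Section Representative.
Context {R : realType} {k : scalar_kind}.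
Local Notation K := (scalar_field R k).

Lemma negligible_smooth_near {E : coord_space R} (r : eps_family E k) :
  smooth_family r -> \forall e \near 0^'+, smooth (r e).
Proof.
move=> sr; near=> e; apply: sr; apply/andP; split => //.
by near: e; apply: nbhs_right_le.
Unshelve. all: by end_near. Qed.

Lemma coset_represents {E : coord_space R} (cal : space_calculus E) (phi chi : E -> K)
    (T : (E -> K) -> K) (r : eps_family E k) : mollifier phi -> cutoff chi -> is_distribution T ->
  embed phi chi T r -> represents phi chi r T.
Proof.
move=> mphi cchi dT nr; split; last by move=> X; exact: (negligible_bound cal X nr).
have := negligible_smooth_near nr.1; apply: filterS => e se.
have cr : continuous_scalar (regularization phi chi T e).
  by have [] := regularization_continuous cal mphi cchi e dT.
have -> : r e = fun x => (r e x - regularization phi chi T e x) + regularization phi chi T e x.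
  by apply/funext => x; rewrite subrK.
exact: continuous_scalar_add (smooth_continuous_scalar se) cr.
Qed.

(** Turns the equalities between sets of families into estimates for an arbitrary member [u1]. Each
    operation is a set of images of members, so the image of [u1] belongs to the left side and
    therefore to the right side, that is, up to a null family. *)
Lemma solution_representative (phi chi : line R -> K) (f : K -> K) (a b : (line R -> K) -> K)
    (u : set (eps_family (plane R) k)) (u1 : eps_family (plane R) k) (L : R) :
  mollifier phi -> cutoff chi -> is_distribution a -> is_distribution b -> 0 <= L ->
  (forall y z, modulus (f y - f z) <= L * modulus (y - z)) ->
  generalized_solution f (embed phi chi a) (embed phi chi b) u -> u u1 ->
  [/\ \forall e \near 0^'+, smooth (u1 e),
      represents phi chi (fun e y => u1 e (y, 0)) a,
      represents phi chi (fun e y => partial [:: dir_t R] (u1 e) (y, 0)) b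
    & forall X : R, exists2 C : R, 0 <= C & \forall e \near 0^'+, forall z : plane R, `|z| <= X ->
        modulus (wave_op (u1 e) z - f (u1 e z)) <= C * e].
Proof.
move=> mphi cchi da db L0 fL [[u0 mu0 Eu] Ew Ea Eb] uu1.
have c1 := @line_calculus R; have c2 := @plane_calculus R.
have n1 : negligible_family (fun e x => u1 e x - u0 e x) by move: uu1; rewrite -Eu.
split.
- have s0 := negligible_smooth_near mu0.1; have s1 := negligible_smooth_near n1.1.
  apply: filterS2 s0 s1 => e se0 se1.
  have -> : u1 e = fun x => (u1 e x - u0 e x) + u0 e x by apply/funext => x; rewrite subrK.
  exact: smooth_add.
- apply: (coset_represents c1) => //; rewrite -Ea; exists u1 => //; exact: coset_refl.
- apply: (coset_represents c1) => //; rewrite -Eb.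
  exists (fun e => partial [:: dir_t R] (u1 e)); last exact: coset_refl.
  by exists u1 => //; exact: coset_refl.
(* Membership in [gcomp f u] only provides some representative [u2], possibly different from [u1].
   The Lipschitz condition transfers the estimate, since both differ from [u0] by null families. *)
have [u2 uu2 n2] : gcomp f u (fun e x => wave_op (u1 e) x).
  rewrite -Ew; exists (fun e => partial [:: dir_t R; dir_t R] (u1 e)), (fun e => partial [:: dir_x R; dir_x R] (u1 e)).
  by split; [exists u1 => //; exact: coset_refl|exists u1 => //; exact: coset_refl|exact: coset_refl].
have n3 : negligible_family (fun e x => u2 e x - u0 e x) by move: uu2; rewrite -Eu.
move=> X; have [C1 C10 H1] := negligible_bound c2 X n1; have [C2 C20 H2] := negligible_bound c2 X n2.
have [C3 C30 H3] := negligible_bound c2 X n3.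
exists (C2 + L * (C3 + C1)); first by rewrite addr_ge0 // mulr_ge0 // addr_ge0.
near=> e => z zX.
have h1 : forall z : plane R, `|z| <= X -> modulus (u1 e z - u0 e z) <= C1 * e by near: e.
have h2 : forall z : plane R, `|z| <= X -> modulus (wave_op (u1 e) z - f (u2 e z)) <= C2 * e by near: e.
have h3 : forall z : plane R, `|z| <= X -> modulus (u2 e z - u0 e z) <= C3 * e by near: e.
rewrite -(subrK (f (u2 e z)) (wave_op (u1 e) z)) -addrA mulrDl.
apply: le_trans (modulusD _ _) _; apply: lerD; first exact: h2.
apply: le_trans (fL _ _) _; rewrite -mulrA ler_wpM2l //.
rewrite (_ : u2 e z - u1 e z = (u2 e z - u0 e z) + - (u1 e z - u0 e z)); last by ring.
by rewrite mulrDl; apply: le_trans (modulusD _ _) _; rewrite modulusN; apply: lerD; [exact: h3|exact: h1].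
Unshelve. all: by end_near. Qed.

End Representative.

(** * The error of the nonlinear part *)

Section WaveError.
Context {R : realType}.
Local Notation mR := (measurableTypeR R).
Local Notation M := ((@lebesgue_measure R) \x (@lebesgue_measure R))%E.

(** The intended chain is [wave_op (u e)], [f (u e)], [f (V e + w)], [f (vreg + w)]. The first step
    is uniformly small, the second is controlled by the unknown error and left for Gronwall, the
    third is small in L^1 only. *)
Lemma cone_difference (X c : R) (z : R * R) (g1 g2 g3 g4 h : R * R -> R) :
  `|z.1| + `|z.2| <= X -> bounded_on_box X g1 -> bounded_on_box X g2 ->
  bounded_on_box X g3 -> bounded_on_box X g4 -> bounded_on_box X h -> 0 <= c ->
  (forall p, box X p -> `|g1 p - g2 p| <= c) -> (forall p, `|g2 p - g3 p| <= h p) ->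
  `|rcone g1 z - rcone g4 z| <= c * expR X + rcone h z + \int[M]_(p in box X) `|g3 p - g4 p|.
Proof.
move=> zX b1 b2 b3 b4 bh c0 H12 H23.
have -> : rcone g1 z - rcone g4 z =
    rcone (fun p => g1 p - g2 p) z + rcone (fun p => g2 p - g3 p) z + rcone (fun p => g3 p - g4 p) z.
  rewrite -(cone_sub zX b1 b2) -(cone_sub zX b2 b3) -(cone_sub zX b3 b4).
  have alg (p q r s : R) : p - s = p - q + (q - r) + (r - s) by ring.
  exact: alg.
apply: le_trans (ler_normD _ _) _; apply: lerD; last first.
  exact: cone_le_box zX (bounded_on_box_sub b3 b4).
apply: le_trans (ler_normD _ _) _; apply: lerD; last first.
  by apply: (cone_le zX (bounded_on_box_sub b2 b3) bh) => p _.
(* The constant [c] is enlarged to [c exp |s|], so that [cone_weight] with [l = 1] yields the bound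
   [c exp X]. *)
have bw : bounded_on_box X (fun p => c * expR (1 * `|p.2|)).
  by apply: bounded_on_box_continuous; exact: weight_continuous.
apply: (@le_trans _ _ (rcone (fun p => c * expR (1 * `|p.2|)) z)).
  apply: (cone_le zX (bounded_on_box_sub b1 b2) bw) => p /(cone_region_box zX)[_ /H12 h12].
  apply: le_trans h12 _; rewrite ler_peMr //; exact: weight_ge1.
apply: le_trans (cone_weight z c0 (ltr01 : 0 < (1 : R))) _.
rewrite expr1n divr1 ler_wpM2l // ler_expR mul1r; have := normr_ge0 z.1; lra.
Qed.

Lemma small_cvg0 (F : R -> R) (C : R) : (\forall e \near 0^'+, `|F e| <= C * e) ->
  F e @[e --> 0^'+] --> (0 : R).
Proof.
move=> HF; apply/cvgrPdist_le => d d0; near=> e.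
have e0 : 0 < e by [].
have h1 : `|F e| <= C * e by near: e.
have h2 : e < d / (`|C| + 1) by near: e; apply: nbhs_right_lt; rewrite divr_gt0 // ltr_wpDl.
rewrite sub0r normrN (le_trans h1) //; move: h2; rewrite ltr_pdivlMr ?ltr_wpDl // => /ltW; apply: le_trans.
rewrite mulrC ler_wpM2l ?(ltW e0) //; have := ler_norm C; lra.
Unshelve. all: by end_near. Qed.

End WaveError.

Section WaveLimit.
Context {R : realType} {k : scalar_kind}.
Local Notation K := (scalar_field R k).
Local Notation M := ((@lebesgue_measure R) \x (@lebesgue_measure R))%E.
Local Notation cc := compactly_supported_continuous.

Lemma weak_solution_cone (f : K -> K) (g w : plane R -> K) : weak_solution f g w ->
  forall z : plane R, w z = cone (fun p => f (g p + w p)) z.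
Proof. by move=> [_ hw] [x t]; rewrite hw. Qed.

Lemma bounded_on_box_parts (g : R * R -> K) (X B : R) : measurable_scalar g ->
  (forall z, modulus (g z) <= B) ->
  bounded_on_box X (fun z => re (g z)) /\ bounded_on_box X (fun z => im (g z)).
Proof.
move=> [mr mi] gB; split; split => //; exists B => z _; apply: le_trans (gB z).
  exact: re_le_modulus.
exact: im_le_modulus.
Qed.

Lemma continuous_on_box_parts (g : plane R -> K) (X : R) : continuous_scalar g ->
  bounded_on_box X (fun z => re (g z)) /\ bounded_on_box X (fun z => im (g z)).
Proof. by move=> [cr ci]; split; exact: bounded_on_box_continuous. Qed.

Variables (f : K -> K) (L B : R).
Hypotheses (L0 : 0 <= L) (fL : forall y z, modulus (f y - f z) <= L * modulus (y - z))
  (fB : forall z, modulus (f z) <= B).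
Variables (u V : R -> plane R -> K) (vreg w : plane R -> K) (N : set (R * R)).
Hypothesis cu : \forall e \near 0^'+, continuous_scalar (u e).
Hypothesis cV : \forall e \near 0^'+, continuous_scalar (V e).
Hypothesis cop : \forall e \near 0^'+, continuous_scalar (wave_op (u e)).
Hypothesis decomposition : \forall e \near 0^'+, forall z, u e z = V e z + cone (wave_op (u e)) z.
Hypothesis residual : forall X : R, exists2 C : R, 0 <= C &
  \forall e \near 0^'+, forall z : plane R, `|z| <= X ->
    modulus (wave_op (u e) z - f (u e z)) <= C * e.
Hypothesis mreg : measurable_scalar vreg.
Hypothesis cw : continuous_scalar w.
Hypothesis hw : forall z : plane R, w z = cone (fun p => f (vreg p + w p)) z.
Hypothesis mN : measurable (N : set (measurableTypeR R * measurableTypeR R)).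
Hypothesis N0 : M N = 0%E.
Hypothesis Vlim : forall z : plane R, ~ N z -> exists2 C : R, 0 <= C &
  \forall e \near 0^'+, modulus (V e z - vreg z) <= C * e.

(** The L^1 error, for which dominated convergence gives no rate in [e]; it is the reason why the
    final estimate has an unspecified null function and not a multiple of [e]. *)
Let J (p : K -> R) (X e : R) : R :=
  \int[M]_(z in box X) `|p (f (V e z + w z)) - p (f (vreg z + w z))|.

Let J_cvg (p : K -> R) (X : R) : (p = @re R k \/ p = @im R k) -> J p X e @[e --> 0^'+] --> (0 : R).
Proof.
move=> hp.
have pB x y : `|p x - p y| <= modulus (x - y).
  by case: hp => ->; rewrite -?reB -?imB; [exact: re_le_modulus|exact: im_le_modulus].
have mp (g : R * R -> K) : measurable_scalar g ->
    measurable_fun setT ((fun z => p (g z)) : measurableTypeR R * measurableTypeR R -> R).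
  by move=> [mr mi]; case: hp => ->.
apply: (@box_dominated R (fun e z => `|p (f (V e z + w z)) - p (f (vreg z + w z))|) X (B + B) N) => //.
- near=> e; apply: measurableT_comp => //; apply: measurable_funB; apply: mp.
    apply: lipschitz_comp_measurable fL _; apply: measurable_scalar_add; apply: continuous_measurable_scalar => //.
    by near: e.
  apply: lipschitz_comp_measurable fL _; apply: measurable_scalar_add => //.
  exact: continuous_measurable_scalar.
- move=> e z; rewrite normr_id; apply: le_trans (pB _ _) _.
  by apply: le_trans (modulusD _ _) _; rewrite modulusN; apply: lerD; exact: fB.
move=> z /Vlim[C C0 HC]; apply: (@small_cvg0 _ _ (L * C)); near=> e.
rewrite normr_id; apply: le_trans (pB _ _) _; apply: le_trans (fL _ _) _.
rewrite (_ : _ - _ = V e z - vreg z); last by ring.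
by rewrite -mulrA ler_wpM2l //; near: e.
Unshelve. all: by end_near. Qed.

(** The sum [D] of the absolute values of the real and imaginary parts of [u e - V e - w] satisfies
    Gronwall's hypothesis on the diamond: both [u e - V e] and [w] are cone integrals, to whose
    integrands [cone_difference] applies. *)
Lemma nonlinear_part_converges (X : R) : 0 <= X -> exists2 d : R -> R, d e @[e --> 0^'+] --> (0 : R) &
  \forall e \near 0^'+, forall z : plane R, `|z.1| + `|z.2| <= X ->
    modulus (u e z - V e z - w z) <= d e.
Proof.
move=> X0; have [C C0 HC] := residual X; have [G G0 HG] := gronwall X0 L0.
(* The real and the imaginary part each contribute the residual [C e exp X] and one L^1 error; they
   also account for the factor 2 before the integral in [gronwall]. *)
pose d0 e := 2 * (C * e * expR X) + (J (@re R k) X e + J (@im R k) X e).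
exists (fun e => G * d0 e).
  have h1 : 2 * (C * e * expR X) @[e --> 0^'+] --> (0 : R).
    apply: (@small_cvg0 _ _ (2 * (C * expR X))); near=> e.
    have e0 : 0 < e by [].
    rewrite ger0_norm; first by rewrite (_ : 2 * _ = 2 * (C * expR X) * e) //; ring.
    by rewrite mulr_ge0 // mulr_ge0 ?expR_ge0 // mulr_ge0 // ltW.
  have h2 := J_cvg X (or_introl (erefl (@re R k))); have h3 := J_cvg X (or_intror (erefl (@im R k))).
  have h4 : G * d0 e @[e --> 0^'+] --> G * (0 + (0 + 0)).
    by apply: cvgM; [exact: cvg_cst|apply: cvgD h1 _; exact: cvgD h2 h3].
  by rewrite !addr0 mulr0 in h4.
near=> e => z zX.
have e0 : 0 < e by [].
have cue : continuous_scalar (u e) by near: e.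
have cVe : continuous_scalar (V e) by near: e.
have cope : continuous_scalar (wave_op (u e)) by near: e.
have dece : forall z, u e z = V e z + cone (wave_op (u e)) z by near: e.
have HCe : forall z : plane R, `|z| <= X -> modulus (wave_op (u e) z - f (u e z)) <= C * e by near: e.
pose W z := u e z - V e z - w z.
have cW : continuous_scalar W by apply: continuous_scalar_sub => //; exact: continuous_scalar_sub.
have WE z' : W z' = cone (wave_op (u e)) z' - cone (fun p => f (vreg p + w p)) z'.
  by rewrite /W dece (addrC (V e z')) addrK; congr (_ - _); exact: hw.
pose D z := `|re (W z)| + `|im (W z)|.
have cD : continuous D by apply: continuousT_add; apply: continuousT_norm; [exact: cW.1|exact: cW.2].
have cVw := continuous_scalar_add cVe cw.
have [b1r b1i] := continuous_on_box_parts X cope.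
have [b2r b2i] := continuous_on_box_parts X (lipschitz_comp_continuous fL cue).
have [b3r b3i] := continuous_on_box_parts X (lipschitz_comp_continuous fL cVw).
have [b4r b4i] := @bounded_on_box_parts _ X B (lipschitz_comp_measurable fL
  (measurable_scalar_add mreg (continuous_measurable_scalar cw))) (fun=> fB _).
have bD : bounded_on_box X (fun p => L * D p).
  by apply: bounded_on_box_continuous; exact: continuousT_mul (continuousT_cst (y := L)) cD.
have Ce0 : 0 <= C * e by rewrite mulr_ge0 // ltW.
have h12 p : box X p -> modulus (wave_op (u e) p - f (u e p)) <= C * e by move/boxE; exact: HCe.
have h23 p : modulus (f (u e p) - f (V e p + w p)) <= L * D p.
  apply: le_trans (fL _ _) _; rewrite ler_wpM2l //.
  by rewrite opprD addrA; exact: modulus_le.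
have d0e : 0 <= d0 e.
  by rewrite addr_ge0 ?addr_ge0 ?mulr_ge0 ?expR_ge0 ?Rintegral_ge0 // ltW.
apply: le_trans (modulus_le _) _; apply: (HG D (d0 e) cD _ d0e _ z zX).
  by move=> p; rewrite addr_ge0.
have reW z' : re (W z') = rcone (fun p => re (wave_op (u e) p)) z' -
    rcone (fun p => re (f (vreg p + w p))) z'.
  by apply: etrans (congr1 _ (WE z')) _; apply: etrans (reB _ _) _; congr (_ - _); exact: re_cone.
have imW z' : im (W z') = rcone (fun p => im (wave_op (u e) p)) z' -
    rcone (fun p => im (f (vreg p + w p))) z'.
  by apply: etrans (congr1 _ (WE z')) _; apply: etrans (imB _ _) _; congr (_ - _); exact: im_cone.
move=> z' zX'; rewrite /D reW imW.
have H1 := cone_difference zX' b1r b2r b3r b4r bD Ce0 _ _.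
have H2 := cone_difference zX' b1i b2i b3i b4i bD Ce0 _ _.
rewrite (_ : d0 e + _ = (C * e * expR X + rcone (fun p => L * D p) z' + J (@re R k) X e) +
  (C * e * expR X + rcone (fun p => L * D p) z' + J (@im R k) X e)); last by rewrite /d0; ring.
apply: lerD; [apply: H1 => p|apply: H2 => p]; rewrite -?reB -?imB.
- by move=> pX; apply: le_trans (re_le_modulus _) _; exact: h12.
- by apply: le_trans (re_le_modulus _) _; exact: h23.
- by move=> pX; apply: le_trans (im_le_modulus _) _; exact: h12.
- by apply: le_trans (im_le_modulus _) _; exact: h23.
Unshelve. all: by end_near. Qed.

End WaveLimit.

(** * The distribution v + w and discrete supports *)

Section Distributions.
Context {R : realType} {k : scalar_kind}.
Local Notation K := (scalar_field R k).
Local Notation I2 := (@integral_space R (plane R)).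
Local Notation cc := compactly_supported_continuous.

Lemma wave_op_continuous (u : plane R -> K) : smooth u -> continuous_scalar (wave_op u).
Proof.
move=> su; split.
  rewrite (_ : _ \o _ = fun z => rpartial [:: dir_t R; dir_t R] (fun z => re (u z)) z -
     rpartial [:: dir_x R; dir_x R] (fun z => re (u z)) z); last by apply/funext => z; exact: re_wave_op.
  by apply: rsmooth_continuous; apply: rsmooth_sub; apply: rsmooth_rpartial; exact: smooth_re.
rewrite (_ : _ \o _ = fun z => rpartial [:: dir_t R; dir_t R] (fun z => im (u z)) z -
   rpartial [:: dir_x R; dir_x R] (fun z => im (u z)) z); last by apply/funext => z; exact: im_wave_op.
by apply: rsmooth_continuous; apply: rsmooth_sub; apply: rsmooth_rpartial; exact: smooth_im.
Qed.

Lemma partial_bound_ge0 {E : coord_space R} (psi : E -> K) (m : nat) (M : R) :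
  (forall l x, (size l <= m)%N -> modulus (partial l psi x) <= M) -> 0 <= M.
Proof. by move=> h; apply: le_trans (modulus_ge0 _) (h [::] 0 (leq0n _)). Qed.

Lemma of_function_distribution (w : plane R -> K) : continuous_scalar w ->
  is_distribution (of_function w).
Proof.
move=> cw; split.
  move=> c psi1 psi2 t1 t2.
  have ccr psi (t : test psi) := cc_re_mul cw t; have cci psi (t : test psi) := cc_im_mul cw t.
  have cZ (x : R) (g : plane R -> R) : cc g -> cc (fun z => x * g z).
    by move=> cg; apply: cc_mulr => //; exact: continuousT_cst.
  have [pa po] := (@plane_calculus R, @plane_order R).
  rewrite /of_function; apply: scalar_eq.
    rewrite reD reM !re_Kintegral (im_Kintegral pa).
    rewrite -!(integral_homog po) -?(integral_sub pa) -?(integral_add pa); first last;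
      try by [apply: ccr|apply: cci|apply: cZ; apply: ccr|apply: cZ; apply: cci|
              apply: cc_add; [apply: cZ; apply: ccr|apply: cc_opp; apply: cZ; apply: cci]].
    by congr I2; apply/funext => z; rewrite !(reM, imM, reD, imD); ring.
  rewrite imD imM !(im_Kintegral pa) !re_Kintegral.
  rewrite -!(integral_homog po) -?(integral_add pa); first last;
    try by [apply: ccr|apply: cci|apply: cZ; apply: ccr|apply: cZ; apply: cci|
            apply: cc_add; apply: cZ; [apply: cci|apply: ccr]].
  by congr I2; apply/funext => z; rewrite !(reM, imM, reD, imD); ring.
move=> C cC; have [X [_ HX]] := compact_bounded cC.
pose Y := `|X| + 1.
have CY z : C z -> `|z| <= Y.
  by move=> Cz; apply: (HX Y _ z Cz); rewrite /Y ltr_pwDr // ler_norm.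
(* [q] is twice the positive part of [Y + 1 - |z|]: continuous, zero beyond [Y + 1] and at least one
   on the ball of radius [Y]. It makes [h] a compactly supported continuous majorant of [w] on [C],
   whose integral serves as the constant of an estimate of order 0. *)
pose q (z : plane R) := Y + 1 - `|z| + `|Y + 1 - `|z| |.
pose h (z : plane R) := (`|re (w z)| + `|im (w z)|) * q z.
have cq : continuous q.
  have cn : continuous (fun z : plane R => Y + 1 - `|z|).
    apply: continuousT_add; first exact: continuousT_cst.
    by apply: continuousT_opp; exact: norm_continuous.
  exact: continuousT_add cn (continuousT_norm cn).
have q0 z : 0 <= q z by rewrite /q addrC -(opprK (_ - _)) normrN subr_ge0 ler_norm.
have ch : cc h.
  split.
    apply: continuousT_mul cq.
    by apply: continuousT_add; apply: continuousT_norm; [exact: cw.1|exact: cw.2].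
  exists (Y + 1); first by rewrite /Y !addr_ge0.
  move=> z hz; have n0 : Y + 1 - `|z| <= 0 by rewrite subr_le0 ltW.
  by rewrite /h /q (ler0_norm n0) subrr mulr0.
have hw z : `|z| <= Y -> modulus (w z) <= h z.
  move=> zY; apply: le_trans (modulus_le _) _; rewrite /h ler_peMr ?addr_ge0 //.
  have h1 : 1 <= Y + 1 - `|z| by lra.
  by rewrite /q -[leLHS]addr0 lerD.
have h0 z : 0 <= h z by apply: mulr_ge0; [rewrite addr_ge0|exact: q0].
exists (I2 h + I2 h), 0%N => psi sp sC M HM.
have tp := test_supported sp cC sC.
have M0 := partial_bound_ge0 HM.
have wp z : modulus (w z * psi z) <= M * h z.
  have [Cz|nCz] := pselect (C z); last first.
    by rewrite (sC z nCz) mulr0 modulusE re0 im0 expr0n addr0 sqrtr0 mulr_ge0.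
  rewrite modulusM mulrC; apply: ler_pM; rewrite ?modulus_ge0 //; last exact/hw/CY.
  by have := HM [::] z (leqnn _); rewrite partial_nil.
have H1 := integral_norm_le (@plane_order R) (cc_re_mul cw tp) ch (fun x => le_trans (re_le_modulus _) (wp x)).
have H2 := integral_norm_le (@plane_order R) (cc_im_mul cw tp) ch (fun x => le_trans (im_le_modulus _) (wp x)).
apply: le_trans (modulus_le _) _; rewrite re_Kintegral (im_Kintegral (@plane_calculus R)).
by rewrite mulrDl ![_ * M]mulrC; apply: lerD.
Qed.

Lemma distribution_sum {E : coord_space R} (S T : (E -> K) -> K) : is_distribution S ->
  is_distribution T -> is_distribution (fun psi => S psi + T psi).
Proof.
move=> [lS bS] [lT bT]; split.
  by move=> c psi1 psi2 t1 t2; rewrite lS // lT // mulrDr addrACA.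
move=> C cC; have [c1 [m1 H1]] := bS C cC; have [c2 [m2 H2]] := bT C cC.
exists (c1 + c2), (m1 + m2)%N => psi sp sC M HM.
rewrite mulrDl; apply: le_trans (modulusD _ _) _; apply: lerD.
  by apply: H1 => // l x hl; apply: HM; apply: leq_trans hl (leq_addr _ _).
by apply: H2 => // l x hl; apply: HM; apply: leq_trans hl (leq_addl _ _).
Qed.

(** The isolated points of any subset of the line are countable; discreteness says that all points
    of the support are isolated. *)
Lemma discrete_support_countable (T : (line R -> K) -> K) : has_discrete_support T ->
  countable (dsupport T).
Proof.
move=> dT; apply: sub_countable (subset_card_le dT) _.
exact: (@countable_isolated R (dsupport T)).
Qed.

End Distributions.

Theorem proposition6 (R : realType) (k : scalar_kind)
    (phi1 chi1 : line R -> scalar_field R k)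
    (phi2 chi2 : plane R -> scalar_field R k)
    (f : scalar_field R k -> scalar_field R k)
    (a b : (line R -> scalar_field R k) -> scalar_field R k)
    (u : set (eps_family (plane R) k))
    (v : (plane R -> scalar_field R k) -> scalar_field R k)
    (vreg w : plane R -> scalar_field R k) :
  mollifier phi1 -> cutoff chi1 -> mollifier phi2 -> cutoff chi2 ->
  admissible f ->
  is_distribution a -> has_discrete_support a ->
  is_distribution b -> has_discrete_support b ->
  generalized_solution f (embed phi1 chi1 a) (embed phi1 chi1 b) u ->
  linear_solution a b v ->
  regular_part v vreg ->
  weak_solution f vreg w ->
  associated u (embed phi2 chi2 (fun psi => (v psi + of_function w psi)%R)).
Proof.
move=> mphi1 cchi1 mphi2 cchi2 [_ [B fB] [L fL'] _ _] da sa db sb gs lv rv ws u1 v1 uu1 vv1 psi tp.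
(* The given Lipschitz constant carries no sign, while the estimates multiply inequalities by it. *)
have fL y z : modulus (f y - f z) <= `|L| * modulus (y - z).
  by apply: le_trans (fL' y z) _; rewrite ler_wpM2r ?modulus_ge0 // ler_norm.
have [su rA rB res] := solution_representative mphi1 cchi1 da db (normr_ge0 L) fL gs uu1.
pose V e := dalembert_fun (fun y => u1 e (y, 0)) (fun y => partial [:: dir_t R] (u1 e) (y, 0)).
have cV : \forall e \near 0^'+, @continuous_scalar R (plane R) k (V e).
  by apply: filterS2 rA.1 rB.1 => e; exact: dalembert_fun_continuous.
have cu : \forall e \near 0^'+, continuous_scalar (u1 e).
  by apply: filterS su => e; exact: smooth_continuous_scalar.
have [mN N0] := countable_characteristics_null
  (countable_setU (discrete_support_countable sa) (discrete_support_countable sb)).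
have Vlim (z : plane R) : ~ characteristics a b z -> exists2 C : R, 0 <= C &
    \forall e \near 0^'+, modulus (V e z - vreg z) <= C * e.
  by move=> nz; have [] := dalembert_fun_regular_part mphi1 cchi1 da db rA rB lv cchi2 rv nz.
have [X X0 pX] := test_bounded tp.
have cop : \forall e \near 0^'+, continuous_scalar (wave_op (u1 e)).
  by apply: filterS su => e; exact: wave_op_continuous.
have dec : \forall e \near 0^'+, forall z, u1 e z = V e z + cone (wave_op (u1 e)) z.
  by apply: filterS su => e sue z; exact: smooth_wave_decomposition.
(* The support of [psi] lies in the sup-norm ball of radius [X], hence in the diamond of size
   [X + X]. *)
have X20 : 0 <= X + X by rewrite addr_ge0.
have [d dc Hd] := nonlinear_part_converges (normr_ge0 L) fL fB cu cV cop dec res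
  (regular_part_measurable rv) ws.1 (weak_solution_cone ws) mN N0 Vlim X20.
have [C1 C10 H1] := dalembert_fun_converges tp mphi1 cchi1 da db rA rB.
have dT := distribution_sum lv.1 (of_function_distribution ws.1).
have rT := coset_represents (@plane_calculus R) mphi2 cchi2 dT vv1.
have [C2 C20 H2] := represents_pairing (@plane_calculus R) (@plane_order R) mphi2 cchi2 dT rT tp.
have [M M0 HM] := Kintegral_small (@plane_calculus R) (@plane_order R) tp.
have hc : C1 * e + C2 * e + M * `|d e| @[e --> 0^'+] --> (0 : R).
  have i0 (C : R) : 0 <= C -> C * e @[e --> 0^'+] --> (0 : R).
    move=> C0; apply: (@small_cvg0 _ _ C); near=> e.
    by rewrite ger0_norm // mulr_ge0 // ltW.
  have : C1 * e + C2 * e + M * `|d e| @[e --> 0^'+] --> 0 + 0 + M * `|0 : R|.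
    apply: cvgD; first by apply: cvgD; exact: i0.
    by apply: cvgM; [exact: cvg_cst|exact: cvg_norm].
  by rewrite normr0 mulr0 !addr0.
apply: squeeze_cvgr (cvg_cst 0) hc; near=> e; rewrite modulus_ge0 /=.
have cue : continuous_scalar (u1 e) by near: e.
have cVe : @continuous_scalar R (plane R) k (V e) by near: e.
have cve : continuous_scalar (v1 e) by near: e; exact: rT.1.
have Hde : forall z : plane R, `|z.1| + `|z.2| <= X + X -> modulus (u1 e z - V e z - w z) <= d e by near: e.
have H1e : modulus (Kintegral (fun z : plane R => V e z * psi z) - dalembert a b psi) <= C1 * e by near: e.
have H2e : modulus (Kintegral (fun x => v1 e x * psi x) - (v psi + of_function w psi)) <= C2 * e by near: e.
have cal := @plane_calculus R.
have cw := ws.1.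
have cW := continuous_scalar_sub (continuous_scalar_sub cue cVe) cw.
(* The three errors: the linear part against d'Alembert's functional, the regularization of v + w
   against its limit, and the nonlinear part against [w]. The pairings of [v] and [w] with [psi]
   cancel. *)
have E : Kintegral (fun z => (u1 e z - v1 e z) * psi z) =
    (Kintegral (fun z : plane R => V e z * psi z) - dalembert a b psi) +
    - (Kintegral (fun x => v1 e x * psi x) - (v psi + of_function w psi)) +
    Kintegral (fun z : plane R => (u1 e z - V e z - w z) * psi z).
  rewrite (Kintegral_mulB cal cue cve tp) (Kintegral_mulB cal (continuous_scalar_sub cue cVe) cw tp).
  rewrite (Kintegral_mulB cal cue cVe tp) (lv.2 psi tp) /of_function.
  have alg (p q r s t : scalar_field R k) : p - q = (r - s) + - (q - (s + t)) + (p - r - t) by ring.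
  exact: alg.
rewrite E; apply: le_trans (modulusD _ _) _; apply: lerD.
  by apply: le_trans (modulusD _ _) _; rewrite modulusN; exact: lerD.
apply: HM => // z pz; apply: le_trans (ler_norm _); apply: Hde.
have : `|z| <= X by rewrite leNgt; apply: contra pz => /pX ->.
by case: z {pz} => x t; rewrite plane_norm_le => /andP[h1 h2]; apply: lerD.
Unshelve. all: by end_near. Qed.
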